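(* Let $\nu>0$. There exists an open subset $\Omega\subset H^{1/2}_+$, independent of $(\alpha,\beta)\in\mathbb{R}^2$, such that for every $s>\frac12$ the set $\Omega\cap H^s_+$ is nonempty and, for every $\alpha\in\mathbb{R}$ and every $\beta\in\mathbb{R}$ with $\beta\neq 1$, every solution $u$ of the damped $(\alpha,\beta)$-Szegő equation $$i\partial_t u+i\nu (u\vert \mathbf{1}) = \Pi(|u|^2u)+\alpha (u\vert \mathbf{1})-\beta S\Pi(|S^*u|^2S^*u)$$ with $u(0)\in\Omega\cap H^s_+$ satisfies $$\Vert u(t)\Vert_{H^s}\longrightarrow+\infty\quad\text{as } t\to+\infty .$$ Furthermore, there exist rational initial data in $\Omega$ which generate stationary (i.e. time-independent) solutions of this equation for $\beta=1$ (with $\alpha\in\mathbb{R}$ arbitrary).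
   Context: Let $\mathbb{T}=\mathbb{R}/2\pi\mathbb{Z}$; functions on $\mathbb{T}$ are written as functions of $x$ or of $e^{ix}$. The inner product on $L^2(\mathbb{T})$ is $(f\vert g)=\frac1{2\pi}\int_{-\pi}^{\pi} f\overline g\,dx$, and $\mathbf{1}$ is the constant function $1$, so $(u\vert\mathbf 1)=\hat u(0)$. $L^2_+(\mathbb{T})$ is the closed subspace of $f\in L^2(\mathbb{T})$ with $\hat f(k)=0$ for all $k<0$, and $H^s_+=H^s(\mathbb{T})\cap L^2_+(\mathbb{T})$. The Szegő projector $\Pi:L^2(\mathbb{T})\to L^2_+(\mathbb{T})$ is $\Pi(u)=\sum_{k\ge0}\hat u(k)e^{ikx}$. The shift $S$ on $L^2_+$ is $Su=e^{ix}u$ and its adjoint is $S^*u=e^{-ix}(u-(u\vert\mathbf 1))$. The equation is globally well-posed on $H^s_+$ for every $s\ge\frac12$. A rational function is one of the form $P_1(e^{ix})/P_2(e^{ix})$ with $P_1,P_2$ polynomials, where $P_2$ has no zeros in the closed unit disk. *)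

(* Defs.v *)
From HB Require Import structures.
From mathcomp Require Import all_boot all_order all_algebra.
From mathcomp Require Import complex.
From mathcomp Require Import all_classical all_reals all_analysis.
Import Order.TTheory GRing.Theory Num.Theory.
Import numFieldNormedType.Exports.

Set Implicit Arguments.
Unset Strict Implicit.
Unset Printing Implicit Defensive.

Local Open Scope classical_set_scope.
Local Open Scope ring_scope.

(* A function on T = R/2piZ is a 2pi-periodic function R -> R[i].  Elements of
   L^2(T) are handled through Borel representatives; L2norm, Hnorm and the
   Fourier coefficients do not distinguish functions equal almost everywhere,
   so that an open set of H^s_+ is saturated for that relation. *)

Section Circle.
Context {R : realType}.
Local Notation C := R[i].
Implicit Types (f g : R -> C) (s : R) (k : int).

Definition period : set R := `[- pi, pi].

Definition cintegral f : C :=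
  Complex (Rintegral lebesgue_measure period (fun x => complex.Re (f x)))
          (Rintegral lebesgue_measure period (fun x => complex.Im (f x))).

Definition inner f g : C :=
  (real_complex R (2 * pi)^-1) * cintegral (fun x => f x * conjc (g x)).

Definition expi k (x : R) : C := Complex (cos (k%:~R * x)) (sin (k%:~R * x)).

Definition fun_one : R -> C := fun=> 1.

Definition fourier f k : C := inner f (expi k).

Definition L2norm f : \bar R :=
  ((((2 * pi)^-1)%:E *
    \int[lebesgue_measure]_(x in period) ((Normc.normc (f x)) ^+ 2)%:E)
   `^ 2^-1)%E.

Definition L2 : set (R -> C) := [set f |
  [/\ forall x, f (x + 2 * pi) = f x,
      measurable_fun setT (fun x => complex.Re (f x)),
      measurable_fun setT (fun x => complex.Im (f x)) &
      (L2norm f < +oo)%E]].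

Definition L2plus : set (R -> C) :=
  L2 `&` [set f | forall k, k < 0 -> fourier f k = 0].

Definition Hnorm s f : \bar R :=
  ((\esum_(k in [set: int])
      ((1 + k%:~R ^+ 2) `^ s * Normc.normc (fourier f k) ^+ 2)%:E)
   `^ 2^-1)%E.

Definition Hs s : set (R -> C) := L2 `&` [set f | (Hnorm s f < +oo)%E].

Definition Hplus s : set (R -> C) := Hs s `&` L2plus.

(* Topology of H^s_+ induced by its norm. *)
Definition open_in_Hplus s (Omega : set (R -> C)) : Prop :=
  Omega `<=` Hplus s /\
  forall f, Omega f -> exists2 eps : R, 0 < eps &
    forall g, Hplus s g -> (Hnorm s (g \- f)%R < eps%:E)%E -> Omega g.

(* g = sum_{k >= 0} \hat f(k) e^{ikx}, the series converging in L^2(T). *)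
Definition is_szego_proj f g : Prop :=
  L2 g /\
  L2norm (fun x => g x - \sum_(0 <= k < n) fourier f k%:Z * expi k%:Z x)
    @[n --> \oo] --> 0%E.

(* A representative of the sum (which exists for f in L^2 and is unique almost
   everywhere). *)
Definition szego_proj f : R -> C := xget (fun=> 0) [set g | is_szego_proj f g].

Definition hardy_shift f : R -> C := fun x => expi 1 x * f x.

Definition hardy_shift_adj f : R -> C := fun x => expi (- 1) x * (f x - inner f fun_one).

Definition cubic f : R -> C := fun x => `|f x| ^+ 2 * f x.

(* du is the derivative at time t >= 0 of u : [0, +oo[ -> L^2(T)
   (one-sided if t = 0). *)
Definition time_derivative (u : R -> R -> C) (t : R) (du : R -> C) : Prop :=
  L2 du /\
  L2norm (fun x => (real_complex R (r - t)^-1) * (u r x - u t x) - du x)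
    @[r --> within [set r : R | 0 <= r] t^'] --> 0%E.

(* u in C([0, +oo[, H^s_+), with the equation holding in L^2(T) at each time;
   u r is irrelevant for r < 0. *)
Definition szego_solution s (nu alpha beta : R) (u : R -> R -> C) : Prop :=
  [/\ forall t, 0 <= t -> Hplus s (u t),
      forall t, 0 <= t ->
        Hnorm s (u r \- u t)
          @[r --> within [set r : R | 0 <= r] (nbhs t)] --> 0%E &
      forall t, 0 <= t -> exists2 du : R -> C, time_derivative u t du &
        {ae lebesgue_measure, forall x, period x ->
          'i%C * du x + 'i%C * real_complex R nu * inner (u t) fun_one =
          szego_proj (cubic (u t)) x
          + real_complex R alpha * inner (u t) fun_one
          - real_complex R beta
            * hardy_shift (szego_proj (cubic (hardy_shift_adj (u t)))) x}].

Definition rational_fun f : Prop :=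
  exists P1 P2 : {poly C},
    (forall z : C, `|z| <= 1 -> P2.[z] != 0) /\
    (forall x, f x = P1.[expi 1 x] / P2.[expi 1 x]).

End Circle.

(* Main.v *)
(* Write a = conj(z) u and let H_a h = Pi(a conj(h)) be the shifted Hankel operator of u.
   The equation has a Lax pair for H_a although it is damped, so the sums kyfan n of the n
   largest eigenvalues of H_a^2 are constant in time, while |u|^2 decreases at the rate
   2 nu |(u|1)|^2.

   If u does not blow up in H^s, then u(t_n) tends to some v in the Wiener algebra along
   t_n -> +oo. The dissipation forces (u|1) to vanish asymptotically on windows of fixed
   length after t_n; differentiating, and using beta <> 1, all the moments (H_u^(2m+1) 1 | 1)
   vanish in the limit, for v. Then consecutive iterates H_v^n 1 and H_v^(n+1) 1 are orthogonal,
   and for a suitable n both nearly maximize |H_v h| / |h|. As |H_a h|^2 = |H_v h|^2 - |(v|h)|^2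
   for a = conj(z) v, testing H_a on this pair yields 2 kyfan 1 <= kyfan 2 + |v|^2. Here kyfan 1
   and kyfan 2 have kept their initial values and |v|^2 is at most the initial one, so that data
   with 2 kyfan 1 > kyfan 2 + |u|^2 blow up.

   Since kyfan 2 + |u|^2 <= sum (k + 1) |u_k|^2 and kyfan 1 is bounded below by testing H_a on
   h = 3 + 4 z + 3 z^2 + z^3, one gets a set of such data that is open in H^(1/2). It contains
   the polynomial - z + 5 z^2 + 5 z^3 + 3 z^4, which has (u|1) = 0 and (|u|^2 u|1) = 0 and is
   therefore stationary for beta = 1. *)

Require Import Defs.
From HB Require Import structures.
From mathcomp Require Import all_boot all_order all_algebra.
From mathcomp Require Import complex.
From mathcomp Require Import all_classical all_reals all_analysis.
From mathcomp Require Import measurable_realfun.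
From mathcomp Require Import ring lra zify.
Import Order.TTheory GRing.Theory Num.Theory.
Import numFieldNormedType.Exports.
Set Implicit Arguments.
Unset Strict Implicit.
Unset Printing Implicit Defensive.
Local Open Scope classical_set_scope.
Local Open Scope ring_scope.

(** * Complex-valued integrals and Fourier coefficients on the circle *)

(** The equation is an ordinary differential equation with a locally Lipschitz field on the Wiener
    algebra, into which [H^s] embeds compactly for [s > 1/2]; the dynamics takes place there. Two
    obstacles shape the argument. A solution is differentiable in time only for the L^2 norm, hence
    coefficient by coefficient, so conservation laws are derived from increments: a quantity that
    changes by at most [O(d^2)] over a time [d] is constant. And the Ky Fan sums are suprema over
    orthonormal families; near-maximizers stand for eigenvectors, being almost invariant under
    [H_a^2].

    The Lax pair survives the damping because [nu] and [alpha] only multiply a constant function,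
    and [conj(z)] times a constant is invisible to a Hankel operator. The value [beta = 1] is
    singular because, once [(u|1)] and [(|u|^2 u|1)] are small, the two cubic terms merge into
    [- i (1 - beta) Pi(|u|^2 u)], whose flow differentiates each odd moment into the next. Finally,
    some iterate of 1 nearly maximizes because a top eigenspace orthogonal to 1 would be stable
    under the backward shift, which compactness forbids. *)

Notation nrm := Normc.normc.

Section Modulus.
Context {R : realType}.
Implicit Types x y z : R[i].

Lemma nrmE x : nrm x = complex.Re `|x|. Proof. by rewrite normc_def; case: x. Qed.
Lemma nrmC x : (nrm x)%:C%C = `|x|. Proof. by rewrite normc_def; case: x. Qed.
Lemma nrm_ge0 x : 0 <= nrm x.
Proof. by case: x => a b; exact: sqrtr_ge0. Qed.
Lemma nrm0 : nrm (0 : R[i]) = 0. Proof. exact: Normc.normc0. Qed.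
Lemma nrm1 : nrm (1 : R[i]) = 1. Proof. exact: Normc.normc1. Qed.
Lemma nrmM x y : nrm (x * y) = nrm x * nrm y. Proof. exact: Normc.normcM. Qed.
Lemma nrmN x : nrm (- x) = nrm x. Proof. exact: normcN. Qed.
Lemma nrmD x y : nrm (x + y) <= nrm x + nrm y. Proof. exact: le_normcD. Qed.
Lemma nrmB x y : nrm (x - y) <= nrm x + nrm y.
Proof. by rewrite -(nrmN y) nrmD. Qed.
Lemma nrm_conj x : nrm (conjc x) = nrm x.
Proof. by rewrite !nrmE normcJ. Qed.
Lemma nrm_real (a : R) : nrm a%:C%C = `|a|.
Proof. by rewrite /= expr0n /= addr0 sqrtr_sqr. Qed.
Lemma nrm_i : nrm ('i%C : R[i]) = 1.
Proof. by rewrite /= expr0n /= expr1n add0r sqrtr1. Qed.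
Lemma nrm_eq0 x : nrm x = 0 -> x = 0. Proof. exact: Normc.eq0_normc. Qed.
Lemma nrm_sum I (r : seq I) (P : pred I) (F : I -> R[i]) :
  nrm (\sum_(i <- r | P i) F i) <= \sum_(i <- r | P i) nrm (F i).
Proof.
elim/big_rec2: _ => [|i a b _ h]; first by rewrite nrm0.
by apply: le_trans (nrmD _ _) _; rewrite lerD2l.
Qed.

Lemma absRe_le x : `|complex.Re x| <= nrm x.
Proof.
case: x => a b /=; rewrite -sqrtr_sqr ler_sqrt ?addr_ge0 ?sqr_ge0//.
by rewrite lerDl sqr_ge0.
Qed.
Lemma absIm_le x : `|complex.Im x| <= nrm x.
Proof.
case: x => a b /=; rewrite -sqrtr_sqr ler_sqrt ?addr_ge0 ?sqr_ge0//.
by rewrite lerDr sqr_ge0.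
Qed.
Lemma nrm_le_ReIm x : nrm x <= `|complex.Re x| + `|complex.Im x|.
Proof.
case: x => a b; rewrite -[Complex a b]/(Complex a b).
have -> : Complex a b = a%:C%C + 'i%C * b%:C%C by rewrite /=; simpc.
by apply: le_trans (nrmD _ _) _; rewrite nrmM nrm_i mul1r !nrm_real; simpc.
Qed.
Lemma mul_conj x : x * conjc x = (nrm x ^+ 2)%:C%C.
Proof. by rewrite -sqr_normc -nrmC rmorphXn. Qed.

Lemma rcB (a b : R) : (a - b)%:C%C = a%:C%C - b%:C%C :> R[i]. Proof. exact: rmorphB. Qed.
Lemma rcM (a b : R) : (a * b)%:C%C = a%:C%C * b%:C%C :> R[i]. Proof. exact: rmorphM. Qed.
Lemma conjcM x y : conjc (x * y) = conjc x * conjc y.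
Proof. exact: (rmorphM (@conjc R)). Qed.
Lemma conjcD x y : conjc (x + y) = conjc x + conjc y.
Proof. exact: (rmorphD (@conjc R)). Qed.
Lemma conjcN x : conjc (- x) = - conjc x.
Proof. exact: (rmorphN (@conjc R)). Qed.
Lemma conjc_rc (a : R) : conjc a%:C%C = a%:C%C. Proof. by rewrite /conjc /= oppr0. Qed.

(** Turns a modulus into the real part of a rotated number, so that real estimates (monotonicity of
    the integral, the mean value inequality) apply to complex quantities. *)
Lemma rotate x : exists2 w, nrm w = 1 & w * x = (nrm x)%:C%C.
Proof.
have [->|x0] := eqVneq x 0.
  by exists 1; rewrite ?nrm1 ?mul1r ?nrm0.
have n0 : nrm x != 0 by apply: contra x0 => /eqP/nrm_eq0 ->.
exists (conjc x * (nrm x)^-1%:C%C).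
  by rewrite nrmM nrm_conj nrm_real gtr0_norm ?divff ?invr_gt0 ?lt0r ?n0 ?nrm_ge0.
by rewrite mulrAC (mulrC (conjc x)) mul_conj -rmorphM expr2 mulfK.
Qed.

End Modulus.

Section CIntegral.
Context {R : realType}.
Local Notation C := R[i].
Local Notation mu := (@lebesgue_measure R).
Local Notation per := (@period R).
Implicit Types (f g : R -> C).

Lemma ae_filter_lebesgue : Filter (almost_everywhere mu).
Proof. exact: (@ae_filter_ringOfSetsType _ _ _ mu). Qed.

Lemma aeS (P Q : R -> Prop) : (forall x, P x -> Q x) ->
  {ae mu, forall x, P x} -> {ae mu, forall x, Q x}.
Proof. by move=> pq; apply: (@filterS _ _ ae_filter_lebesgue). Qed.

Lemma aeI (P Q : R -> Prop) : {ae mu, forall x, P x} -> {ae mu, forall x, Q x} ->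
  {ae mu, forall x, P x /\ Q x}.
Proof. exact: (@filterI _ _ ae_filter_lebesgue). Qed.

Definition cint f := mu.-integrable per (fun x => (complex.Re (f x))%:E) /\
  mu.-integrable per (fun x => (complex.Im (f x))%:E).

Lemma measurable_period : measurable (per : set (measurableTypeR R)).
Proof. exact: measurable_itv. Qed.
#[local] Hint Resolve measurable_period : core.

Lemma mu_period : mu per = (2 * pi)%:E.
Proof.
rewrite /period lebesgue_measure_itv/= lte_fin.
have p0 := pi_gt0 R.
have -> : - pi < pi :> R by lra.
by rewrite -EFinB; congr (_%:E); lra.
Qed.
Lemma mu_period_fin : (mu per < +oo)%E. Proof. by rewrite mu_period ltry. Qed.

Lemma cintD f g : cint f -> cint g -> cint (fun x => f x + g x).
Proof.
move=> [f1 f2] [g1 g2]; split; [have := integrableD measurable_period f1 g1|have := integrableD measurable_period f2 g2];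
  apply: eq_integrable => // x _ /=; rewrite -EFinD; by case: (f x) (g x) => ? ? [].
Qed.

Lemma cintZ (c : C) f : cint f -> cint (fun x => c * f x).
Proof.
case: c => a b [f1 f2]; split.
  have := integrableB measurable_period (integrableZl measurable_period a f1) (integrableZl measurable_period b f2).
  by apply: eq_integrable => // x _ /=; case: (f x) => ? ? /=; rewrite -!EFinM -EFinB.
have := integrableD measurable_period (integrableZl measurable_period a f2) (integrableZl measurable_period b f1).
by apply: eq_integrable => // x _ /=; case: (f x) => u v /=; rewrite -!EFinM -EFinD.
Qed.

Lemma cintegralD f g : cint f -> cint g ->
  cintegral (fun x => f x + g x) = cintegral f + cintegral g.
Proof.
move=> [f1 f2] [g1 g2]; rewrite /cintegral.
have e1 x : complex.Re (f x + g x) = complex.Re (f x) + complex.Re (g x) by case: (f x) (g x) => ? ? [].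
have e2 x : complex.Im (f x + g x) = complex.Im (f x) + complex.Im (g x) by case: (f x) (g x) => ? ? [].
under eq_Rintegral do rewrite e1.
under [X in Complex _ X = _]eq_Rintegral do rewrite e2.
by rewrite !RintegralD.
Qed.

Lemma cintegralZ c f : cint f -> cintegral (fun x => c * f x) = c * cintegral f.
Proof.
case: c => a b [f1 f2]; rewrite /cintegral.
have e1 x : complex.Re (Complex a b * f x) = a * complex.Re (f x) - b * complex.Im (f x) by case: (f x).
have e2 x : complex.Im (Complex a b * f x) = a * complex.Im (f x) + b * complex.Re (f x) by case: (f x).
under eq_Rintegral do rewrite e1.
under [X in Complex _ X = _]eq_Rintegral do rewrite e2.
have i1 r : mu.-integrable per (EFin \o (fun x => r * complex.Re (f x))).
  by have := integrableZl measurable_period r f1; apply: eq_integrable.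
have i2 r : mu.-integrable per (EFin \o (fun x => r * complex.Im (f x))).
  by have := integrableZl measurable_period r f2; apply: eq_integrable.
by rewrite RintegralB// RintegralD// !RintegralZl.
Qed.

Lemma cintegral_ext f g : (forall x, per x -> f x = g x) -> cintegral f = cintegral g.
Proof.
by move=> fg; rewrite /cintegral; congr Complex; apply: eq_Rintegral => x;
  rewrite inE => /fg ->.
Qed.

Lemma cint_ext f g : (forall x, per x -> f x = g x) -> cint f -> cint g.
Proof.
by move=> fg [f1 f2]; split; [move: f1|move: f2]; apply: eq_integrable => // x;
  rewrite inE => /fg ->.
Qed.

Definition cmeas f := measurable_fun per (fun x => complex.Re (f x)) /\
  measurable_fun per (fun x => complex.Im (f x)).

Lemma cint_meas f : cint f -> cmeas f.
Proof. by move=> [/measurable_int/measurable_EFinP ? /measurable_int/measurable_EFinP]. Qed.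

Lemma cmeasM f g : cmeas f -> cmeas g -> cmeas (fun x => f x * g x).
Proof.
move=> [f1 f2] [g1 g2]; split.
  have := measurable_funB (measurable_funM f1 g1) (measurable_funM f2 g2).
  by apply: eq_measurable_fun => x _ /=; case: (f x) (g x) => ? ? [].
have := measurable_funD (measurable_funM f1 g2) (measurable_funM f2 g1).
by apply: eq_measurable_fun => x _ /=; case: (f x) (g x) => ? ? [].
Qed.

Lemma cmeasD f g : cmeas f -> cmeas g -> cmeas (fun x => f x + g x).
Proof.
move=> [f1 f2] [g1 g2]; split.
  have := measurable_funD f1 g1.
  by apply: eq_measurable_fun => x _ /=; case: (f x) (g x) => ? ? [].
have := measurable_funD f2 g2.
by apply: eq_measurable_fun => x _ /=; case: (f x) (g x) => ? ? [].
Qed.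

Lemma cmeas_conj f : cmeas f -> cmeas (fun x => conjc (f x)).
Proof.
move=> [f1 f2]; split.
  by move: f1; apply: eq_measurable_fun => x _ /=; case: (f x).
have := measurableT_comp (@oppr_measurable R setT) f2.
by apply: eq_measurable_fun => x _ /=; case: (f x).
Qed.

Lemma cmeas_cst (c : C) : cmeas (fun=> c).
Proof. by split; exact: measurable_cst. Qed.

Lemma cmeasB f g : cmeas f -> cmeas g -> cmeas (fun x => f x - g x).
Proof.
move=> mf mg; have := cmeasD mf (cmeasM (cmeas_cst (-1)) mg).
by under eq_fun do rewrite mulN1r.
Qed.

Lemma measurable_nrm f : cmeas f -> measurable_fun per (fun x => nrm (f x)).
Proof.
move=> [f1 f2].
have := measurableT_comp (continuous_measurable_fun (@sqrt_continuous R)) (measurable_funD (measurable_funM f1 f1) (measurable_funM f2 f2)).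
by apply: eq_measurable_fun => x _ /=; case: (f x).
Qed.

Lemma cint_dom f (h : R -> R) : cmeas f -> mu.-integrable per (EFin \o h) ->
  (forall x, per x -> nrm (f x) <= h x) -> cint f.
Proof.
move=> [f1 f2] ih hb; split; apply: le_integrable ih => //; try exact/measurable_EFinP.
  move=> x px; rewrite /= lee_fin; apply: le_trans (absRe_le _) _.
  by apply: le_trans (hb _ px) (ler_norm _).
move=> x px; rewrite /= lee_fin; apply: le_trans (absIm_le _) _.
by apply: le_trans (hb _ px) (ler_norm _).
Qed.

Lemma integrable_nrm f : cint f -> mu.-integrable per (EFin \o (fun x => nrm (f x))).
Proof.
move=> cf; have [f1 f2] := cf.
have := integrableD measurable_period (integrable_abse f1) (integrable_abse f2).
apply: le_integrable => //.
  apply/measurable_EFinP; exact: measurable_nrm (cint_meas cf).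
move=> x px.
change ((`|nrm (f x)|)%:E <= (`|(`|complex.Re (f x)| + `|complex.Im (f x)|)|)%:E)%E.
rewrite lee_fin (ger0_norm (nrm_ge0 _)) ger0_norm ?addr_ge0//.
exact: nrm_le_ReIm.
Qed.

Lemma cintM_bnd f g (B : R) : cint f -> cmeas g -> (forall x, per x -> nrm (g x) <= B) ->
  cint (fun x => f x * g x).
Proof.
move=> cf mg gB; apply: (@cint_dom _ (fun x => B * nrm (f x))).
- exact: cmeasM (cint_meas cf) mg.
- have := integrableZl measurable_period B (integrable_nrm cf).
  by apply: eq_integrable.
- by move=> x px; rewrite nrmM mulrC ler_wpM2r ?nrm_ge0 ?gB.
Qed.

Lemma integrable_cst_period (k : R) : mu.-integrable per (EFin \o (fun=> k)).
Proof.
apply: measurable_bounded_integrable => //; first exact: mu_period_fin.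
exists `|k|; split => // M kM x _; exact: ltW.
Qed.

Lemma cint_cst (c : C) : cint (fun=> c).
Proof.
apply: (@cint_dom _ (fun=> nrm c)); [exact: cmeas_cst| |by []].
exact: integrable_cst_period.
Qed.

Lemma cint_bnd f (B : R) : cmeas f -> (forall x, per x -> nrm (f x) <= B) -> cint f.
Proof.
move=> mf fB; apply: (@cint_dom _ (fun=> B)) => //.
exact: integrable_cst_period.
Qed.

Lemma nrm_cintegral_le f : cint f ->
  nrm (cintegral f) <= Rintegral mu per (fun x => nrm (f x)).
Proof.
move=> cf; have [w w1 we] := rotate (cintegral f).
have -> : nrm (cintegral f) = complex.Re (w * cintegral f) by rewrite we.
rewrite -cintegralZ//= ; apply: le_Rintegral => //.
- by have [] := cintZ w cf.
- exact: integrable_nrm.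
- move=> x px; apply: le_trans (ler_norm _) _; apply: le_trans (absRe_le _) _.
  by rewrite nrmM w1 mul1r.
Qed.

Lemma nrm_cintegral_bnd f (B : R) : cint f -> (forall x, per x -> nrm (f x) <= B) ->
  nrm (cintegral f) <= 2 * pi * B.
Proof.
move=> cf fB; apply: le_trans (nrm_cintegral_le cf) _.
have -> : 2 * pi * B = Rintegral mu per (fun=> B).
  by rewrite Rintegral_cst//= [X in fine X]mu_period mulrC.
apply: le_Rintegral => //; first exact: integrable_nrm.
exact: integrable_cst_period.
Qed.

Lemma cintegral_ae f g : cint f -> cmeas g ->
  {ae mu, forall x, per x -> f x = g x} -> cintegral f = cintegral g.
Proof.
move=> cf [g1 g2] fg; have [f1 f2] := cint_meas cf.
rewrite /cintegral /Rintegral; congr Complex; congr fine; apply: ae_eq_integral => //.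
- exact/measurable_EFinP.
- exact/measurable_EFinP.
- by move: fg; apply: aeS => x h px; rewrite /= h.
- exact/measurable_EFinP.
- exact/measurable_EFinP.
- by move: fg; apply: aeS => x h px; rewrite /= h.
Qed.

End CIntegral.

Section Fourier.
Context {R : realType}.
Local Notation C := R[i].
Local Notation mu := (@lebesgue_measure R).
Local Notation per := (@period R).
Implicit Types (f g : R -> C) (k j : int).

Lemma expi0 x : expi 0 x = 1 :> C.
Proof. by rewrite /expi mul0r cos0 sin0. Qed.
Lemma expiD j k (x : R) : expi (j + k) x = expi j x * expi k x.
Proof. by rewrite /expi rmorphD mulrDl cosD sinD; simpc; rewrite [X in (_ +i* X)%C]addrC [sin _ * _]mulrC. Qed.
Lemma conj_expi k (x : R) : conjc (expi k x) = expi (- k) x.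
Proof. by rewrite /expi rmorphN mulNr cosN sinN. Qed.
Lemma nrm_expi k (x : R) : nrm (expi k x) = 1.
Proof. by rewrite /= cos2Dsin2 sqrtr1. Qed.

Lemma expi_periodic k (x : R) : expi k (x + 2 * pi) = expi k x.
Proof.
have sh (n : nat) y : cos (y + n%:R * (2 * pi)) = cos y :> R /\ sin (y + n%:R * (2 * pi)) = sin y :> R.
  elim: n => [|n [IH1 IH2]]; first by rewrite mul0r addr0.
  rewrite -natr1 mulrDl mul1r addrA (_ : 2 * pi = pi *+ 2); last by rewrite mulr_natl.
  by rewrite cosD2pi sinD2pi -[pi *+ 2]mulr_natl.
rewrite /expi mulrDr; case: k => n.
  by have [] := sh n ((Posz n)%:~R * x); rewrite -pmulrn => -> ->.
have -> : (Negz n)%:~R = - n.+1%:R :> R by rewrite NegzE mulrNz.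
have [] := sh n.+1 (- n.+1%:R * x + - n.+1%:R * (2 * pi)).
by rewrite -addrA -mulrDl addNr mul0r addr0 => <- <-.
Qed.

Lemma continuous_expi_Re k : continuous (fun x : R => complex.Re (expi k x)).
Proof.
move=> x; apply: continuous_comp; [exact: mulrl_continuous|exact: continuous_cos].
Qed.
Lemma continuous_expi_Im k : continuous (fun x : R => complex.Im (expi k x)).
Proof.
move=> x; apply: continuous_comp; [exact: mulrl_continuous|exact: continuous_sin].
Qed.

Lemma cmeas_continuous f : continuous (fun x => complex.Re (f x)) ->
  continuous (fun x => complex.Im (f x)) -> cmeas f.
Proof. by move=> c1 c2; split; apply: measurable_funTS; exact: continuous_measurable_fun. Qed.

Lemma cmeas_expi k : cmeas (@expi R k).
Proof. by apply: cmeas_continuous; [exact: continuous_expi_Re|exact: continuous_expi_Im]. Qed.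

Lemma cintM_expi f k : cint f -> cint (fun x => f x * expi k x).
Proof.
move=> cf; apply: (cintM_bnd (B := 1)) => //; first exact: cmeas_expi.
by move=> x _; rewrite nrm_expi.
Qed.

Lemma Rintegral_derive (F f : R -> R) : (forall x, is_derive x (1:R) F (f x)) ->
  continuous f -> Rintegral mu per f = F pi - F (- pi).
Proof.
move=> dF cf; rewrite /Rintegral /period.
rewrite (@continuous_FTC2 _ f F)//=.
- by have := pi_gt0 R; lra.
- exact: continuous_subspaceT.
- have cF x : {for x, continuous F}.
    apply: differentiable_continuous; apply/derivable1_diffP.
    by have [] := dF x.
  split; first by move=> x _; have [] := dF x.
    by apply: cvg_at_right_filter; exact: cF.
  by apply: cvg_at_left_filter; exact: cF.
- by move=> x _; rewrite derive1E; have [] := dF x.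
Qed.

Lemma cintegral_expi k : cintegral (@expi R k) = if k == 0 then (2 * pi)%:C%C else 0.
Proof.
case: eqP => [->|/eqP k0].
  rewrite (@cintegral_ext _ _ (fun=> 1)); last by move=> x _; rewrite expi0.
  rewrite /cintegral/= !Rintegral_cst ?mul0r ?mul1r//=; try exact: measurable_period.
  by rewrite [X in fine X]mu_period.
have k0' : k%:~R != 0 :> R by rewrite intr_eq0.
have dl x : is_derive x (1:R) (fun y : R => k%:~R * y) k%:~R.
  by have := @is_deriveZ _ _ _ id k%:~R x 1 1 _; rewrite /GRing.scale/= mulr1; apply.
have pe : expi k (- pi) = expi k (pi : R).
  by rewrite -[in RHS](_ : - pi + 2 * pi = pi) ?expi_periodic//; ring.
have d1 (x : R) : is_derive x (1:R) (fun y : R => k%:~R^-1 * sin (k%:~R * y)) (complex.Re (expi k x)).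
  have := @is_deriveZ _ _ _ _ k%:~R^-1 x 1 _ (is_derive1_comp (is_derive_sin (k%:~R * x)) (dl x)).
  by rewrite /GRing.scale/= mulrC mulfK.
have d2 (x : R) : is_derive x (1:R) (fun y : R => - k%:~R^-1 * cos (k%:~R * y)) (complex.Im (expi k x)).
  have := @is_deriveZ _ _ _ _ (- k%:~R^-1) x 1 _ (is_derive1_comp (is_derive_cos (k%:~R * x)) (dl x)).
  rewrite (_ : complex.Im _ = - k%:~R^-1 *: (- sin (k%:~R * x) * k%:~R)) // /GRing.scale /=.
  by field.
have e1 := Rintegral_derive d1 (@continuous_expi_Re k).
have e2 := Rintegral_derive d2 (@continuous_expi_Im k).
move: pe => [p1 p2].
by rewrite /cintegral e1 e2 p1 p2 !subrr.
Qed.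

Lemma cintegral_conj f : cint f -> cintegral (fun x => conjc (f x)) = conjc (cintegral f).
Proof.
move=> [f1 f2]; rewrite /cintegral.
have e1 x : complex.Re (conjc (f x)) = complex.Re (f x) by case: (f x).
have e2 x : complex.Im (conjc (f x)) = (-1) * complex.Im (f x) by case: (f x) => ? ? /=; rewrite mulN1r.
under eq_Rintegral do rewrite e1.
under [X in Complex _ X = _]eq_Rintegral do rewrite e2.
by rewrite RintegralZl ?mulN1r//; exact: measurable_period.
Qed.

Lemma fourierE f k :
  fourier f k = (2 * pi)^-1%:C%C * cintegral (fun x => f x * expi (- k) x).
Proof.
rewrite /fourier /inner; congr (_ * _); apply: cintegral_ext => x _.
by rewrite conj_expi.
Qed.

Lemma twopi_neq0 : (2 * pi)%:C%C != 0 :> C.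
Proof. by rewrite eq_complex /= eqxx andbT mulf_neq0 ?pnatr_eq0// gt_eqF ?pi_gt0. Qed.

Lemma fourierD f g k : cint f -> cint g ->
  fourier (fun x => f x + g x) k = fourier f k + fourier g k.
Proof.
move=> cf cg; rewrite !fourierE -mulrDr -cintegralD; [|exact: cintM_expi..].
by congr (_ * _); apply: cintegral_ext => x _; rewrite mulrDl.
Qed.

Lemma fourierZ c f k : cint f -> fourier (fun x => c * f x) k = c * fourier f k.
Proof.
move=> cf; rewrite !fourierE mulrCA -(cintegralZ c (cintM_expi _ cf)).
by congr (_ * _); apply: cintegral_ext => x _; rewrite mulrA.
Qed.

Lemma fourier_ext f g k : (forall x, per x -> f x = g x) -> fourier f k = fourier g k.
Proof.
by move=> fg; rewrite !fourierE; congr (_ * _); apply: cintegral_ext => x px; rewrite fg.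
Qed.

Lemma fourier_ae f g k : cint f -> cmeas g ->
  {ae mu, forall x, per x -> f x = g x} -> fourier f k = fourier g k.
Proof.
move=> cf mg fg; rewrite !fourierE; congr (_ * _); apply: cintegral_ae.
- exact: cintM_expi.
- exact: cmeasM mg (cmeas_expi _).
- by move: fg; apply: aeS => x h px; rewrite h.
Qed.

Lemma fourierB f g k : cint f -> cint g ->
  fourier (fun x => f x - g x) k = fourier f k - fourier g k.
Proof.
move=> cf cg; rewrite -mulN1r -fourierZ// -fourierD//; last exact: cintZ.
by apply: fourier_ext => x _; rewrite mulN1r.
Qed.

Lemma fourier_shift f j k : fourier (fun x => f x * expi j x) k = fourier f (k - j).
Proof.
rewrite !fourierE; congr (_ * _); apply: cintegral_ext => x _.
by rewrite -mulrA -expiD opprB addrC.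
Qed.

Lemma fourier_conj f k : cint f -> fourier (fun x => conjc (f x)) k = conjc (fourier f (- k)).
Proof.
move=> cf; rewrite !fourierE conjcM conjc_rc -(cintegral_conj (cintM_expi _ cf)).
congr (_ * _).
by apply: cintegral_ext => x _; rewrite conjcM conj_expi opprK.
Qed.

Lemma cint_expi k : cint (@expi R k).
Proof.
apply: (@cint_bnd _ _ 1); first exact: cmeas_expi.
by move=> x _; rewrite nrm_expi.
Qed.

Lemma fourier_expi j k : fourier (@expi R j) k = (j == k)%:R.
Proof.
rewrite fourierE (@cintegral_ext _ _ (expi (j - k))); last by move=> x _; rewrite expiD.
rewrite cintegral_expi subr_eq0; case: eqP => _; last by rewrite mulr0.
by rewrite fmorphV mulVf// twopi_neq0.
Qed.

Lemma nrm_fourier_int f k : cint f ->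
  nrm (fourier f k) <= (2 * pi)^-1 * Rintegral mu per (fun x => nrm (f x)).
Proof.
move=> cf; rewrite fourierE nrmM nrm_real ger0_norm ?invr_ge0 ?mulr_ge0 ?pi_ge0//.
rewrite ler_wpM2l ?invr_ge0 ?mulr_ge0 ?pi_ge0//.
apply: le_trans (nrm_cintegral_le (cintM_expi _ cf)) _.
rewrite le_eqVlt; apply/orP; left; apply/eqP; apply: eq_Rintegral => x _.
by rewrite nrmM nrm_expi mulr1.
Qed.

Lemma nrm_fourier_bnd f k (B : R) : cint f -> (forall x, per x -> nrm (f x) <= B) ->
  nrm (fourier f k) <= B.
Proof.
move=> cf fB; rewrite fourierE nrmM nrm_real ger0_norm ?invr_ge0 ?mulr_ge0 ?pi_ge0//.
rewrite ler_pdivrMl ?mulr_gt0 ?pi_gt0//.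
apply: nrm_cintegral_bnd; first exact: cintM_expi.
by move=> x px; rewrite nrmM nrm_expi mulr1 fB.
Qed.

End Fourier.

(** * Uniqueness of the Fourier coefficients *)

Section Uniqueness.
Context {R : realType}.
Local Notation C := R[i].
Local Notation mu := (@lebesgue_measure R).
Local Notation per := (@period R).
Implicit Types (f g : R -> C) (k j : int).

(** Asking for every [k], and not only for the mean, makes the class stable under multiplication by
    trigonometric polynomials. *)
Definition annihilates f := cint f /\ forall k, fourier f k = 0.

Lemma annihilatesD f g : annihilates f -> annihilates g -> annihilates (fun x => f x + g x).
Proof.
move=> [cf f0] [cg g0]; split=> [|k]; first exact: cintD.
by rewrite fourierD// f0 g0 addr0.
Qed.
Lemma annihilatesZ c f : annihilates f -> annihilates (fun x => c * f x).
Proof.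
move=> [cf f0]; split=> [|k]; first exact: cintZ.
by rewrite fourierZ// f0 mulr0.
Qed.
Lemma annihilates_expi j f : annihilates f -> annihilates (fun x => f x * expi j x).
Proof.
move=> [cf f0]; split=> [|k]; first exact: cintM_expi.
by rewrite fourier_shift f0.
Qed.
Lemma annihilates_cos (c : R) f : annihilates f -> annihilates (fun x => f x * (cos (x - c))%:C%C).
Proof.
move=> af.
have := annihilatesD (annihilatesZ (expi 1 (- c) / 2) (annihilates_expi 1 af))
  (annihilatesZ (expi (- 1) (- c) / 2) (annihilates_expi (- 1) af)).
congr annihilates; apply/funext => x.
have -> : (cos (x - c))%:C%C = (expi 1 (x - c) + expi (- 1) (x - c)) / 2.
  apply: (@mulIf _ 2); rewrite ?pnatr_eq0// -mulrA mulVf ?pnatr_eq0// mulr1.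
  rewrite /expi rmorphN !mulNr !mul1r cosN sinN; simpc.
  by congr Complex; ring.
have ed k : expi k (x - c) = expi k x * expi k (- c).
  by rewrite /expi mulrDr cosD sinD; simpc; congr Complex; rewrite addrC mulrC [X in _ + X]mulrC.
by rewrite !ed; ring.
Qed.

(** A trigonometric polynomial with values in [[0, 1]] when [0 <= rho <= 1], zero at [c] and growing
    with the distance to [c] on the circle: its sublevel sets are arcs, whose indicators are
    approximated by [(1 - bump^n)^(K^n)]. *)
Definition bump (rho c x : R) : R := rho / 2 * (1 - cos (x - c)).

Lemma annihilates_bump rho c n m f : annihilates f ->
  annihilates (fun x => f x * ((1 - bump rho c x ^+ n) ^+ m)%:C%C).
Proof.
have one g : annihilates g -> annihilates (fun x => g x * (bump rho c x)%:C%C).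
  move=> ag; have := annihilatesD (annihilatesZ (rho / 2)%:C%C ag)
     (annihilatesZ (- (rho / 2)%:C%C) (annihilates_cos c ag)).
  congr annihilates; apply/funext => x.
  by rewrite /bump !rcM rcB; ring.
have pw g : annihilates g -> annihilates (fun x => g x * (bump rho c x ^+ n)%:C%C).
  move=> ag; elim: n => [|n IH].
    by move: ag; congr annihilates; apply/funext => x; rewrite expr0 mulr1.
  by move: (one _ IH); congr annihilates; apply/funext => x; rewrite exprSr rcM mulrA.
move=> af; elim: m => [|m IH].
  by move: af; congr annihilates; apply/funext => x; rewrite expr0 mulr1.
have := annihilatesD IH (annihilatesZ (-1) (pw _ IH)).
congr annihilates; apply/funext => x.
by rewrite exprSr rcM rcB; ring.
Qed.

End Uniqueness.

Section Uniqueness2.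
Context {R : realType}.
Local Notation C := R[i].
Local Notation mu := (@lebesgue_measure R).
Local Notation per := (@period R).
Implicit Types (f g : R -> C) (k j : int).

Lemma bernoulli_ge (y : R) m : 0 <= y <= 1 -> 1 - m%:R * y <= (1 - y) ^+ m.
Proof.
move=> /andP[y0 y1]; elim: m => [|m IH]; first by rewrite mul0r subr0 expr0.
rewrite exprS -natr1; apply: (@le_trans _ _ ((1 - y) * (1 - m%:R * y))).
  have : 0 <= m%:R * y * y by rewrite !mulr_ge0.
  lra.
by rewrite ler_wpM2l// subr_ge0.
Qed.

Lemma bernoulli_le (y : R) m : 0 <= y <= 1 -> (1 - y) ^+ m * (1 + m%:R * y) <= 1.
Proof.
move=> /andP[y0 y1].
have h : 1 + m%:R * y <= (1 + y) ^+ m.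
  elim: m => [|m IH]; first by rewrite mul0r addr0 expr0.
  rewrite exprS -natr1; apply: (@le_trans _ _ ((1 + y) * (1 + m%:R * y))).
    have : 0 <= m%:R * y * y by rewrite !mulr_ge0.
    lra.
  by rewrite ler_wpM2l// addr_ge0.
apply: (@le_trans _ _ ((1 - y) ^+ m * (1 + y) ^+ m)).
  by rewrite ler_wpM2l// exprn_ge0// subr_ge0.
rewrite -exprMn exprn_ile1//.
  by rewrite mulr_ge0 ?subr_ge0// addr_ge0.
have : 0 <= y * y by rewrite mulr_ge0.
by lra.
Qed.

(* The polynomials [(1 - t^n)^(K^n)] of the Stone-Weierstrass theorem approximate
   the indicator function of [t < 1/K]. *)
Lemma step_cvg (t : R) (K : nat) : 0 <= t <= 1 -> K%:R * t != 1 ->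
  (1 - t ^+ n) ^+ (K ^ n)%N @[n --> \oo] --> (if K%:R * t < 1 then 1 else 0 : R).
Proof.
move=> /andP[t0 t1] Kt.
have tn n : 0 <= t ^+ n <= 1 by rewrite exprn_ge0 ?exprn_ile1.
have a0 : 0 <= K%:R * t by rewrite mulr_ge0.
have [lt1|gt1|e] := ltgtP (K%:R * t) 1; last by rewrite e eqxx in Kt.
  apply: (@squeeze_cvgr _ _ _ _ (fun n => 1 - (K%:R * t) ^+ n) (fun=> 1)).
  - near=> n; apply/andP; split.
      by rewrite exprMn -natrX; exact: bernoulli_ge.
    have /andP[u0 u1] := tn n.
    by rewrite exprn_ile1// ?subr_ge0// gerBl.
  - rewrite -[X in _ --> X]subr0; apply: cvgB; first exact: cvg_cst.
    by apply: cvg_expr; rewrite ger0_norm.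
  - exact: cvg_cst.
have e0 : ((K%:R * t) ^- n) @[n --> \oo] --> (0 : R).
  under eq_fun do rewrite -exprVn.
  apply: cvg_expr; rewrite normfV ger0_norm// invf_lt1//; exact: lt_trans gt1.
apply: (@squeeze_cvgr _ _ _ _ (fun=> 0) (fun n => (K%:R * t) ^- n)) => //; last exact: cvg_cst.
near=> n; have /andP[u0 u1] := tn n; apply/andP; split.
  by rewrite exprn_ge0// subr_ge0.
have p0 : 0 < (K%:R * t) ^+ n by rewrite exprn_gt0// (lt_trans _ gt1).
rewrite -[_ ^- n]mul1r ler_pdivlMr//; apply: le_trans (bernoulli_le (K ^ n) (tn n)).
rewrite ler_wpM2l ?exprn_ge0 ?subr_ge0//.
by rewrite natrX -exprMn lerDr.
Unshelve. all: by end_near. Qed.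

Lemma bump_range (rho c x : R) : 0 <= rho <= 1 -> 0 <= bump rho c x <= 1.
Proof.
move=> /andP[r0 r1]; have := cos_le1 (x - c); have := cos_geN1 (x - c).
rewrite /bump => h1 h2; apply/andP; split.
  by rewrite mulr_ge0 ?divr_ge0 ?subr_ge0.
have : rho / 2 * (1 - cos (x - c)) <= rho / 2 * 2.
  by rewrite ler_wpM2l ?divr_ge0//; lra.
by lra.
Qed.

(** Beyond [pi], reflecting [|y|] into [2 pi - |y|] extends the comparison up to [2 pi - r]; this
    covers the distances from any point of the period to the centre of the arc. *)
Lemma cos_lt_arc (y r : R) : 0 < r < pi -> `|y| < 2 * pi - r -> (cos r < cos y) = (`|y| < r).
Proof.
move=> /andP[r0 rp] yb.
have ci a b : 0 <= a <= pi -> 0 <= b <= pi -> (cos a < cos b :> R) = (b < a).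
  by move=> ha hb; rewrite ltr_cos// in_itv.
have <- : cos `|y| = cos y by case: (ger0P y) => // _; rewrite cosN.
have n0 := normr_ge0 y.
have [yp|yp] := leP `|y| pi; first by rewrite ci//; apply/andP; split=> //; exact: ltW.
have -> : cos `|y| = cos (2 * pi - `|y|).
  by rewrite -[in RHS]cosN opprB -[in LHS](subrK (2 * pi) `|y|) mulr_natl cosD2pi.
by rewrite ci; [lra|apply/andP; split; lra|apply/andP; split; lra].
Qed.

Lemma cos_eq_arc (y r : R) : 0 < r < pi -> `|y| < 2 * pi - r -> cos y = cos r -> `|y| = r.
Proof.
move=> /andP[r0 rp] yb.
have n0 := normr_ge0 y.
have <- : cos `|y| = cos y by case: (ger0P y) => // _; rewrite cosN.
have [yp|yp] := leP `|y| pi.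
  by move=> h; apply: cos_inj h; rewrite in_itv/= ?n0 ?yp ?(ltW r0) ?(ltW rp).
have -> : cos `|y| = cos (2 * pi - `|y|).
  by rewrite -[in RHS]cosN opprB -[in LHS](subrK (2 * pi) `|y|) mulr_natl cosD2pi.
by move=> /cos_inj; rewrite !in_itv/= => h; have := h (ltac:(lra)) (ltac:(lra)); lra.
Qed.

Lemma ae_neq (a : R) : {ae mu, forall x, x != a}.
Proof.
exists [set a]; split; [exact: measurable_set1|exact: lebesgue_measure_set1|].
by move=> x /= /negP; rewrite negbK => /eqP.
Qed.

(** The product of [f] with each approximate indicator of the arc has zero mean; dominated
    convergence passes to the indicator itself. *)
Lemma integral_arc0 f (c r : R) : annihilates f -> 0 < r -> `|c| + r < pi ->
  Rintegral mu `]c - r, c + r[ (fun x => complex.Re (f x)) = 0.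
Proof.
move=> af r0 cr; have p0 := pi_gt0 R; have c0 := normr_ge0 c.
have rp : r < pi by lra.
have [cf _] := af.
have cr1 : cos r < 1.
  by rewrite -(@cos0 R) ltr_cos ?in_itv/= ?lexx ?ltW.
have d0 : 0 < 1 - cos r by lra.
pose K := (Num.trunc (2 / (1 - cos r))).+1.
have K0 : (0 : R) < K%:R by rewrite ltr0n.
have KE : 2 / (1 - cos r) < K%:R :> R.
  by have := @truncnS_gt R (2 / (1 - cos r)).
(* With this [rho], [K * bump] equals [(1 - cos (x - c)) / (1 - cos r)], which is below 1 exactly on
   the arc; [K > 2 / (1 - cos r)] keeps [rho] below 1. *)
pose rho := 2 / (K%:R * (1 - cos r)).
have rho01 : 0 <= rho <= 1.
  apply/andP; rewrite /rho; split; first by rewrite divr_ge0 ?mulr_ge0 ?ltW.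
  rewrite ler_pdivrMr ?mulr_gt0// mul1r.
  by rewrite -ler_pdivrMr// ltW.
have arc x : per x -> (K%:R * bump rho c x < 1) = (c - r < x < c + r).
  rewrite /period/= in_itv/= => /andP[x1 x2].
  have -> : K%:R * bump rho c x = (1 - cos (x - c)) / (1 - cos r).
    by rewrite /bump /rho; field; rewrite !gt_eqF.
  rewrite ltr_pdivrMr// mul1r ltrD2l ltrN2 cos_lt_arc ?r0//.
    by rewrite ltr_norml; apply/idP/idP => /andP[? ?]; apply/andP; split; lra.
  have : `|x - c| <= pi + `|c|.
    by apply: le_trans (ler_normB _ _) _; rewrite lerD2r ler_norml x1.
  lra.
have arceq x : per x -> x != c - r -> x != c + r -> K%:R * bump rho c x != 1.
  rewrite /period/= in_itv/= => /andP[x1 x2] n1 n2.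
  have -> : K%:R * bump rho c x = (1 - cos (x - c)) / (1 - cos r).
    by rewrite /bump /rho; field; rewrite !gt_eqF.
  apply/eqP => /(congr1 (fun y => y * (1 - cos r))); rewrite mulfVK ?gt_eqF// mul1r => e.
  have ce : cos (x - c) = cos r by lra.
  have : `|x - c| <= pi + `|c|.
    by apply: le_trans (ler_normB _ _) _; rewrite lerD2r ler_norml x1.
  move=> b; have /eqP := cos_eq_arc (introT andP (conj r0 rp)) (ltac:(lra) : `|x - c| < 2 * pi - r) ce.
  rewrite eqr_norml ltW// andbT => /orP[/eqP h|/eqP h].
    by move/eqP: n2; apply; lra.
  by move/eqP: n1; apply; lra.
pose q n x := (1 - bump rho c x ^+ n) ^+ (K ^ n)%N.
pose fl x := (complex.Re (f x) * \1_(`]c - r, c + r[%classic) x).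
have mre : measurable_fun per (fun x => complex.Re (f x)).
  by have [] := cint_meas cf.
have aq n : cint (fun x => f x * (q n x)%:C%C) /\ Rintegral mu per (fun x => complex.Re (f x) * q n x) = 0.
  have [ci h] := annihilates_bump rho c n (K ^ n)%N af; split => //.
  have := h 0; rewrite fourierE => /eqP; rewrite mulf_eq0 => /orP[|].
    by rewrite eq_complex /= eqxx andbT invr_eq0 mulf_eq0 pnatr_eq0/= gt_eqF.
  move=> /eqP/(congr1 (@complex.Re R)) /= <-; apply: eq_Rintegral => x _.
  by rewrite oppr0 expi0 mulr1 /q; case: (f x) => u v; simpc.
have intq n : mu.-integrable per (EFin \o (fun x => complex.Re (f x) * q n x)).
  have [[]] := aq n; move=> + _ _; apply: eq_integrable; first exact: measurable_period.
  by move=> x _ /=; case: (f x) => u v; simpc.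
have mfl : measurable_fun per fl.
  by apply: measurable_funM => //; apply: measurable_indic; exact: measurable_itv.
have aecv : {ae mu, forall x, per x ->
    (EFin \o (fun x => complex.Re (f x) * q n x)) x @[n --> \oo] --> (EFin \o fl) x}.
  (* [step_cvg] excludes the level [K * t = 1], which is reached only at the two ends of the arc. *)
  have := aeI (ae_neq (c - r)) (ae_neq (c + r)); apply: aeS => x [n1 n2] px.
  apply: cvg_EFin; first by near=> n.
  rewrite /fl indicE; apply: cvgM; first exact: cvg_cst.
  rewrite (_ : _%:R = if K%:R * bump rho c x < 1 then 1 else 0); last first.
    by rewrite arc// mem_setE in_itv/=; case: ifP.
  by apply: step_cvg; [exact: bump_range|exact: arceq].
have dom : {ae mu, forall x n, per x ->
    (`|(complex.Re (f x) * q n x)%R%:E| <= ((`|complex.Re (f x)|)%R)%:E)%E}.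
  apply: aeW => x n px; rewrite /= lee_fin normrM ler_piMr//.
  have /andP[b0 b1] := @bump_range rho c x rho01.
  by rewrite ger0_norm ?exprn_ge0 ?exprn_ile1 ?subr_ge0 ?exprn_ile1// gerBl exprn_ge0.
have [il _ lim] := @dominated_convergence _ _ _ mu per measurable_period
  (fun n => EFin \o (fun x => complex.Re (f x) * q n x)) (EFin \o fl)
  (EFin \o (fun x => `|complex.Re (f x)|))
  (fun n => measurable_int mu (intq n)) (ltac:(exact/measurable_EFinP)) aecv
  (integrable_norm cf.1) dom.
have zero : Rintegral mu per fl = 0.
  rewrite /Rintegral; have -> : (\int[mu]_(x in per) (fl x)%:E = 0)%E; last by [].
  apply: (cvg_unique (@ereal_hausdorff R) lim); rewrite (_ : [sequence _]_n = fun=> 0%E); first exact: cvg_cst.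
  apply/funext => n /=; have [_ z] := aq n.
  by rewrite -(@fineK _ (\int[mu]_(x in per) _)) ?[fine _]z//; exact: (integrable_fin_num measurable_period (intq n)).
have -> : `]c - r, c + r[%classic = per `&` `]c - r, c + r[%classic.
  apply/seteqP; split => x /=; last by case.
  move=> xi; split => //; move: xi; rewrite in_itv/= => /andP[x1 x2].
  rewrite /period /= in_itv/=; have := ler_norm c; have := ler_norm (- c); rewrite normrN.
  by move=> ? ?; apply/andP; split; lra.
rewrite Rintegral_mkcondr -[RHS]zero; apply: eq_Rintegral => x _.
by rewrite /fl indicE patchE; case: ifP; rewrite ?mulr1 ?mulr0.
Unshelve. all: by end_near. Qed.

(** By Lebesgue differentiation almost every value is a limit of averages over small intervals, and
    these averages vanish by [integral_arc0]. *)
Lemma annihilates_ae0_Re f : annihilates f ->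
  {ae mu, forall x, per x -> complex.Re (f x) = 0}.
Proof.
move=> af; have [cf _] := af.
pose g := (fun x => complex.Re (f x)) \_ per.
have lg : locally_integrable setT g.
  by apply: integrable_locally; [exact: measurable_period|exact: cf.1].
pose E (x : R) (n : nat) : set R := ball x n.+1%:R^-1.
have En (x : R) n : E x n = `]x - n.+1%:R^-1, x + n.+1%:R^-1[%classic.
  by rewrite /E ball_itv.
have nE x : nicely_shrinking x (E x).
  split; first by move=> n; exact: measurable_ball.
  exists (1, fun n => PosNum (ltac:(by rewrite invr_gt0) : (0 : R) < n.+1%:R^-1)); split => //=.
  - exact: cvg_harmonic.
  - by move=> n; exact: subset_refl.
  - by move=> n; rewrite mul1e.
have h := lebesgue_differentiation lg.
(* The ends of the period are discarded so that small balls around [x] stay inside it. *)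
have e : {ae mu, forall x, x != - pi /\ x != pi}.
  exact: aeI (ae_neq _) (ae_neq _).
have := aeI h e; apply: aeS => x [px [n1 n2]] xp.
have := nice_lebesgue_differentiation nE lg px.
have gx : g x = complex.Re (f x) by rewrite /g patchE mem_set.
rewrite gx => lim.
have xlt : `|x| < pi.
  move: xp; rewrite /period /= in_itv/= => /andP[x1 x2].
  by rewrite ltr_norml !lt_neqAle x1 x2 n2 eq_sym n1.
suff c0 : (((mu (E x n))^-1 * \int[mu]_(y in E x n) (g y)%:E)%E @[n --> \oo] --> 0%E).
  by apply: EFin_inj; exact: (cvg_unique (@ereal_hausdorff R) lim c0).
apply: cvg_near_cst.
near=> n.
have nr : `|x| + n.+1%:R^-1 < pi.
  rewrite -ltrBrDl; near: n; apply: (near_infty_natSinv_lt (PosNum (ltac:(by rewrite subr_gt0) : 0 < pi - `|x|))).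
have := integral_arc0 af (ltac:(by rewrite invr_gt0) : (0 : R) < n.+1%:R^-1) nr.
rewrite -En => z.
rewrite (_ : (\int[mu]_(y in E x n) _)%E = 0%E) ?mule0//.
have sub : E x n `<=` per.
  move=> y; rewrite En /= in_itv/= => /andP[y1 y2]; rewrite /period /= in_itv/=.
  move: y1 y2 nr; set d := n.+1%:R^-1 => y1 y2 nr.
  have := ler_norm x; have := ler_norm (- x); rewrite normrN => ? ?.
  by apply/andP; split; lra.
rewrite (@eq_integral _ _ _ mu _ (fun y => (complex.Re (f y))%:E)); last first.
  by move=> y; rewrite inE => /sub py; rewrite /g patchE mem_set.
have iE : mu.-integrable (E x n) (fun y => (complex.Re (f y))%:E).
  apply: integrableS cf.1 => //; [exact: measurable_period|exact: measurable_ball].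
rewrite -(@fineK _ (\int[mu]_(y in _) _)%E) ?[fine _]z//.
by apply: integrable_fin_num => //; exact: measurable_ball.
Unshelve. all: by end_near. Qed.

Theorem fourier_uniqueness f : cint f -> (forall k, fourier f k = 0) ->
  {ae mu, forall x, per x -> f x = 0}.
Proof.
move=> cf f0; have a1 := annihilates_ae0_Re (conj cf f0).
have a2 := annihilates_ae0_Re (annihilatesZ 'i%C (conj cf f0)).
have := aeI a1 a2; apply: aeS => x [h1 h2] px.
by move: (h1 px) (h2 px); case: (f x) => u v /= ->; rewrite mul0r mul1r add0r => /eqP; rewrite oppr_eq0 => /eqP ->.
Qed.

Theorem fourier_inj_ae f g : cint f -> cint g -> (forall k, fourier f k = fourier g k) ->
  {ae mu, forall x, per x -> f x = g x}.
Proof.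
move=> cf cg fg.
have ng := cintZ (-1) cg.
have := @fourier_uniqueness (fun x => f x + (-1) * g x) (cintD cf ng) _.
rewrite -[X in (X -> _) -> _]/(forall k, _).
move=> h; have : {ae mu, forall x, per x -> f x + (-1) * g x = 0}.
  by apply: h => k; rewrite fourierD// fourierZ// fg mulN1r subrr.
by apply: aeS => x e px; apply/eqP; rewrite -subr_eq0 -mulN1r; apply/eqP; exact: e.
Qed.

End Uniqueness2.

(** * The Wiener algebra *)

Section IntSums.
Context {R : realType}.
Local Notation C := R[i].
Implicit Types (F G : int -> R) (c : int -> C).

(** [Negz i] is [-(i + 1)], so these are the integers from [-n] to [n - 1]; [idx] locates an integer
    in this exhaustion of the line. *)
Definition ints n : seq int := [seq Posz i | i <- iota 0 n] ++ [seq Negz i | i <- iota 0 n].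

Definition idx (j : int) : nat := match j with Posz m => m | Negz m => m end.

Lemma mem_ints j n : (j \in ints n) = (idx j < n)%N.
Proof.
rewrite mem_cat; case: j => m /=.
  rewrite (mem_map (fun a b => _ : Posz a = Posz b -> a = b)); last by move=> a b [].
  rewrite mem_iota add0n; case: (m < n)%N => //=.
  by apply/negbTE/negP => /mapP [].
rewrite orbC (mem_map (fun a b => _ : Negz a = Negz b -> a = b)); last by move=> a b [].
rewrite mem_iota add0n; case: (m < n)%N => //=.
by apply/negbTE/negP => /mapP [].
Qed.

Lemma ints_uniq n : uniq (ints n).
Proof.
rewrite cat_uniq !map_inj_uniq ?iota_uniq ?andbT//=; try by move=> a b [].
by apply/hasPn => x /mapP[i _ ->]; apply/negP => /mapP [].
Qed.

Lemma sum_intsE (V : nmodType) (F : int -> V) n :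
  \sum_(j <- ints n) F j = \sum_(0 <= k < n) (F (Posz k) + F (Negz k)).
Proof. by rewrite big_cat /= !big_map big_split /= /index_iota subn0. Qed.

Lemma sum_sub_ints F (s : seq int) n : (forall j, 0 <= F j) -> uniq s ->
  (forall j, j \in s -> (idx j < n)%N) -> \sum_(j <- s) F j <= \sum_(j <- ints n) F j.
Proof.
move=> F0 us sub.
have -> : \sum_(j <- s) F j = \sum_(j <- ints n | j \in s) F j.
  rewrite -[RHS]big_filter; apply: perm_big; apply: uniq_perm => //.
    by rewrite filter_uniq// ints_uniq.
  move=> j; rewrite mem_filter mem_ints.
  by case: (boolP (j \in s)) => // /sub ->.
by rewrite [leRHS](bigID (mem s)) /= lerDl sumr_ge0.
Qed.

Lemma seq_idx_bound (s : seq int) : exists n, forall j, j \in s -> (idx j < n)%N.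
Proof.
exists (\max_(j <- s) idx j).+1 => j js.
by rewrite ltnS; apply: (@leq_bigmax_seq _ s xpredT idx).
Qed.

Definition summ F := exists B, forall n, \sum_(j <- ints n) F j <= B.

(** Sums of nonnegative families are suprema of partial sums over [ints], so that they remain real
    numbers. *)
Definition tot F : R := sup (range (fun n => \sum_(j <- ints n) F j)).

Lemma ints_mono F m n : (forall j, 0 <= F j) -> (m <= n)%N ->
  \sum_(j <- ints m) F j <= \sum_(j <- ints n) F j.
Proof.
move=> F0 mn; apply: sum_sub_ints => //; first exact: ints_uniq.
by move=> j; rewrite mem_ints => h; exact: leq_trans mn.
Qed.

Lemma has_sup_tot F : summ F -> has_sup (range (fun n => \sum_(j <- ints n) F j)).
Proof.
move=> [B FB]; split; first by exists (\sum_(j <- ints 0) F j), 0%N.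
by exists B => _ [n _ <-].
Qed.

Lemma sum_le_tot F n : summ F -> \sum_(j <- ints n) F j <= tot F.
Proof. by move=> sF; apply: sup_upper_bound; [exact: has_sup_tot|exists n]. Qed.

Lemma seq_le_tot F s : (forall j, 0 <= F j) -> summ F -> uniq s -> \sum_(j <- s) F j <= tot F.
Proof.
move=> F0 sF us; have [n sn] := seq_idx_bound s.
exact: le_trans (sum_sub_ints F0 us sn) (sum_le_tot n sF).
Qed.

Lemma tot_le F B : (forall n, \sum_(j <- ints n) F j <= B) -> tot F <= B.
Proof.
move=> FB; apply: ge_sup; first by exists (\sum_(j <- ints 0) F j), 0%N.
by move=> _ [n _ <-].
Qed.

Lemma tot_ge0 F : (forall j, 0 <= F j) -> summ F -> 0 <= tot F.
Proof. by move=> F0 sF; apply: le_trans (sum_le_tot 0 sF); rewrite sumr_ge0. Qed.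

Lemma tot_tail F e : (forall j, 0 <= F j) -> summ F -> 0 < e ->
  exists N, forall n, (N <= n)%N -> tot F - e < \sum_(j <- ints n) F j.
Proof.
move=> F0 sF e0; have [_ [N _ <-] h] := sup_adherent e0 (has_sup_tot sF).
by exists N => n Nn; apply: lt_le_trans h _; exact: ints_mono.
Qed.

End IntSums.

(** * Absolutely convergent Fourier series *)

Section Synthesis.
Context {R : realType}.
Local Notation C := R[i].
Local Notation mu := (@lebesgue_measure R).
Local Notation per := (@period R).
Implicit Types (c : int -> C).

Definition psum c n (x : R) : C := \sum_(j <- ints n) c j * expi j x.

Definition synth c (x : R) : C :=
  Complex (limn (fun n => complex.Re (psum c n x))) (limn (fun n => complex.Im (psum c n x))).

Definition asum c := @summ R (fun j => nrm (c j)).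
Definition l1 c := @tot R (fun j => nrm (c j)).

Lemma nrm_ge0j c j : 0 <= nrm (c j). Proof. exact: nrm_ge0. Qed.

Lemma psum_dist c m n x : asum c -> (n <= m)%N ->
  nrm (psum c m x - psum c n x) <= l1 c - \sum_(j <- ints n) nrm (c j).
Proof.
move=> ac nm; rewrite /psum !sum_intsE (@big_cat_nat _ _ _ n 0%N m _ _ (leq0n _) nm) /= [X in nrm X]addrAC subrr add0r.
apply: le_trans (nrm_sum _ _ _) _.
have := sum_le_tot m ac; rewrite -/(l1 c) sum_intsE (@big_cat_nat _ _ _ n 0%N m _ _ (leq0n _) nm) /=.
rewrite -lerBrDl; apply: le_trans; apply: ler_sum => k _.
by apply: le_trans (nrmD _ _) _; rewrite !nrmM !nrm_expi !mulr1.
Qed.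

Lemma cvg_of_tail (u : R^nat) (d : R^nat) : (forall m n, (n <= m)%N -> `|u m - u n| <= d n) ->
  (forall e, 0 < e -> exists N, d N < e) -> cvgn u /\ forall n, `|limn u - u n| <= d n.
Proof.
move=> ud d0.
have cu : cvgn u.
  apply/cauchy_cvgP/cauchy_exP => e e0; have [N dN] := d0 _ e0.
  exists (u N), N => // m /= Nm; rewrite /ball /= distrC.
  exact: le_lt_trans (ud _ _ Nm) dN.
split=> // n; apply/ler_addgt0Pr => e e0.
have /cvgrPdist_lt/(_ _ e0)[N _ h] := cu.
have := h (maxn N n) (leq_maxl _ _); have := ud (maxn N n) n (leq_maxr _ _).
move=> h1 h2; rewrite -[limn u](subrK (u (maxn N n))) -addrA.
by apply: le_trans (ler_normD _ _) _; rewrite [leRHS]addrC; apply: lerD => //; exact: ltW.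
Qed.

Lemma complexE0 (z : C) : z = Complex (complex.Re z) (complex.Im z). Proof. by case: z. Qed.

Lemma synth_ReIm c x : asum c ->
  (forall n, `|complex.Re (synth c x) - complex.Re (psum c n x)| <= l1 c - \sum_(j <- ints n) nrm (c j)) /\
  (forall n, `|complex.Im (synth c x) - complex.Im (psum c n x)| <= l1 c - \sum_(j <- ints n) nrm (c j)).
Proof.
move=> ac.
have d0 e : 0 < e -> exists N, l1 c - \sum_(j <- ints N) nrm (c j) < e.
  move=> e0; have [N h] := tot_tail (nrm_ge0j c) ac e0.
  by exists N; have := h N (leqnn _); rewrite -/(l1 c); lra.
split.
- have [] := @cvg_of_tail (fun n => complex.Re (psum c n x)) _ _ d0 => // m n nm.
  by apply: le_trans _ (psum_dist x ac nm); apply: le_trans _ (absRe_le _); rewrite raddfB.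
- have [] := @cvg_of_tail (fun n => complex.Im (psum c n x)) _ _ d0 => // m n nm.
  by apply: le_trans _ (psum_dist x ac nm); apply: le_trans _ (absIm_le _); rewrite raddfB.
Qed.

(** The factor 2 comes from taking the limits of the real and imaginary parts separately. *)
Lemma synth_dist c x n : asum c ->
  nrm (synth c x - psum c n x) <= 2 * (l1 c - \sum_(j <- ints n) nrm (c j)).
Proof.
move=> ac; have [h1 h2] := synth_ReIm x ac.
apply: le_trans (nrm_le_ReIm _) _; rewrite mulr_natl mulr2n.
by apply: lerD; rewrite raddfB; [exact: h1|exact: h2].
Qed.

Lemma continuous_unif (F : nat -> R -> R) (f : R -> R) (d : R^nat) :
  (forall n, continuous (F n)) -> (forall n x, `|f x - F n x| <= d n) ->
  (forall e, 0 < e -> exists N, d N < e) -> continuous f.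
Proof.
move=> cF fF d0 x; apply/cvgrPdist_lt => e e0.
have e3 : 0 < e / 3 by rewrite divr_gt0.
have [N dN] := d0 _ e3.
have /cvgrPdist_lt/(_ _ e3) := cF N x; apply: filterS => y hy.
have h1 := fF N x; have h2 := fF N y.
have -> : f x - f y = (f x - F N x) + (F N x - F N y) - (f y - F N y) by ring.
have := ler_normB (f x - F N x + (F N x - F N y)) (f y - F N y).
have := ler_normD (f x - F N x) (F N x - F N y).
lra.
Qed.

Lemma continuous_psum c n : continuous (fun x => complex.Re (psum c n x)) /\
  continuous (fun x => complex.Im (psum c n x)).
Proof.
rewrite /psum; elim: (ints n) => [|j s [IH1 IH2]].
  split; under eq_fun do rewrite big_nil; exact: cst_continuous.
split.
  have -> : (fun x => complex.Re (\sum_(i <- j :: s) c i * expi i x)) =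
    (fun x => complex.Re (c j) * complex.Re (expi j x) - complex.Im (c j) * complex.Im (expi j x) + complex.Re (\sum_(i <- s) c i * expi i x)).
    by apply/funext => x; rewrite big_cons raddfD; case: (c j).
  move=> x; apply: continuousD (IH1 x); apply: continuousB.
    by apply: continuousM; [exact: cst_continuous|exact: continuous_expi_Re].
  by apply: continuousM; [exact: cst_continuous|exact: continuous_expi_Im].
have -> : (fun x => complex.Im (\sum_(i <- j :: s) c i * expi i x)) =
    (fun x => complex.Re (c j) * complex.Im (expi j x) + complex.Im (c j) * complex.Re (expi j x) + complex.Im (\sum_(i <- s) c i * expi i x)).
  by apply/funext => x; rewrite big_cons raddfD; case: (c j).
move=> x; apply: continuousD (IH2 x); apply: continuousD.
  by apply: continuousM; [exact: cst_continuous|exact: continuous_expi_Im].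
by apply: continuousM; [exact: cst_continuous|exact: continuous_expi_Re].
Qed.

Lemma continuous_synth c : asum c -> continuous (fun x => complex.Re (synth c x)) /\
  continuous (fun x => complex.Im (synth c x)).
Proof.
move=> ac.
have d0 e : 0 < e -> exists N, l1 c - \sum_(j <- ints N) nrm (c j) < e.
  move=> e0; have [N h] := tot_tail (nrm_ge0j c) ac e0.
  by exists N; have := h N (leqnn _); rewrite -/(l1 c); lra.
split.
  apply: (@continuous_unif (fun n x => complex.Re (psum c n x)) _ (fun n => l1 c - \sum_(j <- ints n) nrm (c j))) => //.
    by move=> n; have [] := continuous_psum c n.
  by move=> n x; have [h _] := synth_ReIm x ac; exact: h.
apply: (@continuous_unif (fun n x => complex.Im (psum c n x)) _ (fun n => l1 c - \sum_(j <- ints n) nrm (c j))) => //.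
  by move=> n; have [] := continuous_psum c n.
by move=> n x; have [_ h] := synth_ReIm x ac; exact: h.
Qed.

Lemma psum_periodic c n x : psum c n (x + 2 * pi) = psum c n x.
Proof. by apply: eq_bigr => j _; rewrite expi_periodic. Qed.

Lemma synth_periodic c x : synth c (x + 2 * pi) = synth c x.
Proof.
rewrite /synth; congr Complex; congr (limn _); apply/funext => n; by rewrite psum_periodic.
Qed.

Lemma nrm_psum_le c n x : asum c -> nrm (psum c n x) <= l1 c.
Proof.
move=> ac; apply: le_trans (nrm_sum _ _ _) _.
under eq_bigr do rewrite nrmM nrm_expi mulr1.
exact: (sum_le_tot n ac).
Qed.

Lemma nrm_synth_le c x : asum c -> nrm (synth c x) <= l1 c.
Proof.
move=> ac; apply/ler_addgt0Pr => e e0.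
have e2 : 0 < e / 2 by rewrite divr_gt0.
have [N h] := tot_tail (nrm_ge0j c) ac e2.
have := h N (leqnn _); rewrite -/(l1 c) => hN.
have := synth_dist x N ac; have := nrm_psum_le N x ac.
have := nrmD (psum c N x) (synth c x - psum c N x); rewrite addrC subrK; lra.
Qed.

Lemma cint_sum (s : seq int) c : cint (fun x => \sum_(j <- s) c j * expi j x).
Proof.
elim: s => [|j s IH]; first by under eq_fun do rewrite big_nil; exact: cint_cst.
under eq_fun do rewrite big_cons.
exact: cintD (cintZ _ (cint_expi _)) IH.
Qed.

Lemma fourier_finsum (s : seq int) c k : uniq s ->
  fourier (fun x => \sum_(j <- s) c j * expi j x) k = if k \in s then c k else 0.
Proof.
elim: s => [|j s IH] /=.
  move=> _; under eq_fun do rewrite big_nil.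
  have := @fourierZ R 0 (@expi R 0) k (cint_expi 0); rewrite mul0r => {2}<-.
  by apply: fourier_ext => x _; rewrite mul0r.
move=> /andP[js us]; under eq_fun do rewrite big_cons.
rewrite fourierD ?fourierZ ?fourier_expi ?IH//; [|exact: cint_expi|exact: cintZ (cint_expi _)|exact: cint_sum].
rewrite in_cons [j == k]eq_sym; case: eqVneq => [->|kj] /=.
  by rewrite (negbTE js) mulr1 addr0.
by rewrite mulr0 add0r.
Qed.

Lemma cmeas_synth c : asum c -> cmeas (synth c).
Proof. by move=> ac; have [? ?] := continuous_synth ac; exact: cmeas_continuous. Qed.

Lemma cint_synth c : asum c -> cint (synth c).
Proof. by move=> ac; apply: (cint_bnd (cmeas_synth ac)) => x _; exact: nrm_synth_le. Qed.

Lemma fourier_synth c k : asum c -> fourier (synth c) k = c k.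
Proof.
move=> ac; apply/eqP; rewrite -subr_eq0; apply/eqP/nrm_eq0/eqP.
rewrite eq_le nrm_ge0 andbT; apply/ler_addgt0Pr => e e0; rewrite add0r.
have e2 : 0 < e / 2 by rewrite divr_gt0.
have [N h] := tot_tail (nrm_ge0j c) ac e2.
pose n := maxn N (idx k).+1.
have := h n (leq_maxl _ _); rewrite -/(l1 c) => hN.
have <- : fourier (psum c n) k = c k by rewrite fourier_finsum ?ints_uniq// mem_ints leq_maxr.
rewrite -fourierB; [|exact: cint_synth|exact: cint_sum].
apply: nrm_fourier_bnd.
  have := cintD (cint_synth ac) (cintZ (-1) (cint_sum (ints n) c)).
  by apply: cint_ext => x _; rewrite mulN1r.
by move=> x _; have := synth_dist x n ac; lra.
Qed.

End Synthesis.

Section Wiener.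
Context {R : realType}.
Local Notation C := R[i].
Local Notation mu := (@lebesgue_measure R).
Local Notation per := (@period R).
Implicit Types (f g : R -> C).

Lemma contB (u v : R -> R) : continuous u -> continuous v -> continuous (fun x => u x - v x).
Proof. by move=> cu cv x; exact: (@continuousB _ _ _ u v x (cu x) (cv x)). Qed.
Lemma contD (u v : R -> R) : continuous u -> continuous v -> continuous (fun x => u x + v x).
Proof. by move=> cu cv x; exact: (@continuousD _ _ _ u v x (cu x) (cv x)). Qed.
Lemma contM (u v : R -> R) : continuous u -> continuous v -> continuous (fun x => u x * v x).
Proof. by move=> cu cv x; exact: (@continuousM _ _ u v x (cu x) (cv x)). Qed.
Lemma contc (a : R) : continuous (fun _ : R => a).
Proof. exact: cst_continuous. Qed.

(** Continuity and periodicity make the Fourier coefficients determine the function everywhere and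
    not just almost everywhere, so that equality in the algebra is equality of functions. *)
Record wienerP f : Prop := WienerP {
  wiener_contRe : continuous (fun x => complex.Re (f x));
  wiener_contIm : continuous (fun x => complex.Im (f x));
  wiener_per : forall x, f (x + 2 * pi) = f x;
  wiener_asum : asum (fourier f) }.

Lemma wiener_cmeas f : wienerP f -> cmeas f.
Proof. by case=> ? ? _ _; exact: cmeas_continuous. Qed.

(** A nonzero value would persist on a ball of positive measure inside the period; the two ends are
    reached by continuity and the other points by periodicity. *)
Lemma continuous_period_zero (h : R -> R) : continuous h -> (forall x, h (x + 2 * pi) = h x) ->
  {ae mu, forall x, per x -> h x = 0} -> forall x, h x = 0.
Proof.
move=> ch ph [N [mN N0 sub]].
have p0 := pi_gt0 R.
have nz x : h x != 0 -> \forall y \near x, h y != 0.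
  rewrite -normr_gt0 => hx; have /cvgrPdist_lt/(_ _ hx) := ch x.
  by apply: filterS => y; apply: contraTneq => ->; rewrite subr0 ltxx.
have inn x : `|x| < pi -> h x = 0.
  move=> xp; apply/eqP/contraT => hx.
  have [e /= e0 he] : \forall y \near x, h y != 0.
    exact: nz.
  pose d := Num.min e (pi - `|x|).
  have d0 : 0 < d by rewrite lt_min e0 subr_gt0.
  have : (mu (ball x d) <= mu N)%E.
    apply: le_measure; rewrite ?inE//; first exact: measurable_ball.
    move=> y /= xy; apply: sub => /= hy; move: xy; rewrite /ball/= => xy.
    have xe : `|x - y| < e by apply: lt_le_trans xy _; rewrite ge_min lexx.
    have /negP := he y xe; apply; apply/eqP/hy.
    have : `|x - y| < pi - `|x| by apply: lt_le_trans xy _; rewrite ge_min lexx orbT.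
    rewrite /period /= in_itv/= => yx.
    have : `|y| < pi.
      by have := ler_normB x (x - y); rewrite opprB addrC subrK; lra.
    by rewrite ltr_norml => /andP[? ?]; apply/andP; split; exact: ltW.
  rewrite N0 lebesgue_measure_ball; last exact: ltW.
  by rewrite lee_fin leNgt mulrn_wgt0.
have inc x : `|x| <= pi -> h x = 0.
  move=> xp; apply/eqP/contraT => hx.
  have [e /= e0 he] : \forall y \near x, h y != 0.
    exact: nz.
  (* [(1 - a) * x] lies in the open period and within [e] of [x]. *)
  pose a := Num.min (1 / 2) (e / (2 * pi)).
  have a0 : 0 < a by rewrite lt_min !divr_gt0// mulr_gt0.
  have a1 : a <= 1 / 2 by rewrite ge_min lexx.
  have a2 : a <= e / (2 * pi) by rewrite ge_min lexx orbT.
  have a3 : a * (2 * pi) <= e by rewrite -ler_pdivlMr// mulr_gt0.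
  have b1 : a * `|x| <= a * pi by rewrite ler_wpM2l// ltW.
  have near1 : `|x - (1 - a) * x| < e.
    rewrite (_ : x - (1 - a) * x = a * x); last by ring.
    rewrite normrM (gtr0_norm a0); have := mulr_gt0 a0 p0; lra.
  have := he _ near1; rewrite inn ?eqxx// normrM ger0_norm; last by lra.
  apply: (@le_lt_trans _ _ ((1 - a) * pi)); first by rewrite ler_wpM2l//; lra.
  rewrite mulrBl mul1r; have := mulr_gt0 a0 p0; lra.
move=> x; pose n := Num.floor ((x + pi) / (2 * pi)).
have tp : 0 < 2 * pi :> R by lra.
have shn (m : nat) y : h (y + m%:R * (2 * pi)) = h y.
  elim: m => [|m IH]; first by rewrite mul0r addr0.
  by rewrite -natr1 mulrDl mul1r addrA ph IH.
have shz (m : int) y : h (y + m%:~R * (2 * pi)) = h y.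
  case: m => m; first exact: shn.
  rewrite -(shn m.+1) -addrA -mulrDl NegzE mulrNz addNr mul0r addr0//.
rewrite -(shz (- n)); apply: inc.
have := floor_itv ((x + pi) / (2 * pi)); rewrite -/n => /andP[n1 n2].
move: n1 n2; rewrite ler_pdivlMr// ltr_pdivrMr// intrD mulrDl mul1r mulrNz mulNr => n1 n2.
by rewrite ler_norml; apply/andP; split; lra.
Qed.

Lemma continuous_eq_ae f g :
  continuous (fun x => complex.Re (f x)) -> continuous (fun x => complex.Im (f x)) ->
  continuous (fun x => complex.Re (g x)) -> continuous (fun x => complex.Im (g x)) ->
  (forall x, f (x + 2 * pi) = f x) -> (forall x, g (x + 2 * pi) = g x) ->
  {ae mu, forall x, per x -> f x = g x} -> f = g.
Proof.
move=> f1 f2 g1 g2 pf pg fg; apply/funext => x.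
have r : complex.Re (f x) - complex.Re (g x) = 0.
  apply: (@continuous_period_zero (fun x => complex.Re (f x) - complex.Re (g x))).
  - by move=> y; apply: continuousB; [exact: f1|exact: g1].
  - by move=> y; rewrite pf pg.
  - by move: fg; apply: aeS => y h py; rewrite h// subrr.
have i : complex.Im (f x) - complex.Im (g x) = 0.
  apply: (@continuous_period_zero (fun x => complex.Im (f x) - complex.Im (g x))).
  - by move=> y; apply: continuousB; [exact: f2|exact: g2].
  - by move=> y; rewrite pf pg.
  - by move: fg; apply: aeS => y h py; rewrite h// subrr.
rewrite [f x]complexE0 [g x]complexE0; congr Complex; lra.
Qed.

Lemma continuous_cint f : continuous (fun x => complex.Re (f x)) ->
  continuous (fun x => complex.Im (f x)) -> cint f.
Proof.
move=> f1 f2; split; apply: continuous_compact_integrable;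
  by [exact: segment_compact|exact: continuous_subspaceT].
Qed.

Lemma wiener_cint f : wienerP f -> cint f.
Proof. by case=> ? ? _ _; exact: continuous_cint. Qed.

Lemma wiener_synth c : asum c -> wienerP (synth c).
Proof.
move=> ac; have [c1 c2] := continuous_synth ac; split=> //; first exact: synth_periodic.
by rewrite (_ : fourier _ = c)//; apply/funext => k; exact: fourier_synth.
Qed.

Lemma wiener_synthE f : wienerP f -> f = synth (fourier f).
Proof.
move=> wf; have ac := wiener_asum wf; have [c1 c2] := continuous_synth ac.
apply: continuous_eq_ae => //; try by case: wf.
- by move=> x; exact: synth_periodic.
- apply: fourier_inj_ae; [exact: wiener_cint|exact: cint_synth|].
  by move=> k; rewrite fourier_synth.
Qed.

Lemma asumD (c d : int -> C) : asum c -> asum d -> asum (fun j => c j + d j).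
Proof.
move=> [B cB] [D dD]; exists (B + D) => n.
apply: (@le_trans _ _ (\sum_(j <- ints n) (nrm (c j) + nrm (d j)))).
  by apply: ler_sum => j _; exact: nrmD.
by rewrite big_split lerD.
Qed.

Lemma asumZ (a : C) (c : int -> C) : asum c -> asum (fun j => a * c j).
Proof.
move=> [B cB]; exists (nrm a * B) => n.
under eq_bigr do rewrite nrmM.
by rewrite -mulr_sumr ler_wpM2l ?nrm_ge0.
Qed.

Lemma wienerD f g : wienerP f -> wienerP g -> wienerP (fun x => f x + g x).
Proof.
move=> wf wg; have [f1 f2 f3 f4] := wf; have [g1 g2 g3 g4] := wg; split.
- under eq_fun do rewrite raddfD /=; move=> x; exact: continuousD (f1 x) (g1 x).
- under eq_fun do rewrite raddfD /=; move=> x; exact: continuousD (f2 x) (g2 x).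
- by move=> x; rewrite f3 g3.
- have -> : fourier (fun x => f x + g x) = fun j => fourier f j + fourier g j.
    by apply/funext => j; rewrite fourierD//; exact: wiener_cint.
  exact: asumD.
Qed.

Lemma wienerZ a f : wienerP f -> wienerP (fun x => a * f x).
Proof.
move=> wf; have [f1 f2 f3 f4] := wf; split.
- have -> : (fun x => complex.Re (a * f x)) = (fun x => complex.Re a * complex.Re (f x) - complex.Im a * complex.Im (f x)).
    by apply/funext => x; case: a (f x) => ? ? [].
  by apply: contB; apply: contM => //; exact: contc.
- have -> : (fun x => complex.Im (a * f x)) = (fun x => complex.Re a * complex.Im (f x) + complex.Im a * complex.Re (f x)).
    by apply/funext => x; case: a (f x) => ? ? [].
  by apply: contD; apply: contM => //; exact: contc.
- by move=> x; rewrite f3.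
- have -> : fourier (fun x => a * f x) = fun j => a * fourier f j.
    by apply/funext => j; rewrite fourierZ//; exact: wiener_cint.
  exact: asumZ.
Qed.

Lemma wiener_bnd f x : wienerP f -> nrm (f x) <= l1 (fourier f).
Proof. by move=> wf; rewrite {1}(wiener_synthE wf); exact: nrm_synth_le (wiener_asum wf). Qed.

(** Truncating [f] turns the convolution into a finite sum, for which the bound is an exchange of
    summations; uniform convergence of the truncations then controls the finitely many coefficients
    in [s]. *)
Lemma fourierM_sum_le f g (s : seq int) : wienerP f -> wienerP g -> uniq s ->
  \sum_(k <- s) nrm (fourier (fun x => f x * g x) k) <= l1 (fourier f) * l1 (fourier g).
Proof.
move=> wf wg us; have af := wiener_asum wf; have ag := wiener_asum wg.
have l0 : 0 <= l1 (fourier g) by apply: tot_ge0 ag => j; exact: nrm_ge0.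
have cfg : cint (fun x => f x * g x).
  by apply: (cintM_bnd (wiener_cint wf) (wiener_cmeas wg)) => x _; exact: wiener_bnd.
have S N : \sum_(k <- s) nrm (fourier (fun x => psum (fourier f) N x * g x) k) <= l1 (fourier f) * l1 (fourier g).
  apply: (@le_trans _ _ (\sum_(k <- s) \sum_(j <- ints N) nrm (fourier f j) * nrm (fourier g (k - j)))).
    apply: ler_sum => k _.
    have -> : fourier (fun x => psum (fourier f) N x * g x) k = \sum_(j <- ints N) fourier f j * fourier g (k - j).
      rewrite /psum; elim: (ints N) => [|j r IH].
        have := @fourierZ R 0 g k (wiener_cint wg); rewrite big_nil mul0r => {2}<-.
        by apply: fourier_ext => x _; rewrite big_nil mul0r.
      rewrite big_cons -IH -fourier_shift -fourierZ; last exact: cintM_expi (wiener_cint wg).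
      rewrite -fourierD; first by apply: fourier_ext => x _; rewrite big_cons; ring.
        exact: cintZ (cintM_expi _ (wiener_cint wg)).
      apply: (cintM_bnd (B := l1 (fourier g))); [exact: cint_sum|exact: wiener_cmeas|].
      by move=> x _; exact: wiener_bnd.
    by apply: le_trans (nrm_sum _ _ _) _; apply: ler_sum => j _; rewrite nrmM.
  rewrite exchange_big /=.
  apply: (@le_trans _ _ (\sum_(j <- ints N) nrm (fourier f j) * l1 (fourier g))).
    apply: ler_sum => j _; rewrite -mulr_sumr ler_wpM2l ?nrm_ge0//.
    have := @seq_le_tot R (fun j => nrm (fourier g j)) [seq k - j | k <- s] (fun j => nrm_ge0 _) ag.
    by rewrite big_map; apply; rewrite map_inj_uniq//; exact: addIr.
  by rewrite -mulr_suml; apply: (ler_wpM2r l0); exact: (sum_le_tot N af).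
apply/ler_addgt0Pr => e e0.
(* Chosen so that a truncation error [2 E] on [f], times a bound of [g], costs [e / (size s + 1)] on
   each coefficient. *)
pose E := e / (2 * (size s).+1%:R * (l1 (fourier g) + 1)).
have b0 : 0 < l1 (fourier g) + 1 by lra.
have sz : (0 : R) < (size s).+1%:R by rewrite ltr0n.
have E0 : 0 < E by rewrite divr_gt0// !mulr_gt0.
have [N h] := tot_tail (nrm_ge0j (fourier f)) af E0.
apply: le_trans (lerD (S N) (lexx e)).
have cp : cint (fun x => psum (fourier f) N x * g x).
  apply: (cintM_bnd (B := l1 (fourier g))); [exact: cint_sum|exact: wiener_cmeas|].
  by move=> x _; exact: wiener_bnd.
have dk k : nrm (fourier (fun x => f x * g x) k) <= nrm (fourier (fun x => psum (fourier f) N x * g x) k) + e / (size s).+1%:R.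
  rewrite -[fourier (fun x => f x * g x) k](subrK (fourier (fun x => psum (fourier f) N x * g x) k)).
  apply: le_trans (nrmD _ _) _; rewrite addrC lerD2l -fourierB//.
  apply: nrm_fourier_bnd.
    have := cintD cfg (cintZ (-1) cp); apply: cint_ext => x _; by rewrite mulN1r.
  move=> x _; rewrite -mulrBl nrmM.
  have h1 := synth_dist x N af; rewrite -(wiener_synthE wf) in h1.
  have := h N (leqnn _); rewrite -/(l1 (fourier f)) => h2.
  apply: (@le_trans _ _ (2 * E * (l1 (fourier g) + 1))).
    apply: ler_pM; rewrite ?nrm_ge0//; first by lra.
    by apply: le_trans (wiener_bnd x wg) _; rewrite lerDl.
  by rewrite le_eqVlt; apply/orP; left; apply/eqP; rewrite /E; field; rewrite !gt_eqF.
apply: (@le_trans _ _ (\sum_(k <- s) (nrm (fourier (fun x => psum (fourier f) N x * g x) k) + e / (size s).+1%:R))).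
  by apply: ler_sum.
rewrite big_split lerD2l /= big_const_seq count_predT iter_addr_0.
rewrite -[leRHS]mulr1 -[_ *+ _]mulr_natr -mulrA ler_wpM2l ?(ltW e0)//.
by rewrite mulrC ler_pdivrMr// mul1r ler_nat leqnSn.
Qed.

Lemma wienerM f g : wienerP f -> wienerP g -> wienerP (fun x => f x * g x).
Proof.
move=> wf wg; have [f1 f2 f3 f4] := wf; have [g1 g2 g3 g4] := wg; split.
- have -> : (fun x => complex.Re (f x * g x)) = (fun x => complex.Re (f x) * complex.Re (g x) - complex.Im (f x) * complex.Im (g x)).
    by apply/funext => x; case: (f x) (g x) => ? ? [].
  by apply: contB; exact: contM.
- have -> : (fun x => complex.Im (f x * g x)) = (fun x => complex.Re (f x) * complex.Im (g x) + complex.Im (f x) * complex.Re (g x)).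
    by apply/funext => x; case: (f x) (g x) => ? ? [] ? ? /=; rewrite addrC.
  by apply: contD; exact: contM.
- by move=> x; rewrite f3 g3.
- exists (l1 (fourier f) * l1 (fourier g)) => n; apply: fourierM_sum_le => //; exact: ints_uniq.
Qed.

Lemma wiener_cst (a : C) : wienerP (fun=> a).
Proof.
split=> //; [exact: cst_continuous|exact: cst_continuous|].
exists (nrm a) => n.
have e j : fourier (fun=> a) j = a * (0 == j :> int)%:R.
  rewrite -fourier_expi -fourierZ; last exact: cint_expi.
  by apply: fourier_ext => x _; rewrite expi0 mulr1.
under eq_bigr do rewrite e nrmM.
rewrite -mulr_sumr -[leRHS]mulr1 ler_wpM2l ?nrm_ge0//.
case: n => [|n]; first by rewrite /ints big_nil.
rewrite (bigD1_seq (0 : int)) ?mem_ints ?ints_uniq//= big1; first by rewrite addr0 expr1n expr0n /= addr0 sqrtr1.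
by move=> j j0; rewrite eq_sym (negbTE j0) nrm0.
Qed.

Lemma asum_conj (c : int -> C) : asum c -> asum (fun j => conjc (c (- j))).
Proof.
move=> ac; exists (l1 c) => n; under eq_bigr do rewrite nrm_conj.
have := @seq_le_tot R (fun j => nrm (c j)) [seq - k | k <- ints n] (fun j => nrm_ge0 _) ac.
by rewrite big_map; apply; rewrite map_inj_uniq ?ints_uniq//; exact: oppr_inj.
Qed.

Lemma wiener_conj f : wienerP f -> wienerP (fun x => conjc (f x)).
Proof.
move=> wf; have [f1 f2 f3 f4] := wf; split.
- by have -> : (fun x => complex.Re (conjc (f x))) = (fun x => complex.Re (f x)) by apply/funext => x; case: (f x).
- have -> : (fun x => complex.Im (conjc (f x))) = (fun x => - complex.Im (f x)) by apply/funext => x; case: (f x).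
  by move=> x; exact: continuousN (f2 x).
- by move=> x; rewrite f3.
- have -> : fourier (fun x => conjc (f x)) = fun j => conjc (fourier f (- j)).
    by apply/funext => j; rewrite fourier_conj//; exact: wiener_cint.
  exact: asum_conj.
Qed.

Lemma wiener_expi k : wienerP (@expi R k).
Proof.
split; [exact: continuous_expi_Re|exact: continuous_expi_Im|exact: expi_periodic|].
exists 1 => n; under eq_bigr do rewrite fourier_expi.
have [kn|kn] := boolP (k \in ints n).
  rewrite (bigD1_seq k) ?ints_uniq//= eqxx nrm1 big1 ?addr0//.
  by move=> j j0; rewrite eq_sym (negbTE j0) nrm0.
rewrite big_seq big1// => j jn; case: eqP => [e|_]; last by rewrite nrm0.
by rewrite e jn in kn.
Qed.

End Wiener.

(** * The Wiener algebra as a commutative ring *)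

Section WAlgDef.
Context {R : realType}.
Local Notation C := R[i].
Local Notation mu := (@lebesgue_measure R).
Local Notation per := (@period R).

Definition wiener : {pred (R -> C)} := fun f => `[< wienerP f >].

Lemma wiener_subring_closed : subring_closed wiener.
Proof.
split=> [|f g|f g]; rewrite ?unfold_in.
- by apply/asboolP; exact: wiener_cst.
- move=> /asboolP wf /asboolP wg; apply/asboolP.
  have := wienerD wf (wienerZ (-1) wg).
  by congr wienerP; apply/funext => x; rewrite mulN1r.
- by move=> /asboolP wf /asboolP wg; apply/asboolP; exact: wienerM.
Qed.
HB.instance Definition _ := GRing.isSubringClosed.Build _ wiener wiener_subring_closed.

(** Packed as a commutative ring so that [ring] decides the identities between products of a
    function, its conjugate and powers of [z], conjugates being atoms. *)
Record walg := WAlg { wfun :> R -> C; _ : wfun \in wiener }.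
HB.instance Definition _ := [isSub for wfun].
HB.instance Definition _ := [Choice of walg by <:].
HB.instance Definition _ := [SubChoice_isSubComNzRing of walg by <:].

End WAlgDef.
Arguments walg : clear implicits.

Section WAlgTheory.
Context {R : realType}.
Local Notation C := R[i].
Local Notation mu := (@lebesgue_measure R).
Local Notation per := (@period R).
Local Notation V := (walg R).
Implicit Types (f g h : V) (a b : C) (k j n : int).

Lemma walgP f : wienerP f.
Proof. by case: f => f wf; exact/asboolP. Qed.

Definition wmk (f : R -> C) (wf : wienerP f) : V :=
  @WAlg R f (introT (asboolP _) wf).

Lemma walg_ext f g : f =1 g -> f = g.
Proof. by move=> fg; apply/val_inj/funext. Qed.

(* The operations of the algebra are sealed: comparing them up to conversion would
   unfold Lebesgue integrals. *)
Fact coef_seal : {c : V -> int -> C | c = fun f k => fourier f k}.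
Proof. by eexists. Qed.
Definition coef := sval coef_seal.
Lemma coefE f k : coef f k = fourier f k. Proof. by rewrite /coef (svalP coef_seal). Qed.
Fact wn_seal : {w : V -> R | w = fun f => l1 (fourier f)}.
Proof. by eexists. Qed.
Definition wn := sval wn_seal.
Lemma wnE f : wn f = l1 (fourier f). Proof. by rewrite /wn (svalP wn_seal). Qed.
Lemma coef_fun f : coef f = fourier f. Proof. by apply/funext => k; exact: coefE. Qed.
Arguments Normc.normc : simpl never.

Lemma walg_cint f : cint f. Proof. exact: wiener_cint (walgP f). Qed.
Lemma walg_cmeas f : cmeas f. Proof. exact: wiener_cmeas (walgP f). Qed.
Lemma walg_asum f : asum (fourier f). Proof. exact: wiener_asum (walgP f). Qed.

Lemma walg_coef f g : (forall k, coef f k = coef g k) -> f = g.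
Proof.
move=> fg; apply: walg_ext => x.
rewrite (wiener_synthE (walgP f)) (wiener_synthE (walgP g)).
by congr (synth _ x); apply/funext => k; rewrite -!coefE.
Qed.

Definition wcst a : V := wmk (wiener_cst a).
Definition wexp k : V := wmk (wiener_expi k).
Definition wconj f : V := wmk (wiener_conj (walgP f)).

Lemma asum_restr (c : int -> C) (P : pred int) : asum c -> asum (fun j => if P j then c j else 0).
Proof.
move=> [B cB]; exists B => m; apply: le_trans (cB m); apply: ler_sum => j _.
by case: ifP => // _; rewrite nrm0 nrm_ge0.
Qed.

Fact wproj_seal : {p : V -> V | p = fun f =>
  wmk (wiener_synth (asum_restr (fun j => 0 <= j) (walg_asum f)))}.
Proof. by eexists. Qed.
Definition wproj := sval wproj_seal.

Lemma coefD f g k : coef (f + g) k = coef f k + coef g k.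
Proof. by rewrite !coefE -fourierD; [|exact: walg_cint..]. Qed.
Lemma coefN f k : coef (- f) k = - coef f k.
Proof.
rewrite !coefE -[RHS]mulN1r -fourierZ; last exact: walg_cint.
by apply: fourier_ext => x _; rewrite mulN1r.
Qed.
Lemma coefB f g k : coef (f - g) k = coef f k - coef g k.
Proof. by rewrite coefD coefN. Qed.
Lemma coef0 k : coef 0 k = 0.
Proof. by rewrite -[0 in LHS](subrr 1) coefB subrr. Qed.
Lemma coefZ a f k : coef (wcst a * f) k = a * coef f k.
Proof. by rewrite !coefE -fourierZ; [|exact: walg_cint]. Qed.
Lemma coef_exp j k : coef (wexp j) k = (j == k)%:R.
Proof. by rewrite coefE; exact: fourier_expi. Qed.
Lemma coef_shift j f k : coef (wexp j * f) k = coef f (k - j).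
Proof. by rewrite mulrC !coefE -fourier_shift. Qed.
Lemma coef_conj f k : coef (wconj f) k = conjc (coef f (- k)).
Proof. by rewrite !coefE; exact: fourier_conj (walg_cint f). Qed.
Lemma coef_proj f k : coef (wproj f) k = if 0 <= k then coef f k else 0.
Proof.
rewrite !coefE /wproj (svalP wproj_seal) fourier_synth//.
exact: asum_restr (fun j => 0 <= j) (walg_asum f).
Qed.
Lemma coef_sum I (r : seq I) (P : pred I) (F : I -> V) k :
  coef (\sum_(i <- r | P i) F i) k = \sum_(i <- r | P i) coef (F i) k.
Proof. by elim/big_rec2: _ => [|i y1 y2 _ <-]; rewrite ?coef0 ?coefD. Qed.

Lemma wcstD a b : wcst (a + b) = wcst a + wcst b. Proof. exact: walg_ext. Qed.
Lemma wcstN a : wcst (- a) = - wcst a. Proof. exact: walg_ext. Qed.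
Lemma wcstB a b : wcst (a - b) = wcst a - wcst b. Proof. exact: walg_ext. Qed.
Lemma wcstM a b : wcst (a * b) = wcst a * wcst b. Proof. exact: walg_ext. Qed.
Lemma wcst0 : wcst 0 = 0. Proof. exact: walg_ext. Qed.
Lemma wcst1 : wcst 1 = 1. Proof. exact: walg_ext. Qed.
Lemma wexp0 : wexp 0 = 1. Proof. by apply: walg_ext => x; exact: expi0. Qed.
Lemma wexpD j k : wexp (j + k) = wexp j * wexp k.
Proof. by apply: walg_ext => x; exact: expiD. Qed.
Lemma wexpNK k : wexp k * wexp (- k) = 1. Proof. by rewrite -wexpD subrr wexp0. Qed.
Lemma coef_cst a k : coef (wcst a) k = if k == 0 then a else 0.
Proof.
by rewrite -[wcst a]mulr1 -wexp0 coefZ coef_exp eq_sym; case: eqP => _; rewrite ?mulr1 ?mulr0.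
Qed.
Lemma coef1 k : coef 1 k = (k == 0)%:R. Proof. by rewrite -wexp0 coef_exp eq_sym. Qed.

Lemma wconjD f g : wconj (f + g) = wconj f + wconj g.
Proof. by apply: walg_ext => x; exact: conjcD. Qed.
Lemma wconjN f : wconj (- f) = - wconj f.
Proof. by apply: walg_ext => x; exact: conjcN. Qed.
Lemma wconjB f g : wconj (f - g) = wconj f - wconj g.
Proof. by rewrite wconjD wconjN. Qed.
Lemma wconjM f g : wconj (f * g) = wconj f * wconj g.
Proof. by apply: walg_ext => x; exact: conjcM. Qed.
Lemma wconjK f : wconj (wconj f) = f.
Proof. by apply: walg_ext => x; exact: conjcK. Qed.
Lemma wconj_cst a : wconj (wcst a) = wcst (conjc a).
Proof. exact: walg_ext. Qed.
Lemma wconj1 : wconj 1 = 1.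
Proof. by rewrite -wcst1 wconj_cst conjc1. Qed.
Lemma wconj0 : wconj 0 = 0.
Proof. by rewrite -wcst0 wconj_cst conjc0. Qed.
Lemma wconj_exp k : wconj (wexp k) = wexp (- k).
Proof. by apply: walg_ext => x; exact: conj_expi. Qed.

Lemma wprojD f g : wproj (f + g) = wproj f + wproj g.
Proof.
by apply: walg_coef => k; rewrite !(coef_proj, coefD); case: ifP; rewrite ?addr0.
Qed.
Lemma wprojN f : wproj (- f) = - wproj f.
Proof. by apply: walg_coef => k; rewrite !(coef_proj, coefN); case: ifP; rewrite ?oppr0. Qed.
Lemma wprojB f g : wproj (f - g) = wproj f - wproj g.
Proof. by rewrite wprojD wprojN. Qed.
Lemma wprojZ a f : wproj (wcst a * f) = wcst a * wproj f.
Proof. by apply: walg_coef => k; rewrite !(coef_proj, coefZ); case: ifP; rewrite ?mulr0. Qed.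
Lemma wproj0 : wproj 0 = 0.
Proof. by apply: walg_coef => k; rewrite coef_proj coef0 if_same. Qed.

Definition hardy f := forall k, k < 0 -> coef f k = 0.

Lemma hardy_projP f : hardy f <-> wproj f = f.
Proof.
split=> [hf|<- k k0]; last by rewrite coef_proj leNgt k0.
by apply: walg_coef => k; rewrite coef_proj leNgt; case: ifP => // /negbFE/hf ->.
Qed.
Lemma hardy_proj f : hardy (wproj f).
Proof. by move=> k k0; rewrite coef_proj leNgt k0. Qed.
Lemma hardyK f : hardy f -> wproj f = f. Proof. by move/hardy_projP. Qed.
Lemma hardyD f g : hardy f -> hardy g -> hardy (f + g).
Proof. by move=> hf hg k k0; rewrite coefD hf// hg// addr0. Qed.
Lemma hardyN f : hardy f -> hardy (- f).
Proof. by move=> hf k k0; rewrite coefN hf// oppr0. Qed.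
Lemma hardyB f g : hardy f -> hardy g -> hardy (f - g).
Proof. by move=> hf hg; apply: hardyD => //; exact: hardyN. Qed.
Lemma hardyZ a f : hardy f -> hardy (wcst a * f).
Proof. by move=> hf k k0; rewrite coefZ hf// mulr0. Qed.
Lemma hardy_cst a : hardy (wcst a).
Proof. by move=> k k0; rewrite coef_cst lt_eqF. Qed.
Lemma hardy1 : hardy 1. Proof. by rewrite -wcst1; exact: hardy_cst. Qed.
Lemma hardy0 : hardy 0. Proof. by rewrite -wcst0; exact: hardy_cst. Qed.
Lemma hardy_exp k : 0 <= k -> hardy (wexp k).
Proof. by move=> k0 j j0; rewrite coef_exp gt_eqF// (lt_le_trans j0). Qed.

Lemma wn_ge0 f : 0 <= wn f.
Proof. by rewrite wnE; apply: tot_ge0 (walg_asum f) => j; exact: nrm_ge0. Qed.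
Lemma nrm_le_wn f x : nrm (f x) <= wn f. Proof. by rewrite wnE; exact: wiener_bnd (walgP f). Qed.
Lemma coef_le_wn f k : nrm (coef f k) <= wn f.
Proof.
have := @seq_le_tot R (fun j => nrm (fourier f j)) [:: k] (fun j => nrm_ge0 _) (walg_asum f) isT.
by rewrite big_seq1 wnE coefE.
Qed.
Lemma wn_le f B : (forall m, \sum_(j <- ints m) nrm (coef f j) <= B) -> wn f <= B.
Proof. by rewrite wnE -coef_fun; exact: tot_le. Qed.
Lemma sum_le_wn f (s : seq int) : uniq s -> \sum_(j <- s) nrm (coef f j) <= wn f.
Proof.
move=> us; rewrite wnE coef_fun; apply: seq_le_tot => //; last exact: walg_asum.
by move=> j; exact: nrm_ge0.
Qed.
Lemma wnM f g : wn (f * g) <= wn f * wn g.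
Proof.
apply: wn_le => m; rewrite !wnE coef_fun.
by apply: fourierM_sum_le; [exact: walgP|exact: walgP|exact: ints_uniq].
Qed.
Lemma wnD f g : wn (f + g) <= wn f + wn g.
Proof.
apply: wn_le => m; apply: (@le_trans _ _ (\sum_(j <- ints m) (nrm (coef f j) + nrm (coef g j)))).
  by apply: ler_sum => j _; rewrite coefD nrmD.
by rewrite big_split lerD// sum_le_wn// ints_uniq.
Qed.
Lemma wnZ a f : wn (wcst a * f) = nrm a * wn f.
Proof.
have le b g : wn (wcst b * g) <= nrm b * wn g.
  apply: wn_le => m; under eq_bigr do rewrite coefZ nrmM.
  by rewrite -mulr_sumr ler_wpM2l ?nrm_ge0// sum_le_wn// ints_uniq.
apply/eqP; rewrite eq_le le /=.
have [->|a0] := eqVneq a 0; first by rewrite nrm0 mul0r wn_ge0.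
have na : 0 < nrm a by rewrite lt0r nrm_ge0 andbT; apply: contra a0 => /eqP/nrm_eq0 ->.
rewrite -ler_pdivlMl//; have := le a^-1 (wcst a * f).
by rewrite mulrA -wcstM mulVf// wcst1 mul1r Normc.normcV.
Qed.
Lemma wnN f : wn (- f) = wn f.
Proof. by rewrite -mulN1r -wcst1 -wcstN wnZ nrmN nrm1 mul1r. Qed.
Lemma wnB f g : wn (f - g) <= wn f + wn g.
Proof. by rewrite -(wnN g) wnD. Qed.
Lemma wn0 : wn 0 = 0.
Proof. by have := wnZ 0 0; rewrite nrm0 mul0r mulr0. Qed.
Lemma wn_distC f g : wn (f - g) = wn (g - f).
Proof. by rewrite -wnN opprB. Qed.
Lemma wn_conj f : wn (wconj f) = wn f.
Proof.
have le g : wn (wconj g) <= wn g.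
  apply: wn_le => m; under eq_bigr do rewrite coef_conj nrm_conj.
  have := @sum_le_wn g [seq - j | j <- ints m]; rewrite big_map; apply.
  by rewrite map_inj_uniq ?ints_uniq//; exact: oppr_inj.
by apply/eqP; rewrite eq_le le /= -{1}(wconjK f) le.
Qed.
Lemma wn_proj f : wn (wproj f) <= wn f.
Proof.
apply: wn_le => m; apply: le_trans (sum_le_wn f (ints_uniq m)).
by apply: ler_sum => j _; rewrite coef_proj; case: ifP => // _; rewrite nrm0 nrm_ge0.
Qed.
Lemma wn_exp k : wn (wexp k) <= 1.
Proof.
apply: wn_le => m; under eq_bigr do rewrite coef_exp.
have [km|km] := boolP (k \in ints m).
  rewrite (bigD1_seq k) ?ints_uniq//= eqxx nrm1 big1 ?addr0//.
  by move=> j j0; rewrite eq_sym (negbTE j0) nrm0.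
rewrite big_seq big1// => j jn; case: eqP => [e|_]; last by rewrite nrm0.
by rewrite e jn in km.
Qed.
Lemma wn_cst a : wn (wcst a) <= nrm a.
Proof. by rewrite -[wcst a]mulr1 wnZ ler_piMr ?nrm_ge0// -wexp0 wn_exp. Qed.
Lemma wn1 : wn 1 <= 1. Proof. by rewrite -wexp0 wn_exp. Qed.

Definition wtr f (m : nat) : V := \sum_(j <- ints m) wcst (coef f j) * wexp j.

Lemma coef_wtr f m k : coef (wtr f m) k = if (idx k < m)%N then coef f k else 0.
Proof.
rewrite coef_sum; under eq_bigr do rewrite coefZ coef_exp.
rewrite -mem_ints; case: ifP => [km|/negbT km].
  rewrite (bigD1_seq k) ?ints_uniq//= eqxx mulr1 big1 ?addr0//.
  by move=> j /negbTE ->; rewrite mulr0.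
rewrite big_seq big1// => j jn; case: eqP => [e|_]; last by rewrite mulr0.
by rewrite -e jn in km.
Qed.

Lemma wn_wtr f e : 0 < e -> exists N, forall m, (N <= m)%N -> wn (f - wtr f m) <= e.
Proof.
move=> e0; have [N hN] := tot_tail (nrm_ge0j (fourier f)) (walg_asum f) e0.
exists N => m Nm; apply: wn_le => p.
have := hN m Nm; rewrite -/(l1 _) -wnE => hm.
have : \sum_(j <- ints p) nrm (coef (f - wtr f m) j) + \sum_(j <- ints m) nrm (coef f j) <= wn f.
  rewrite (bigID (fun j => (idx j < m)%N)) /= big1 ?add0r; last first.
    by move=> j jm; rewrite coefB coef_wtr jm subrr nrm0.
  rewrite (eq_bigr (fun j => nrm (coef f j))); last first.
    by move=> j /negbTE jm; rewrite coefB coef_wtr jm subr0.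
  rewrite -big_filter -big_cat; apply: sum_le_wn.
  rewrite cat_uniq filter_uniq ?ints_uniq//= andbT; apply/hasPn => j.
  by rewrite mem_ints => jm; rewrite mem_filter jm.
by move: hm; rewrite -coef_fun; lra.
Qed.

Lemma coefM_wtr f g m k :
  coef (wtr f m * g) k = \sum_(j <- ints m) coef f j * coef g (k - j).
Proof.
by rewrite mulr_suml coef_sum; apply: eq_bigr => j _; rewrite -mulrA coefZ coef_shift.
Qed.

(** The coefficients of a product are infinite convolutions; when the truncated ones are eventually
    constant, their common value is the coefficient. *)
Lemma coefM_approx f g k (c : C) : (exists M, forall m, (M <= m)%N -> coef (wtr f m * g) k = c) ->
  coef (f * g) k = c.
Proof.
move=> [M hM]; apply/eqP; rewrite -subr_eq0; apply/eqP/nrm_eq0/eqP.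
rewrite eq_le nrm_ge0 andbT; apply/ler_addgt0Pr => e e0; rewrite add0r.
have g1 : 0 < wn g + 1 by have := wn_ge0 g; lra.
have [N hN] := wn_wtr f (divr_gt0 e0 g1).
rewrite -(hM (maxn N M) (leq_maxr _ _)) -coefB -mulrBl.
apply: le_trans (coef_le_wn _ _) _; apply: le_trans (wnM _ _) _.
apply: (@le_trans _ _ (e / (wn g + 1) * (wn g + 1))); last by rewrite divfK// gt_eqF.
apply: ler_pM (wn_ge0 _) (wn_ge0 _) (hN _ (leq_maxl _ _)) _.
by rewrite lerDl ler01.
Qed.

Lemma hardyM f g : hardy f -> hardy g -> hardy (f * g).
Proof.
move=> hf hg k k0; apply: coefM_approx; exists 0%N => m _.
rewrite coefM_wtr big1// => j _.
have [j0|j0] := ltP j 0; first by rewrite hf// mul0r.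
by rewrite (hg (k - j)) ?mulr0//; lia.
Qed.

End WAlgTheory.
Arguments Normc.normc : simpl never.

(** * The inner product on the Wiener algebra *)

Section InnerProduct.
Context {R : realType}.
Local Notation C := R[i].
Local Notation mu := (@lebesgue_measure R).
Local Notation per := (@period R).
Local Notation V := (walg R).
Implicit Types (f g h : V) (a b : C) (k j n : int).

Fact ip_seal : {p : V -> V -> C | p = fun f g => coef (f * wconj g) 0}.
Proof. by eexists. Qed.
Definition ip := sval ip_seal.
Lemma ipE f g : ip f g = coef (f * wconj g) 0. Proof. by rewrite /ip (svalP ip_seal). Qed.
(** The squared norm, real and free of square roots, which keeps the estimates polynomial. *)
Fact nn_seal : {p : V -> R | p = fun f => complex.Re (ip f f)}.
Proof. by eexists. Qed.
Definition nn := sval nn_seal.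
Lemma nn_ip f : nn f = complex.Re (ip f f). Proof. by rewrite /nn (svalP nn_seal). Qed.

Lemma cReD a b : complex.Re (a + b) = complex.Re a + complex.Re b.
Proof. by case: a b => ? ? []. Qed.
Lemma cReN a : complex.Re (- a) = - complex.Re a.
Proof. by case: a. Qed.
Lemma cRe_rcM (r : R) a : complex.Re (r%:C%C * a) = r * complex.Re a.
Proof. by case: a => u v /=; rewrite mul0r subr0. Qed.

Lemma ipDl f g h : ip (f + g) h = ip f h + ip g h.
Proof. by rewrite !ipE mulrDl coefD. Qed.
Lemma ipNl f h : ip (- f) h = - ip f h.
Proof. by rewrite !ipE mulNr coefN. Qed.
Lemma ipBl f g h : ip (f - g) h = ip f h - ip g h.
Proof. by rewrite ipDl ipNl. Qed.
Lemma ipZl a f h : ip (wcst a * f) h = a * ip f h.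
Proof. by rewrite !ipE -mulrA coefZ. Qed.
Lemma ip_conj f g : ip g f = conjc (ip f g).
Proof. by rewrite !ipE -[0 in RHS]oppr0 -coef_conj wconjM wconjK mulrC. Qed.
Lemma ipDr f g h : ip f (g + h) = ip f g + ip f h.
Proof. by rewrite !ipE wconjD mulrDr coefD. Qed.
Lemma ipNr f h : ip f (- h) = - ip f h.
Proof. by rewrite !ipE wconjN mulrN coefN. Qed.
Lemma ipBr f g h : ip f (g - h) = ip f g - ip f h.
Proof. by rewrite ipDr ipNr. Qed.
Lemma ipZr a f h : ip f (wcst a * h) = conjc a * ip f h.
Proof. by rewrite !ipE wconjM wconj_cst mulrCA coefZ. Qed.
Lemma ip0l h : ip 0 h = 0. Proof. by rewrite !ipE mul0r coef0. Qed.
Lemma ip0r h : ip h 0 = 0. Proof. by rewrite !ipE wconj0 mulr0 coef0. Qed.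
Lemma ip1r f : ip f 1 = coef f 0. Proof. by rewrite !ipE wconj1 mulr1. Qed.
Lemma ip_exp f k : ip f (wexp k) = coef f k.
Proof. by rewrite !ipE wconj_exp mulrC coef_shift sub0r opprK. Qed.
Lemma ipMl f g h : ip (f * g) h = ip g (wconj f * h).
Proof. by rewrite !ipE wconjM wconjK mulrCA mulrA. Qed.
Lemma ip_suml I (r : seq I) (P : pred I) (F : I -> V) h :
  ip (\sum_(i <- r | P i) F i) h = \sum_(i <- r | P i) ip (F i) h.
Proof. rewrite !ipE mulr_suml coef_sum; apply: eq_bigr => i _; by rewrite ipE. Qed.
Lemma ip_sumr I (r : seq I) (P : pred I) (F : I -> V) h :
  ip h (\sum_(i <- r | P i) F i) = \sum_(i <- r | P i) ip h (F i).
Proof.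
elim/big_rec2: _ => [|i y1 y2 _ e]; first exact: ip0r.
by rewrite ipDr e.
Qed.

Lemma mean_abs (g : R -> R) (w : V) : (forall x, w x = (g x)%:C%C) ->
  complex.Re (coef w 0) = (2 * pi)^-1 * Rintegral mu per g.
Proof.
move=> wg; rewrite coefE fourierE.
have -> : cintegral (fun x => w x * expi (- 0) x) = Complex (Rintegral mu per g) (Rintegral mu per (fun=> 0)).
  rewrite /cintegral; congr Complex; apply: eq_Rintegral => x _; by rewrite oppr0 expi0 mulr1 wg.
by rewrite /= mul0r subr0.
Qed.

Lemma nnE f : nn f = (2 * pi)^-1 * Rintegral mu per (fun x => nrm (f x) ^+ 2).
Proof. by rewrite nn_ip ipE; apply: mean_abs => x; exact: mul_conj. Qed.

Lemma nn_ge0 f : 0 <= nn f.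
Proof.
rewrite nnE mulr_ge0 ?invr_ge0 ?mulr_ge0 ?pi_ge0// Rintegral_ge0// => x _.
exact: sqr_ge0.
Qed.

Lemma ipff f : ip f f = (nn f)%:C%C.
Proof.
rewrite nn_ip; have := ip_conj f f; case: (ip f f) => u v /= [] e; congr Complex; lra.
Qed.

Lemma integrable_nrm2 f : mu.-integrable per (EFin \o (fun x => nrm (f x) ^+ 2)).
Proof.
have [h _] := @walg_cint R (f * wconj f); move: h; apply: eq_integrable; first exact: measurable_period.
by move=> x _ /=; rewrite [(_ * _) x]mul_conj.
Qed.

Lemma nn_mul f g : nn (f * g) <= wn f ^+ 2 * nn g.
Proof.
rewrite !nnE mulrCA ler_wpM2l ?invr_ge0 ?mulr_ge0 ?pi_ge0//.
rewrite -RintegralZl; [|exact: measurable_period|exact: integrable_nrm2].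
apply: le_Rintegral; [exact: measurable_period|exact: integrable_nrm2| |].
  by have := integrableZl measurable_period (wn f ^+ 2) (integrable_nrm2 g); apply: eq_integrable; first exact: measurable_period.
move=> x _; rewrite [(f * g) x]/(f x * g x) nrmM exprMn ler_wpM2r ?sqr_ge0//.
by rewrite lerXn2r ?nnegrE ?nrm_ge0 ?wn_ge0 ?nrm_le_wn.
Qed.

Lemma nn_conj f : nn (wconj f) = nn f.
Proof. by rewrite !nn_ip !ipE wconjK mulrC. Qed.

Lemma nn_le_wn f : nn f <= wn f ^+ 2.
Proof.
have := nn_mul f 1; rewrite mulr1 => h; apply: le_trans h _.
by rewrite ler_piMr ?sqr_ge0// !nn_ip ip1r coef1.
Qed.

Lemma nnZ a f : nn (wcst a * f) = nrm a ^+ 2 * nn f.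
Proof. by rewrite !nn_ip ipZl ipZr mulrA mul_conj ipff /= mul0r subr0. Qed.
Lemma nnN f : nn (- f) = nn f.
Proof. by rewrite !nn_ip ipNl ipNr opprK. Qed.
Lemma nn0 : nn 0 = 0. Proof. by rewrite !nn_ip ip0l. Qed.
Lemma nn1 : nn 1 = 1. Proof. by rewrite !nn_ip ip1r coef1. Qed.
Lemma nn_cst a : nn (wcst a) = nrm a ^+ 2.
Proof. by rewrite -[wcst a]mulr1 nnZ nn1 mulr1. Qed.
Lemma nn_expM k f : nn (wexp k * f) = nn f.
Proof. by rewrite !nn_ip ipMl wconj_exp mulrA [_ * wexp k]mulrC wexpNK mul1r. Qed.

Lemma Re_ip_conj f g : complex.Re (ip g f) = complex.Re (ip f g).
Proof. by rewrite ip_conj; case: (ip f g). Qed.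

Lemma nnD f g : nn (f + g) = nn f + 2 * complex.Re (ip f g) + nn g.
Proof.
rewrite !nn_ip ipDl !ipDr !cReD (Re_ip_conj f g); ring.
Qed.
Lemma nnB f g : nn (f - g) = nn f - 2 * complex.Re (ip f g) + nn g.
Proof. by rewrite nnD nnN ipNr cReN mulrN. Qed.

Lemma cauchy_schwarz f g : nrm (ip f g) ^+ 2 <= nn f * nn g.
Proof.
have [g0|g0] := eqVneq (nn g) 0.
  (* When [|g| = 0] the square of [f + t (f|g) g] is affine in [t] with slope [2 |(f|g)|^2], and it
     stays nonnegative. *)
  have key (t : R) : 0 <= nn f + 2 * t * nrm (ip f g) ^+ 2.
    have := nn_ge0 (f + wcst (t%:C%C * ip f g) * g).
    rewrite nnD nnZ g0 mulr0 addr0 ipZr conjcM conjc_rc -mulrA [conjc _ * _]mulrC mul_conj.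
    by rewrite -rcM /= mulrA.
  rewrite g0 mulr0 leNgt; apply/negP => p0.
  have := key (- (nn f + 1) / nrm (ip f g) ^+ 2).
  rewrite -mulrA divfK ?gt_eqF//; have := nn_ge0 f; lra.
have gp : 0 < nn g by rewrite lt0r g0 nn_ge0.
have := nn_ge0 (f - wcst ((nn g)^-1%:C%C * ip f g) * g).
rewrite nnB nnZ ipZr conjcM conjc_rc -mulrA [conjc _ * _]mulrC mul_conj nrmM nrm_real.
rewrite ger0_norm ?invr_ge0 ?nn_ge0// -rcM [complex.Re _]/= => h.
have -> : nn f * nn g = (nn f - 2 * ((nn g)^-1 * nrm (ip f g) ^+ 2) + ((nn g)^-1 * nrm (ip f g)) ^+ 2 * nn g) * nn g + nrm (ip f g) ^+ 2.
  by field.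
by rewrite lerDr mulr_ge0// nn_ge0.
Qed.

Lemma nrm_ip_le f g A B : 0 <= A -> 0 <= B -> nn f <= A ^+ 2 -> nn g <= B ^+ 2 -> nrm (ip f g) <= A * B.
Proof.
move=> A0 B0 fA gB.
rewrite -(@ler_pXn2r _ 2) ?nnegrE ?nrm_ge0 ?mulr_ge0//.
apply: le_trans (cauchy_schwarz f g) _; rewrite exprMn.
by apply: ler_pM; rewrite ?nn_ge0.
Qed.

(** [conj g] has only frequencies at least 1, so a factor [z] comes out of [f * conj g], and [z]
    times a Hardy function has zero mean. *)
Lemma ip_hardy0 f g : hardy f -> (forall k, 0 <= k -> coef g k = 0) -> ip f g = 0.
Proof.
move=> hf gk; rewrite ipE.
have -> : f * wconj g = wexp 1 * (f * (wexp (- 1) * wconj g)).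
  rewrite (_ : _ * (_ * (_ * _)) = (wexp 1 * wexp (- 1)) * (f * wconj g)); last by ring.
  by rewrite wexpNK mul1r.
rewrite coef_shift sub0r; apply: hardyM => // k k0.
by rewrite coef_shift coef_conj gk ?conjc0//; lia.
Qed.

Lemma coef_negpart f k : 0 <= k -> coef (f - wproj f) k = 0.
Proof. by move=> k0; rewrite coefB coef_proj k0 subrr. Qed.

Lemma ip_projr f g : hardy f -> ip f (wproj g) = ip f g.
Proof.
move=> hf; apply/esym/eqP; rewrite -subr_eq0 -ipBr; apply/eqP.
by apply: ip_hardy0 => // k k0; exact: coef_negpart.
Qed.
Lemma ip_projl f g : hardy g -> ip (wproj f) g = ip f g.
Proof. by move=> hg; rewrite ip_conj ip_projr// -ip_conj. Qed.

Lemma nn_proj f : nn (wproj f) <= nn f.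
Proof.
rewrite -[in leRHS](subrK (wproj f) f) nnD.
have -> : ip (f - wproj f) (wproj f) = 0.
  rewrite ip_conj ip_hardy0 ?conjc0//; [exact: hardy_proj|exact: coef_negpart].
by rewrite mulr0 addr0 lerDr nn_ge0.
Qed.

Lemma nn_eq0 f : nn f = 0 -> f = 0.
Proof.
move=> f0; apply: walg_coef => k; rewrite coef0 -ip_exp; apply: nrm_eq0; apply/eqP.
have := cauchy_schwarz f (wexp k); rewrite f0 mul0r => h.
by rewrite -sqrf_eq0 eq_le h sqr_ge0.
Qed.

End InnerProduct.

(** * Hankel operators and Ky Fan sums *)

Section Hankel.
Context {R : realType}.
Local Notation C := R[i].
Local Notation V := (walg R).
Implicit Types (a b f g h u w : V) (c : C) (k j : int).

Definition wz : V := wexp 1.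
Definition wzb : V := wexp (- 1).
(** An antilinear operator with linear square. For [a = u] it is the Hankel operator of [u], for
    [a = conj(z) u] the shifted one. *)
Definition hank a h : V := wproj (a * wconj h).
Definition toep b h : V := wproj (b * h).
Definition cub a : V := a * wconj a * a.

Lemma wzzb : wz * wzb = 1. Proof. exact: wexpNK. Qed.
Lemma wzbz : wzb * wz = 1. Proof. by rewrite mulrC wzzb. Qed.
Lemma wconj_z : wconj wz = wzb. Proof. exact: wconj_exp. Qed.
Lemma wconj_zb : wconj wzb = wz. Proof. by rewrite wconj_exp opprK. Qed.
Lemma hardy_z : hardy wz. Proof. exact: hardy_exp. Qed.
Lemma coef_z f k : coef (wz * f) k = coef f (k - 1). Proof. exact: coef_shift. Qed.
Lemma coef_zb f k : coef (wzb * f) k = coef f (k + 1).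
Proof. by rewrite coef_shift opprK. Qed.

Lemma hankDl a b h : hank (a + b) h = hank a h + hank b h.
Proof. by rewrite /hank mulrDl wprojD. Qed.
Lemma hankNl a h : hank (- a) h = - hank a h.
Proof. by rewrite /hank mulNr wprojN. Qed.
Lemma hankBl a b h : hank (a - b) h = hank a h - hank b h.
Proof. by rewrite hankDl hankNl. Qed.
Lemma hankZl c a h : hank (wcst c * a) h = wcst c * hank a h.
Proof. by rewrite /hank -mulrA wprojZ. Qed.
Lemma hankDr a g h : hank a (g + h) = hank a g + hank a h.
Proof. by rewrite /hank wconjD mulrDr wprojD. Qed.
Lemma hankNr a h : hank a (- h) = - hank a h.
Proof. by rewrite /hank wconjN mulrN wprojN. Qed.
Lemma hankBr a g h : hank a (g - h) = hank a g - hank a h.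
Proof. by rewrite hankDr hankNr. Qed.
Lemma hankZr c a h : hank a (wcst c * h) = wcst (conjc c) * hank a h.
Proof. by rewrite /hank wconjM wconj_cst mulrCA wprojZ. Qed.
Lemma hank0l h : hank 0 h = 0. Proof. by rewrite /hank mul0r wproj0. Qed.
Lemma hank0r a : hank a 0 = 0. Proof. by rewrite /hank wconj0 mulr0 wproj0. Qed.
Lemma hankM a b h : hank (a * b) h = hank a (wconj b * h).
Proof. by rewrite /hank wconjM wconjK mulrA. Qed.
Lemma hardy_hank a h : hardy (hank a h). Proof. exact: hardy_proj. Qed.
Lemma hardy_toep a h : hardy (toep a h). Proof. exact: hardy_proj. Qed.

(** The antilinear counterpart of self-adjointness: both sides are the mean of
    [a * conj f * conj g]. *)
Lemma hank_sym a f g : hardy f -> hardy g -> ip (hank a f) g = ip (hank a g) f.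
Proof.
move=> hf hg; rewrite /hank !ip_projl// !ipE; congr (coef _ 0); ring.
Qed.
Lemma toep_sym b f g : wconj b = b -> hardy f -> hardy g -> ip (toep b f) g = ip f (toep b g).
Proof. by move=> bb hf hg; rewrite /toep ip_projl// ip_projr// ipMl bb. Qed.

Lemma nn_hank a h : nn (hank a h) <= wn a ^+ 2 * nn h.
Proof. by apply: le_trans (nn_proj _) _; rewrite -[in leRHS](nn_conj h) nn_mul. Qed.
Lemma nn_toep a h : nn (toep a h) <= wn a ^+ 2 * nn h.
Proof. by apply: le_trans (nn_proj _) _; exact: nn_mul. Qed.
Lemma wn_hank a h : wn (hank a h) <= wn a * wn h.
Proof. by apply: le_trans (wn_proj _) _; apply: le_trans (wnM _ _) _; rewrite wn_conj. Qed.

Lemma proj_anti f h : (forall k, 0 <= k -> coef f k = 0) -> hardy h -> wproj (f * wconj h) = 0.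
Proof.
move=> f0 hh; apply: walg_coef => k; rewrite coef0 coef_proj; case: ifP => // k0.
rewrite -[f * _]wconjK wconjM wconjK coef_conj.
have -> : wconj f * h = wz * ((wzb * wconj f) * h) by rewrite !mulrA wzzb mul1r.
rewrite coef_z hardyM ?conjc0//; last by lia.
by move=> j j0; rewrite coef_zb coef_conj f0 ?conjc0//; lia.
Qed.

(** Negative frequencies of the symbol stay negative against a conjugate Hardy function. This
    discards the damping term and identifies the operators of symbols [conj(z) u] and [S^* u]. *)
Lemma hank_anti a b h : (forall k, 0 <= k -> coef a k = coef b k) -> hardy h -> hank a h = hank b h.
Proof.
move=> ab hh; apply/eqP; rewrite -subr_eq0 -hankBl; apply/eqP; apply: proj_anti => // k k0.
by rewrite coefB ab// subrr.
Qed.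

(* The part of [a * conj h] killed by the projector is the conjugate of some [g], and
   [a * g] is then itself in the Hardy space. *)
Lemma hank_cub a h : hardy (wz * a) -> hardy h ->
  hank (cub a) h = toep (a * wconj a) (hank a h) + hank a (toep (a * wconj a) h)
    - hank a (hank a (hank a h)).
Proof.
move=> ha hh; pose X := a * wconj h; pose g := wconj (X - wproj X).
(* [g] has frequencies at least 1. The spare factor [z] compensates the coefficient of index [-1]
   that [hardy (wz * a)] allows, as for [a = conj(z) u]. *)
have hg : hardy (wzb * g).
  by move=> k k0; rewrite coef_zb coef_conj coef_negpart ?conjc0//; lia.
have e : a * g = toep (a * wconj a) h - hank a (hank a h).
  have hag : hardy (a * g).
    have -> : a * g = (wz * a) * (wzb * g).
      rewrite (_ : _ * _ * _ = (wz * wzb) * (a * g)); last by ring.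
      by rewrite wzzb mul1r.
    exact: hardyM.
  rewrite -(hardyK hag) /toep /hank -wprojB /g wconjB /X wconjM wconjK.
  by congr wproj; ring.
have -> : hank (cub a) h = wproj (a * wconj a * hank a h + a * wconj (a * g)).
  rewrite /hank /g /cub wconjM wconjK -/X; congr wproj; rewrite /X; ring.
rewrite wprojD e wconjB mulrBr wprojB /toep /hank addrA //.
Qed.

Lemma cImD (x y : C) : complex.Im (x + y) = complex.Im x + complex.Im y.
Proof. by case: x y => ? ? []. Qed.
Lemma cImN (x : C) : complex.Im (- x) = - complex.Im x.
Proof. by case: x. Qed.

Lemma Im_self_adjoint b f : wconj b = b -> hardy f -> complex.Im (ip (toep b f) f) = 0.
Proof.
move=> bb hf; have := ip_conj (toep b f) f; rewrite -toep_sym//.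
by case: (ip (toep b f) f) => u v /= [] e; lra.
Qed.

(** Of the three terms of [hank_cub] paired with [H_a h], the first is real because the Toeplitz
    operator is self-adjoint, and the last is [- |H_a^2 h|^2]; only the middle one has an imaginary
    part. *)
Lemma Im_hank_cub a h : hardy (wz * a) -> hardy h ->
  complex.Im (ip (hank (cub a) h) (hank a h)) =
  complex.Im (ip (hank a (hank a h)) (toep (a * wconj a) h)).
Proof.
move=> ha hh; rewrite hank_cub// ipBl ipDl cImD cImN cImD.
have bb : wconj (a * wconj a) = a * wconj a by rewrite wconjM wconjK mulrC.
rewrite Im_self_adjoint//; last exact: hardy_hank.
rewrite (hank_sym a (hardy_toep _ h))//; last exact: hardy_hank.
rewrite (hank_sym a (hardy_hank a (hank a h)) (hardy_hank a h)).
by rewrite ipff /= subr0 add0r.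
Qed.

End Hankel.

(** * Ky Fan sums and their variation along a Lax pair *)

Section KyFan.
Context {R : realType}.
Local Notation C := R[i].
Local Notation V := (walg R).
Implicit Types (a b f g h u w : V) (c : C).

Definition orthonormal (n : nat) (h : 'I_n -> V) :=
  (forall i, hardy (h i)) /\ forall i j, ip (h i) (h j) = (i == j)%:R.

Definition kyfan_at n a (h : 'I_n -> V) : R := \sum_(i < n) nn (hank a (h i)).

Definition kyfan_set n a : set R := [set kyfan_at a h | h in @orthonormal n].

(* Sum of the [n] largest eigenvalues of the square of the Hankel operator. *)
Definition kyfan n a : R := sup (kyfan_set n a).

Lemma orthonormal_nn n (h : 'I_n -> V) i : orthonormal h -> nn (h i) = 1.
Proof. by move=> [_ o]; rewrite nn_ip o eqxx. Qed.

Lemma orthonormal_exp n : orthonormal (fun i : 'I_n => wexp (Posz i)).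
Proof.
split=> [i|i j]; first exact: hardy_exp.
by rewrite ip_exp coef_exp eqz_nat.
Qed.

Lemma kyfan_at_le n a (h : 'I_n -> V) : orthonormal h -> kyfan_at a h <= n%:R * wn a ^+ 2.
Proof.
move=> oh; rewrite /kyfan_at.
apply: (@le_trans _ _ (\sum_(i < n) wn a ^+ 2)).
  by apply: ler_sum => i _; apply: le_trans (nn_hank _ _) _; rewrite (orthonormal_nn i oh) mulr1.
by rewrite sumr_const card_ord mulr_natl.
Qed.

Lemma has_sup_kyfan n a : has_sup (kyfan_set n a).
Proof.
split; first by exists (kyfan_at a (fun i : 'I_n => wexp (Posz i))), (fun i : 'I_n => wexp (Posz i)) => //; exact: orthonormal_exp.
by exists (n%:R * wn a ^+ 2) => _ [h oh <-]; exact: kyfan_at_le.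
Qed.

Lemma kyfan_ge n a (h : 'I_n -> V) : orthonormal h -> kyfan_at a h <= kyfan n a.
Proof. by move=> oh; apply: sup_upper_bound; [exact: has_sup_kyfan|exists h]. Qed.

Lemma kyfan_le n a B : (forall h : 'I_n -> V, orthonormal h -> kyfan_at a h <= B) -> kyfan n a <= B.
Proof.
move=> hB; apply: ge_sup; first by case: (has_sup_kyfan n a).
by move=> _ [h oh <-]; exact: hB.
Qed.

Lemma kyfan_adherent n a (e : R) : 0 < e ->
  exists2 h : 'I_n -> V, orthonormal h & kyfan n a - e < kyfan_at a h.
Proof.
move=> e0; have [_ [h oh <-] lt] := sup_adherent e0 (has_sup_kyfan n a).
by exists h.
Qed.

Lemma sqr_mono (x y : R) : 0 <= x -> x <= y -> x ^+ 2 <= y ^+ 2.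
Proof. by move=> x0 xy; rewrite lerXn2r ?nnegrE// (le_trans x0). Qed.

Lemma cIm_sum I (r : seq I) (P : pred I) (F : I -> C) :
  complex.Im (\sum_(i <- r | P i) F i) = \sum_(i <- r | P i) complex.Im (F i).
Proof. by elim/big_rec2: _ => [|i x y _ <-] //; rewrite cImD. Qed.

Definition kf_coef n a (h : 'I_n -> V) i j : C := ip (hank a (hank a (h i))) (h j).
(** The part of [H_a^2 h_i] orthogonal to the family: it measures how far the span is from being
    invariant under [H_a^2]. *)
Definition kf_res n a (h : 'I_n -> V) i : V :=
  hank a (hank a (h i)) - \sum_j wcst (kf_coef a h i j) * h j.

Lemma hardy_sum I (r : seq I) (P : pred I) (F : I -> V) :
  (forall i, hardy (F i)) -> hardy (\sum_(i <- r | P i) F i).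
Proof.
move=> hF; elim/big_rec: _ => [|i x _ hx]; first exact: hardy0.
exact: hardyD.
Qed.

Lemma hardy_res n a (h : 'I_n -> V) i : orthonormal h -> hardy (kf_res a h i).
Proof.
move=> [hh _]; apply: hardyB; first exact: hardy_hank.
by apply: hardy_sum => j; exact: hardyZ.
Qed.

Lemma res_orth n a (h : 'I_n -> V) i j : orthonormal h -> ip (kf_res a h i) (h j) = 0.
Proof.
move=> [hh o]; rewrite /kf_res ipBl ip_suml (bigD1 j)//= ipZl o eqxx mulr1.
rewrite big1 ?addr0 ?subrr// => l /negbTE lj.
by rewrite ipZl o lj mulr0.
Qed.

(** Near-maximizers behave like families of eigenvectors. Tilting [h i] towards its residual raises
    the sum at first order in the angle while normalization costs only second order, so a large
    residual would beat the supremum. *)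
Lemma res_small n a (h : 'I_n -> V) i eta : orthonormal h -> 0 <= eta <= 1 ->
  kyfan n a - eta <= kyfan_at a h -> nn (kf_res a h i) <= eta * (wn a ^+ 2 + 1).
Proof.
move=> oh /andP[eta0 eta1] close; have [hh o] := oh.
set r := kf_res a h i; set A := wn a ^+ 2 + 1.
have A1 : 0 < A by rewrite /A; have := sqr_ge0 (wn a); lra.
have hr : hardy r by exact: hardy_res.
have rh : ip r (h i) = 0 by exact: res_orth.
(* The tilt [e] gains [2 e |r|^2] and normalization costs at most [A e^2 |r|^2 = e |r|^2]; the
   surplus [e |r|^2] cannot exceed [eta]. *)
pose e := A^-1.
have e0 : 0 < e by rewrite invr_gt0.
have r0 := nn_ge0 r.
pose D := 1 + e ^+ 2 * nn r.
have D1 : 1 <= D by rewrite /D lerDl mulr_ge0 ?sqr_ge0.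
have D0 : 0 < D by exact: lt_le_trans D1.
pose s := (Num.sqrt D)^-1.
have s2 : s ^+ 2 * D = 1.
  by rewrite /s exprVn sqr_sqrtr ?ltW// mulVf// gt_eqF.
pose hi := wcst s%:C%C * (h i + wcst e%:C%C * r).
pose h' j := if j == i then hi else h j.
have nhi x : nn (wcst x%:C%C * r) = x ^+ 2 * nn r by rewrite nnZ nrm_real real_normK// num_real.
have oh' : orthonormal h'.
  split=> [j|j l]; rewrite /h'.
    by case: eqP => // _; apply: hardyZ; apply: hardyD => //; exact: hardyZ.
  have ort m : m != i -> ip hi (h m) = 0.
    by move=> mi; rewrite ipZl ipDl ipZl res_orth// o eq_sym (negbTE mi) mulr0 addr0 mulr0.
  have self : ip hi hi = 1.
    rewrite ipff nnZ nrm_real real_normK ?num_real// nnD nhi ipZr ip_conj rh conjc0 mulr0.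
    by rewrite (orthonormal_nn i oh) /= mulr0 addr0 -/D s2.
  case: (eqVneq j i) => [ji|ji]; case: (eqVneq l i) => [li|li].
  - by rewrite self ji li eqxx.
  - by rewrite ort// ji eq_sym (negbTE li).
  - by rewrite ip_conj ort// conjc0 li (negbTE ji).
  - exact: o.
have := kyfan_ge a oh'; rewrite /kyfan_at (bigD1 i)//= {1}/h' eqxx.
rewrite (eq_bigr (fun j => nn (hank a (h j)))); last by move=> j ji; rewrite /h' (negbTE ji).
move: close; rewrite /kyfan_at (bigD1 i)//=; set rest := \sum_(j | _) _.
set N := kyfan n a.
have -> : nn (hank a hi) = s ^+ 2 * (nn (hank a (h i)) + 2 * e * nn r + e ^+ 2 * nn (hank a r)).
  rewrite hankZr nnZ nrm_conj nrm_real real_normK ?num_real// hankDr hankZr conjc_rc nnD nnZ.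
  rewrite nrm_real real_normK ?num_real// ipZr conjc_rc cRe_rcM.
  rewrite (Re_ip_conj (hank a r)) (hank_sym a hr (hardy_hank a (h i))).
  have -> : ip (hank a (hank a (h i))) r = (nn r)%:C%C.
    have z : ip (\sum_j wcst (kf_coef a h i j) * h j) r = 0.
      by rewrite ip_suml big1// => j _; rewrite ipZl ip_conj res_orth// conjc0 mulr0.
    rewrite -ipff -[in LHS](subrK (\sum_j wcst (kf_coef a h i j) * h j) (hank a (hank a (h i)))).
    by rewrite ipDl z addr0.
  by rewrite /= mulrA.
move=> h1 h2.
have Kr := nn_ge0 (hank a r).
have Ki : nn (hank a (h i)) <= wn a ^+ 2.
  by apply: le_trans (nn_hank _ _) _; rewrite (orthonormal_nn i oh) mulr1.
have s0 : 0 <= s ^+ 2 by exact: sqr_ge0.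
have h3 : s ^+ 2 * (nn (hank a (h i)) + 2 * e * nn r + e ^+ 2 * nn (hank a r)) <= nn (hank a (h i)) + eta.
  lra.
have h4 : nn (hank a (h i)) + 2 * e * nn r + e ^+ 2 * nn (hank a r) <= (nn (hank a (h i)) + eta) * D.
  have := ler_wpM2r (ltW D0) h3; rewrite mulrAC s2 mul1r//.
have h5 : 0 <= e ^+ 2 * nn (hank a r) by rewrite mulr_ge0 ?sqr_ge0.
have h6 : (nn (hank a (h i)) + eta) * (e ^+ 2 * nn r) <= A * (e ^+ 2 * nn r).
  by rewrite ler_wpM2r ?mulr_ge0 ?sqr_ge0// /A; lra.
have h7 : A * (e ^+ 2 * nn r) = e * nn r by rewrite /e; field; rewrite gt_eqF.
have h8 : 2 * e * nn r <= eta + e * nn r.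
  by move: h4; rewrite /D mulrDr mulr1; lra.
have : e * nn r <= eta by lra.
by rewrite /e mulrC ler_pdivrMr.
Qed.

(* The trace of a product of two self-adjoint matrices is real. *)
Lemma Im_trace n a b (h : 'I_n -> V) : wconj b = b -> orthonormal h ->
  complex.Im (\sum_i ip (hank a (hank a (h i))) (toep b (h i))) =
  complex.Im (\sum_i ip (kf_res a h i) (toep b (h i))).
Proof.
move=> bb [hh o].
pose A i j := kf_coef a h i j; pose T i j := ip (h j) (toep b (h i)).
have -> : \sum_i ip (hank a (hank a (h i))) (toep b (h i)) =
   \sum_i ip (kf_res a h i) (toep b (h i)) + \sum_i \sum_j A i j * T i j.
  rewrite -big_split; apply: eq_bigr => i _ /=.
  rewrite -[in LHS](subrK (\sum_j wcst (kf_coef a h i j) * h j) (hank a (hank a (h i)))).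
  rewrite ipDl ip_suml; congr (_ + _); apply: eq_bigr => j _; by rewrite ipZl.
suff r : conjc (\sum_i \sum_j A i j * T i j) = \sum_i \sum_j A i j * T i j.
  by rewrite cImD; move: r; case: (\sum_i \sum_j _) => x y /= [] e; lra.
rewrite (raddf_sum (@conjc R)) exchange_big /=; apply: eq_bigr => i _.
rewrite (raddf_sum (@conjc R)); apply: eq_bigr => j _.
change (conjc (A i j * T i j) = A j i * T j i).
rewrite conjcM /A /T /kf_coef -ip_conj.
rewrite -ip_conj toep_sym//; congr (_ * _).
rewrite ip_conj (hank_sym a (hardy_hank _ _))//.
by rewrite -ip_conj (hank_sym a (hardy_hank _ _)).
Qed.

(** The quadratic form of [d/dt H_a^2 = - i [T_B, H_a^2]] along [da/dt = b], where the derivative of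
    [|H_a h|^2] is [2 Re (H_b h | H_a h)]. *)
Definition lax_pair a b := exists2 B, wconj B = B &
  forall h, hardy h -> complex.Re (ip (hank b h) (hank a h)) =
    complex.Im (ip (hank a (hank a h)) (toep B h)).

(** [a'] is tested on a near-maximizer for [a]. The first-order term is the imaginary part of a
    trace, hence carried by the residuals and arbitrarily small; what remains is quadratic in [d].
    The sign of [d] is free, so both directions of time are covered. *)
Lemma kyfan_step n a b a' (d C0 : R) : lax_pair a b -> 0 <= C0 ->
  wn (a' - a - wcst d%:C%C * b) <= C0 * d ^+ 2 ->
  kyfan n a - 2 * n%:R * C0 * wn a * d ^+ 2 <= kyfan n a'.
Proof.
move=> [B BB laxB] C00 wc.
rewrite lerBlDr; apply/ler_addgt0Pr => e e0.
have a0 := wn_ge0 a; have B0 := wn_ge0 B.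
pose L := 1 + 2 * `|d| * n%:R * wn B.
have L0 : 0 < L.
  by rewrite ltr_pwDl// !mulr_ge0.
pose A := wn a ^+ 2 + 1.
have A1 : 1 <= A by rewrite lerDr sqr_ge0.
(* Residuals of size [q] alter the estimate by at most [q * L <= e]; [eta] below is the defect to
   which [res_small] associates such residuals. *)
pose q := Num.min 1 (e / L).
have q0 : 0 < q by rewrite lt_min ltr01 divr_gt0.
have q1 : q <= 1 by rewrite ge_min lexx.
have qL : q * L <= e by rewrite -ler_pdivlMr// ge_min lexx orbT.
pose eta := q ^+ 2 / A.
have eta0 : 0 < eta by rewrite divr_gt0 ?exprn_gt0//; lra.
have etaq : eta <= q.
  rewrite ler_pdivrMr; last by lra.
  by rewrite expr2 ler_wpM2l ?(ltW q0)//; lra.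
have eta1 : eta <= 1 by lra.
have [h oh close] := kyfan_adherent n a eta0; have [hh o] := oh.
have res i : nn (kf_res a h i) <= q ^+ 2.
  apply: le_trans (res_small i oh _ (ltW close)) _; first by rewrite ltW.
  by rewrite -/A /eta divfK// gt_eqF//; lra.
pose y i := wcst d%:C%C * hank b (h i) + hank (a' - a - wcst d%:C%C * b) (h i).
have ye i : hank a' (h i) = hank a (h i) + y i.
  rewrite /y -hankZl -!hankDl; congr (hank _ _); ring.
(* The square [|y i|^2] has the right sign for a lower bound and is dropped. *)
have lowers : kyfan_at a h + 2 * \sum_i complex.Re (ip (y i) (hank a (h i))) <= kyfan_at a' h.
  rewrite /kyfan_at mulr_sumr -big_split; apply: ler_sum => i _ /=.
  by rewrite ye nnD Re_ip_conj lerDl nn_ge0.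
have split : \sum_i complex.Re (ip (y i) (hank a (h i))) =
   d * \sum_i complex.Re (ip (hank b (h i)) (hank a (h i))) +
   \sum_i complex.Re (ip (hank (a' - a - wcst d%:C%C * b) (h i)) (hank a (h i))).
  rewrite mulr_sumr -big_split; apply: eq_bigr => i _ /=.
  by rewrite /y ipDl cReD ipZl cRe_rcM.
have p1 : `|\sum_i complex.Re (ip (hank b (h i)) (hank a (h i)))| <= n%:R * (q * wn B).
  have -> : \sum_i complex.Re (ip (hank b (h i)) (hank a (h i))) =
     complex.Im (\sum_i ip (hank a (hank a (h i))) (toep B (h i))).
    by rewrite cIm_sum; apply: eq_bigr => i _; rewrite laxB.
  rewrite Im_trace// cIm_sum.
  apply: le_trans (ler_norm_sum _ _ _) _.
  apply: (@le_trans _ _ (\sum_(i < n) q * wn B)); last by rewrite sumr_const card_ord mulr_natl.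
  apply: ler_sum => i _; apply: le_trans (absIm_le _) _.
  apply: nrm_ip_le => //; first exact: ltW.
  by apply: le_trans (nn_toep _ _) _; rewrite (orthonormal_nn i oh) mulr1.
have p2 : `|\sum_i complex.Re (ip (hank (a' - a - wcst d%:C%C * b) (h i)) (hank a (h i)))| <= n%:R * (C0 * d ^+ 2 * wn a).
  apply: le_trans (ler_norm_sum _ _ _) _.
  apply: (@le_trans _ _ (\sum_(i < n) C0 * d ^+ 2 * wn a)); last by rewrite sumr_const card_ord mulr_natl.
  apply: ler_sum => i _; apply: le_trans (absRe_le _) _.
  apply: nrm_ip_le => //; first by rewrite mulr_ge0 ?sqr_ge0.
    apply: le_trans (nn_hank _ _) _; rewrite (orthonormal_nn i oh) mulr1.
    exact: sqr_mono (wn_ge0 _) wc.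
  by apply: le_trans (nn_hank _ _) _; rewrite (orthonormal_nn i oh) mulr1.
have p3 : `|d * \sum_i complex.Re (ip (hank b (h i)) (hank a (h i)))| <= `|d| * (n%:R * (q * wn B)).
  by rewrite normrM ler_wpM2l.
have := kyfan_ge a' oh.
move: p2 p3 lowers; rewrite split; set P := \sum_(i < n) _; set Q := d * _ => p2 p3 lowers top.
have P0 := ler_norm (- P); have Q0 := ler_norm (- Q); rewrite normrN in P0; rewrite normrN in Q0.
have -> : 2 * n%:R * C0 * wn a * d ^+ 2 = 2 * (n%:R * (C0 * d ^+ 2 * wn a)) by ring.
have e1 : q + 2 * (`|d| * (n%:R * (q * wn B))) <= e.
  by apply: le_trans qL; rewrite /L le_eqVlt; apply/orP; left; apply/eqP; ring.
lra.
Qed.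

End KyFan.

(** * Moments and the top of the spectrum *)

Section Null.
Context {R : realType}.
Implicit Types (x y : nat -> R).

Definition null x := forall e, 0 < e -> exists N, forall n, (N <= n)%N -> `|x n| <= e.

Lemma null_le x y (c : R) : (forall n, `|x n| <= c * `|y n|) -> null y -> null x.
Proof.
move=> xy ny e e0.
have c0 : 0 < `|c| + 1 by rewrite ltr_wpDl.
have [N hN] := ny _ (divr_gt0 e0 c0); exists N => n Nn.
apply: le_trans (xy n) _; have h := hN n Nn.
apply: (@le_trans _ _ ((`|c| + 1) * `|y n|)).
  by rewrite ler_wpM2r// (le_trans (ler_norm _))// lerDl.
by rewrite -ler_pdivlMl// mulrC.
Qed.

Lemma nullD x y : null x -> null y -> null (fun n => x n + y n).
Proof.
move=> nx ny e e0; have e2 : 0 < e / 2 by rewrite divr_gt0.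
have [N hN] := nx _ e2; have [M hM] := ny _ e2; exists (maxn N M) => n.
rewrite geq_max => /andP[Nn Mn]; apply: le_trans (ler_normD _ _) _.
by have := hN n Nn; have := hM n Mn; lra.
Qed.

Lemma null_sum I (r : seq I) (F : I -> nat -> R) : (forall i, null (F i)) ->
  null (fun n => \sum_(i <- r) F i n).
Proof.
move=> nF; elim: r => [|i r IH].
  by move=> e e0; exists 0%N => n _; rewrite big_nil normr0 ltW.
move=> e e0; have [N hN] := nullD (nF i) IH e0; exists N => n Nn.
by rewrite big_cons; exact: hN.
Qed.

Lemma null_sqr x y : (forall n, x n ^+ 2 <= `|y n|) -> null y -> null x.
Proof.
move=> xy ny e e0; have [N hN] := ny _ (exprn_gt0 2 e0); exists N => n Nn.
rewrite -(@ler_pXn2r _ 2) ?nnegrE ?(ltW e0)// real_normK ?num_real//.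
exact: le_trans (xy n) (hN n Nn).
Qed.

End Null.

(** * Visibility of the top of the spectrum from the constant function *)

Section Visibility.
Context {R : realType}.
Local Notation C := R[i].
Local Notation V := (walg R).
Implicit Types (a b f g u w : V) (c : C) (h : nat -> V).

Definition sadj f : V := wzb * (f - wcst (coef f 0)).

Lemma coef_sadj f k : coef (sadj f) k = if k == -1 then 0 else coef f (k + 1).
Proof.
rewrite coef_zb coefB coef_cst addr_eq0; case: eqP => [->|_]; rewrite ?subr0//.
by rewrite addNr subrr.
Qed.
Lemma hardy_sadj f : hardy f -> hardy (sadj f).
Proof.
by move=> hf k k0; rewrite coef_sadj; case: eqP => // /eqP k1; rewrite hf//; lia.
Qed.
Lemma ip_cstr f c : ip f (wcst c) = conjc c * coef f 0.
Proof. by rewrite -[wcst c]mulr1 ipZr ip1r. Qed.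
Lemma nn_sadj f : nn (sadj f) = nn f - nrm (coef f 0) ^+ 2.
Proof.
rewrite nn_expM nnB ip_cstr nn_cst [conjc _ * _]mulrC mul_conj /=; ring.
Qed.
Lemma sadjB f g : sadj (f - g) = sadj f - sadj g.
Proof. by rewrite /sadj coefB wcstB -mulrBr; congr (_ * _); ring. Qed.
Lemma sadjZ c f : sadj (wcst c * f) = wcst c * sadj f.
Proof. by rewrite /sadj coefZ wcstM -mulrBr mulrCA. Qed.
Lemma nn_sadj_le f : nn (sadj f) <= nn f.
Proof. by rewrite nn_sadj gerBl sqr_ge0. Qed.

Lemma hank_zb a f : hank (wzb * a) f = hank a (wz * f).
Proof. by rewrite mulrC hankM wconj_zb. Qed.

Lemma hank_zb_sadj a f : hardy f -> hank (wzb * a) f = sadj (hank a f).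
Proof.
move=> hf; apply: walg_coef => k.
rewrite coef_sadj !coef_proj -mulrA coef_zb.
case: eqP => [->//|/eqP k1]; case: (ltP k 0) => k0; first by rewrite !ifF//; lia.
by rewrite ifT//; lia.
Qed.

(** The rank-one relation between the squares of the Hankel operator and of the shifted one, as
    quadratic forms; it comes from [H_b = S^* H_a] for [b = conj(z) a]. *)
Lemma nn_hank_zb a f : hardy f -> nn (hank (wzb * a) f) = nn (hank a f) - nrm (ip (hank a f) 1) ^+ 2.
Proof. by move=> hf; rewrite hank_zb_sadj// nn_sadj ip1r. Qed.

Lemma nn_hank_kyfan a f : hardy f -> nn (hank a f) <= kyfan 1 a * nn f.
Proof.
move=> hf; have [f0|f0] := eqVneq (nn f) 0.
  by rewrite (nn_eq0 f0) hank0r nn0 mulr0.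
have fp : 0 < nn f by rewrite lt0r f0 nn_ge0.
pose s := (Num.sqrt (nn f))^-1.
have s2 : s ^+ 2 = (nn f)^-1 by rewrite exprVn sqr_sqrtr ?ltW.
have os : orthonormal (fun _ : 'I_1 => wcst s%:C%C * f).
  split=> [_|i j]; first exact: hardyZ.
  by rewrite !ord1 eqxx ipff nnZ nrm_real real_normK ?num_real// s2 mulVf.
have := kyfan_ge a os; rewrite /kyfan_at big_ord1 hankZr nnZ nrm_conj nrm_real.
by rewrite real_normK ?num_real// s2 ler_pdivrMl// mulrC.
Qed.

Lemma kyfan_ge0 n a : 0 <= kyfan n a.
Proof.
apply: le_trans (kyfan_ge a (orthonormal_exp n)).
by apply: sumr_ge0 => i _; exact: nn_ge0.
Qed.

Lemma kyfan1_zb a : kyfan 1 (wzb * a) <= kyfan 1 a.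
Proof.
apply: kyfan_le => f of_; rewrite /kyfan_at big_ord1 hank_zb.
apply: le_trans (nn_hank_kyfan _ _) _; first by apply: hardyM; [exact: hardy_z|case: of_].
by rewrite nn_expM (orthonormal_nn _ of_) mulr1.
Qed.

Definition bounded_hardy h := (forall n, hardy (h n)) /\ exists B, forall n, nn (h n) <= B.

(** Approximate eigenvectors for the top [L] of [H_a^2], without normalization: null sequences
    qualify, which makes the class stable under scaling, null perturbations, [H_a] and, in the proof
    by contradiction below, [S^*]. *)
Definition maximizing (L : R) a h :=
  bounded_hardy h /\ null (fun n => L * nn (h n) - nn (hank a (h n))).

Lemma nnD_le f g : nn (f + g) <= 2 * nn f + 2 * nn g.
Proof. by have := nn_ge0 (f - g); rewrite nnB nnD; lra. Qed.

Section Operator.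
Variables (L : R) (a : V).
Hypothesis L0 : 0 <= L.
Hypothesis La : forall f, hardy f -> nn (hank a f) <= L * nn f.

Lemma defect_ge0 f : hardy f -> 0 <= L * nn f - nn (hank a f).
Proof. by move=> hf; rewrite subr_ge0 La. Qed.

Lemma ip_hank2 f : hardy f -> ip (hank a (hank a f)) f = (nn (hank a f))%:C%C.
Proof. by move=> hf; rewrite hank_sym ?ipff//; exact: hardy_hank. Qed.

(** Expand the square and bound [|H_a^2 f|^2] by [L |H_a f|^2]. *)
Lemma nn_defect f : hardy f ->
  nn (wcst L%:C%C * f - hank a (hank a f)) <= L * (L * nn f - nn (hank a f)).
Proof.
move=> hf; rewrite nnB nnZ nrm_real real_normK ?num_real// ipZl cRe_rcM.
rewrite -Re_ip_conj ip_hank2//=.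
have := La (hardy_hank a f); have := nn_ge0 (hank a f); nra.
Qed.

Lemma maximizing_defect h : maximizing L a h ->
  null (fun n => nn (wcst L%:C%C * h n - hank a (hank a (h n)))).
Proof.
move=> [[hh [B hB]] mx]; apply: null_le mx => n.
rewrite (ger0_norm (nn_ge0 _)) ger0_norm; last exact: defect_ge0.
exact: nn_defect.
Qed.

Lemma bounded_hank h : bounded_hardy h -> bounded_hardy (fun n => hank a (h n)).
Proof.
move=> [hh [B hB]]; split=> [n|]; first exact: hardy_hank.
by exists (L * B) => n; apply: le_trans (La (hh n)) _; rewrite ler_wpM2l.
Qed.

(** The defect of [H_a f] equals [Re (H_a r | H_a f)] with [r = L f - H_a^2 f], which tends to 0 by
    [maximizing_defect]. *)
Lemma maximizing_hank h : maximizing L a h -> maximizing L a (fun n => hank a (h n)).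
Proof.
move=> mx; have df := maximizing_defect mx; have [bh _] := mx.
have bH := bounded_hank bh; have [hh _] := bh; have [_ [B hB]] := bH.
split=> //; apply: (@null_sqr _ _ (fun n => L * B * nn (wcst L%:C%C * h n - hank a (hank a (h n))))).
  move=> n; set r := wcst _ * _ - _.
  have hr : hardy r by apply: hardyB; [exact: hardyZ|exact: hardy_hank].
  have -> : L * nn (hank a (h n)) - nn (hank a (hank a (h n))) =
     complex.Re (ip (hank a r) (hank a (h n))).
    rewrite /r hankBr hankZr conjc_rc ipBl cReD cReN ipZl cRe_rcM ipff.
    by rewrite [in X in _ = _ - X]hank_sym ?ipff//; exact: hardy_hank.
  have B0 : 0 <= B by exact: le_trans (nn_ge0 _) (hB 0%N).
  rewrite ger0_norm; last by rewrite !mulr_ge0 ?nn_ge0.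
  apply: (@le_trans _ _ (nrm (ip (hank a r) (hank a (h n))) ^+ 2)).
    by rewrite -real_normK ?num_real// sqr_mono// absRe_le.
  apply: le_trans (cauchy_schwarz _ _) _.
  rewrite mulrAC; apply: ler_pM (nn_ge0 _) (nn_ge0 _) (La hr) (hB n).
by apply: null_le df => n; rewrite normrM ler_wpM2r// ler_norm.
Qed.

Lemma maximizing_add h h' : maximizing L a h -> (forall n, hardy (h' n)) ->
  null (fun n => nn (h' n)) -> maximizing L a (fun n => h n + h' n).
Proof.
move=> mx hh' n0; have [[hh [B hB]] d0] := mx.
have B0 : 0 <= B by exact: le_trans (nn_ge0 _) (hB 0%N).
have [M hM] := n0 1 ltr01.
have bnd' : exists B', forall n, nn (h' n) <= B'.
  exists (1 + \sum_(i < M) nn (h' i)) => n.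
  have [Mn|nM] := leqP M n.
    have := hM n Mn; rewrite (ger0_norm (nn_ge0 _)) => le1; apply: le_trans le1 _.
    by rewrite lerDl sumr_ge0// => i _; exact: nn_ge0.
  rewrite (bigD1 (Ordinal nM))//= addrCA lerDl addr_ge0// sumr_ge0// => i _; exact: nn_ge0.
have [B' hB'] := bnd'.
split; first split=> [n|].
- exact: hardyD.
- by exists (2 * B + 2 * B') => n; have := nnD_le (h n) (h' n); have := hB n; have := hB' n; lra.
have c1 : null (fun n => nrm (ip (h n) (h' n))).
  apply: (@null_sqr _ _ (fun n => B * nn (h' n))).
    move=> n; apply: le_trans (cauchy_schwarz _ _) _.
    by rewrite ger0_norm ?mulr_ge0 ?nn_ge0// ler_wpM2r ?nn_ge0.
  by apply: null_le n0 => n; rewrite normrM ler_wpM2r// ler_norm.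
have c2 : null (fun n => nrm (ip (hank a (h n)) (hank a (h' n)))).
  apply: (@null_sqr _ _ (fun n => L * B * L * nn (h' n))).
    move=> n; apply: le_trans (cauchy_schwarz _ _) _.
    rewrite ger0_norm ?mulr_ge0 ?nn_ge0// -mulrA.
    apply: ler_pM; rewrite ?nn_ge0 ?La//.
    by apply: le_trans (La (hh n)) _; rewrite ler_wpM2l.
  by apply: null_le n0 => n; rewrite normrM ler_wpM2r// ler_norm.
apply: (@null_le _ _ (fun n => (L * nn (h n) - nn (hank a (h n))) +
  (2 * L * nrm (ip (h n) (h' n)) + (2 * nrm (ip (hank a (h n)) (hank a (h' n))) + L * nn (h' n)))) 1); last first.
  apply: nullD => //; apply: nullD; last apply: nullD.
  - by apply: null_le c1 => n; rewrite normrM ler_wpM2r// ler_norm.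
  - by apply: null_le c2 => n; rewrite normrM ler_wpM2r// ler_norm.
  - by apply: null_le n0 => n; rewrite normrM ler_wpM2r// ler_norm.
move=> n; rewrite mul1r ger0_norm; last by apply: defect_ge0; exact: hardyD.
apply: le_trans (ler_norm _).
rewrite hankDr !nnD.
have p1 := le_trans (ler_norm _) (absRe_le (ip (h n) (h' n))).
have p2 := le_trans (ler_norm _) (absRe_le (- ip (hank a (h n)) (hank a (h' n)))).
rewrite nrmN cReN in p2.
have p3 := nn_ge0 (hank a (h' n)).
have p4 := ler_wpM2l L0 p1.
rewrite !mulrDr; lra.
Qed.

Lemma maximizing_scale c h : maximizing L a h -> maximizing L a (fun n => wcst c * h n).
Proof.
move=> [[hh [B hB]] d0]; split; first split=> [n|].
- exact: hardyZ.
- by exists (nrm c ^+ 2 * B) => n; rewrite nnZ ler_wpM2l ?sqr_ge0.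
apply: null_le d0 => n; rewrite hankZr !nnZ nrm_conj.
rewrite (_ : _ - _ = nrm c ^+ 2 * (L * nn (h n) - nn (hank a (h n)))); last by ring.
by rewrite normrM (ger0_norm (sqr_ge0 _)).
Qed.

End Operator.

Lemma hank_exp_coef (k : nat) f : hardy f ->
  hank (wexp (Posz k)) f = \sum_(0 <= l < k.+1) wcst (conjc (coef f (Posz l))) * wexp (Posz k - Posz l).
Proof.
move=> hf; apply: walg_coef => n.
rewrite coef_proj coef_shift coef_conj opprB coef_sum.
under eq_bigr do rewrite coefZ coef_exp.
case: n => n; last first.
  by rewrite big_nat big1// => l lk; case: eqP => [e|_]; rewrite ?mulr0//; lia.
rewrite /= big_mkord; have [nk|kn] := leqP n k.
  have lt : (k - n < k.+1)%N by lia.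
  rewrite (bigD1 (Ordinal lt))//= big1 ?addr0; last first.
    move=> i; rewrite -val_eqE /= => ik; case: eqP => [e|_]; rewrite ?mulr0//.
    by move/eqP: ik; lia.
  rewrite (_ : Posz k - Posz n = Posz (k - n)); last by lia.
  by case: eqP => [_|]; rewrite ?mulr1//; lia.
rewrite big1; last first.
  by move=> i _; case: eqP => [e|_]; rewrite ?mulr0//; have := ltn_ord i; lia.
by rewrite hf ?conjc0//; lia.
Qed.

Lemma hank_exp_neg k f : k < 0 -> hardy f -> hank (wexp k) f = 0.
Proof.
move=> k0 hf; apply: proj_anti => // n n0; rewrite coef_exp; case: eqP => // e; lia.
Qed.

(** Truncating the symbol makes the operator a norm limit of operators of finite rank, hence
    compact: bounded sequences that tend to 0 coefficientwise have images that tend to 0 in norm. *)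
Lemma hank_compact a h : bounded_hardy h ->
  (forall m : nat, null (fun n => nrm (coef (h n) (Posz m)))) ->
  null (fun n => nn (hank a (h n))).
Proof.
move=> [hh [B hB]] ch e e0.
have B0 : 0 <= B by exact: le_trans (nn_ge0 _) (hB 0%N).
(* The truncation error [d] must satisfy [d^2 * B <= e / 4], where [B] bounds the squared norms of
   the sequence. *)
have e1 : 0 < Num.min 1 (e / (4 * (B + 1))) by rewrite lt_min ltr01 divr_gt0//; lra.
have [N hN] := wn_wtr a e1; have {hN} := hN N (leqnn _).
set d := wn _ => dN.
have dd : d ^+ 2 * B <= e / 4.
  have d0 : 0 <= d by exact: wn_ge0.
  have d1 : d <= 1 by apply: le_trans dN _; rewrite ge_min lexx.
  have d2 : d * (4 * (B + 1)) <= e.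
    by rewrite -ler_pdivlMr; [apply: le_trans dN _; rewrite ge_min lexx orbT|lra].
  nra.
have fin : null (fun n => wn (hank (wtr a N) (h n))).
  have hs n : hank (wtr a N) (h n) = \sum_(j <- ints N) wcst (coef a j) * hank (wexp j) (h n).
    rewrite /wtr; elim: (ints N) => [|j s IH]; first by rewrite !big_nil hank0l.
    by rewrite !big_cons hankDl IH hankZl.
  have one j : null (fun n => wn (wcst (coef a j) * hank (wexp j) (h n))).
    case: j => j; last first.
      by move=> x x0; exists 0%N => n _; rewrite hank_exp_neg// mulr0 wn0 normr0 ltW.
    have : null (fun n => \sum_(l <- index_iota 0 j.+1) nrm (coef (h n) (Posz l))).
      by apply: null_sum => l; exact: ch.
    apply: (@null_le _ _ _ (nrm (coef a (Posz j)))) => n.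
    rewrite wnZ ger0_norm ?mulr_ge0 ?nrm_ge0 ?wn_ge0//.
    rewrite ler_wpM2l ?nrm_ge0// ger0_norm ?sumr_ge0//; last by move=> l _; exact: nrm_ge0.
    rewrite hank_exp_coef//; elim: (index_iota 0 j.+1) => [|l s IH]; first by rewrite !big_nil wn0.
    rewrite !big_cons; apply: le_trans (wnD _ _) _; apply: lerD IH.
    rewrite wnZ nrm_conj ler_piMr ?nrm_ge0//; exact: wn_exp.
  apply: (@null_le _ _ (fun n => \sum_(j <- ints N) wn (wcst (coef a j) * hank (wexp j) (h n))) 1).
    move=> n; rewrite mul1r hs ger0_norm ?wn_ge0// ger0_norm ?sumr_ge0//; last by move=> j _; exact: wn_ge0.
    elim: (ints N) => [|l s IH]; first by rewrite !big_nil wn0.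
    by rewrite !big_cons; apply: le_trans (wnD _ _) _; apply: lerD IH.
  exact: null_sum.
have e2 : 0 < Num.min 1 (e / 4) by rewrite lt_min ltr01 divr_gt0.
have [M hM] := fin _ e2; exists M => n Mn.
rewrite ger0_norm ?nn_ge0//.
have := hM n Mn; rewrite ger0_norm ?wn_ge0// => wM.
have w1 : wn (hank (wtr a N) (h n)) <= 1 by apply: le_trans wM _; rewrite ge_min lexx.
have w2 : wn (hank (wtr a N) (h n)) <= e / 4 by apply: le_trans wM _; rewrite ge_min lexx orbT.
have w3 : nn (hank (wtr a N) (h n)) <= e / 4.
  apply: le_trans (nn_le_wn _) _; apply: le_trans w2.
  by rewrite expr2 ler_piMr ?wn_ge0.
have w4 : nn (hank (a - wtr a N) (h n)) <= e / 4.
  by apply: le_trans (nn_hank _ _) _; apply: le_trans dd; rewrite ler_wpM2l ?sqr_ge0.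
have -> : hank a (h n) = hank (a - wtr a N) (h n) + hank (wtr a N) (h n).
  by rewrite -hankDl subrK.
have := nn_ge0 (hank (a - wtr a N) (h n) - hank (wtr a N) (h n)); rewrite nnB nnD; lra.
Qed.

Lemma ip_hank2_adj a f g : hardy f -> hardy g ->
  ip (hank a (hank a f)) g = ip f (hank a (hank a g)).
Proof.
move=> hf hg; rewrite (hank_sym a (hardy_hank a f) hg) ip_conj.
rewrite (hank_sym a hf (hardy_hank a g)) -ip_conj //.
Qed.

Definition hiter a n : V := iter n (hank a) 1.

Lemma hardy_hiter a n : hardy (hiter a n).
Proof. by case: n => [|n]; [exact: hardy1|exact: hardy_hank]. Qed.

Lemma hiterS a n : hiter a n.+1 = hank a (hiter a n). Proof. by []. Qed.

Lemma ip_hiter_swap a m n : nrm (ip (hiter a m.+1) (hiter a n)) = nrm (ip (hiter a m) (hiter a n.+1)).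
Proof.
rewrite !hiterS (hank_sym a (hardy_hiter a m) (hardy_hiter a n)) ip_conj nrm_conj //.
Qed.

(** [hank_sym] moves one factor across the product at a time; this conjugates, so only the modulus
    is kept. *)
Lemma ip_hiter_add a m n : nrm (ip (hiter a (m + n)) 1) = nrm (ip (hiter a m) (hiter a n)).
Proof.
elim: n m => [|n IH] m; first by rewrite addn0.
by rewrite addnS -addSn IH ip_hiter_swap.
Qed.

Section VisibilityProof.
Variables (a : V) (rho : R).
Let L := kyfan 1 a.
Hypothesis rho0 : 0 <= rho.
Hypothesis rhoL : rho < L.
(** The negation of [visible], from which a contradiction is drawn: seen from 1, the spectrum does
    not exceed [rho < L]. *)
Hypothesis small : forall n, nn (hiter a n.+1) <= rho * nn (hiter a n).

Let L0 : 0 < L. Proof. exact: le_lt_trans rhoL. Qed.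
Let La f : hardy f -> nn (hank a f) <= L * nn f. Proof. exact: nn_hank_kyfan. Qed.

Lemma nn_hiter_small n : nn (hiter a n) <= rho ^+ n.
Proof.
elim: n => [|n IH]; first by rewrite nn1 expr0.
by apply: le_trans (small n) _; rewrite exprS ler_wpM2l.
Qed.

Lemma maximizing_powers h m : maximizing L a h ->
  null (fun n => nn (wcst (L ^+ m)%:C%C * h n - iter m (fun f => hank a (hank a f)) (h n))).
Proof.
elim: m h => [|m IH] h mx.
  by move=> e e0; exists 0%N => n _; rewrite /= expr0 wcst1 mul1r subrr nn0 normr0 ltW.
have mx2 := maximizing_hank (ltW L0) La (maximizing_hank (ltW L0) La mx).
have n1 := IH _ mx2; have n2 := maximizing_defect La mx.
apply: (@null_le _ _ (fun n => 2 * (L ^+ m) ^+ 2 * nn (wcst L%:C%C * h n - hank a (hank a (h n)))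
   + 2 * nn (wcst (L ^+ m)%:C%C * hank a (hank a (h n)) - iter m (fun f => hank a (hank a f)) (hank a (hank a (h n))))) 1); last first.
  apply: nullD; [apply: null_le n2|apply: null_le n1] => n; by rewrite normrM ler_wpM2r// ler_norm.
move=> n; rewrite mul1r iterSr.
rewrite (ger0_norm (nn_ge0 _)); apply: le_trans (ler_norm _).
rewrite exprSr rcM wcstM -mulrA.
set x := wcst (L ^+ m)%:C%C; set y := wcst _ * h n; set w := hank a (hank a (h n)).
have -> : x * y - iter m (fun f => hank a (hank a f)) w = x * (y - w) + (x * w - iter m (fun f => hank a (hank a f)) w) by ring.
set p := x * w - _.
have -> : 2 * (L ^+ m) ^+ 2 * nn (y - w) = 2 * nn (x * (y - w)).
  by rewrite /x nnZ nrm_real real_normK ?num_real// -!mulrA.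
exact: nnD_le.
Qed.

Lemma ip_iter2 m f : hardy f -> ip (iter m (fun f => hank a (hank a f)) f) 1 = ip f (hiter a (m + m)).
Proof.
elim: m f => [|m IH] f hf //=.
rewrite ip_hank2_adj; [|by elim: (m) => [|k IHk] //=; exact: hardy_hank|exact: hardy1].
have gen g : hardy g -> ip (iter m (fun f => hank a (hank a f)) f) g = ip f (iter m (fun f => hank a (hank a f)) g).
  clear IH; elim: m f g hf => [|k IHk] f g hf //= hg.
  have hk u : hardy u -> hardy (iter k (fun f => hank a (hank a f)) u).
    by move=> hu; case: (k) => [|k'] //=; exact: hardy_hank.
  rewrite ip_hank2_adj//; last exact: hk.
  rewrite IHk//; last exact: hardy_hank.
  by rewrite -(iterSr k (fun f => hank a (hank a f)) g).
rewrite gen; last exact: hardy_hank.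
have hk k : iter k (fun f => hank a (hank a f)) (hank a (hank a 1)) = hiter a (k + k).+2.
  by elim: k => [|k IHk] //=; rewrite IHk addnS.
by rewrite hk addnS.
Qed.

(** A maximizing sequence is nearly fixed by [L^-m H_a^(2m)], so [(h n | 1)] is close to
    [L^-m (h n | H_a^(2m) 1)], of order [(rho / L)^m]: [m] is taken large first, then [n]. *)
Lemma maximizing_orth1 h : maximizing L a h -> null (fun n => nrm (coef (h n) 0)).
Proof.
move=> mx e e0; have [[hh [B hB]] _] := mx.
have B0 : 0 <= B by exact: le_trans (nn_ge0 _) (hB 0%N).
pose q := (rho / L) ^+ 2.
have rl1 : 0 <= rho / L < 1 by rewrite divr_ge0 ?(ltW L0)//= ltr_pdivrMr// mul1r.
have /andP[rl0 rl2] := rl1.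
have q1 : 0 <= q < 1.
  by rewrite sqr_ge0 /= /q expr2 (le_lt_trans _ rl2)// ler_piMr// ltW.
have eB : 0 < (e / 2) ^+ 2 / (B + 1) by rewrite divr_gt0 ?exprn_gt0 ?divr_gt0//; lra.
have [m hm] : exists m, q ^+ m <= (e / 2) ^+ 2 / (B + 1).
  have : (fun m => q ^+ m) @ \oo --> (0 : R).
    by apply: cvg_expr; rewrite ger0_norm; case/andP: q1.
  move=> /cvgrPdist_lt/(_ _ eB)[N _ hN]; exists N; have := hN N (leqnn N).
  have /andP[q0 _] := q1.
  by rewrite sub0r normrN ger0_norm ?exprn_ge0//; exact: ltW.
have Lm : 0 < L ^+ m by rewrite exprn_gt0.
have eL : 0 < (e / 2 * L ^+ m) ^+ 2 by rewrite exprn_gt0// mulr_gt0// divr_gt0.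
have [N hN] := maximizing_powers m mx eL; exists N => n Nn.
rewrite ger0_norm ?nrm_ge0//.
have {hN} := hN n Nn; rewrite ger0_norm ?nn_ge0//.
set r := _ - _ => hr.
have e1 : (L ^+ m)%:C%C * coef (h n) 0 = ip (h n) (hiter a (m + m)) + ip r 1.
  by rewrite -ip_iter2// -ipDl /r addrC subrK ipZl ip1r.
have i1 : nrm (ip r 1) <= e / 2 * L ^+ m.
  rewrite -[leRHS]mulr1; apply: nrm_ip_le => //; last by rewrite nn1 expr1n.
  by rewrite mulr_ge0 ?(ltW Lm)// divr_ge0 ?(ltW e0).
have i2 : nrm (ip (h n) (hiter a (m + m))) <= e / 2 * L ^+ m.
  rewrite -(@ler_pXn2r _ 2) ?nnegrE ?nrm_ge0 ?mulr_ge0 ?divr_ge0 ?(ltW Lm) ?(ltW e0)//.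
  apply: le_trans (cauchy_schwarz _ _) _.
  apply: (@le_trans _ _ (B * rho ^+ (m + m))).
    by apply: ler_pM; rewrite ?nn_ge0 ?hB ?nn_hiter_small.
  have -> : rho ^+ (m + m) = q ^+ m * (L ^+ m) ^+ 2.
    by rewrite /q -exprM mulnC exprM -exprMn -exprMn divfK ?gt_eqF// exprD expr2.
  rewrite [in leRHS]exprMn [in leLHS]mulrA ler_wpM2r ?sqr_ge0//.
  apply: (@le_trans _ _ ((B + 1) * q ^+ m)); first by rewrite ler_wpM2r ?exprn_ge0 ?lerDl//; case/andP: q1.
  by rewrite mulrC -ler_pdivlMr//; lra.
have := congr1 (fun c => nrm c) e1; rewrite nrmM nrm_real (ger0_norm (ltW Lm)) => e2.
have := nrmD (ip (h n) (hiter a (m + m))) (ip r 1); rewrite -e2 => e3.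
rewrite -(ler_pM2l Lm); apply: le_trans e3 _; lra.
Qed.

(** With [g = H_a h], the mean of [H_a g] tends to 0, so by the rank-one relation [g] is maximizing
    for [b = conj(z) a] too. Then so is [H_b g], for [b] and hence for [a]; but
    [H_b g = S^* H_a^2 h] is close to [L S^* h]. *)
Lemma maximizing_sadj h : maximizing L a h -> maximizing L a (fun n => sadj (h n)).
Proof.
move=> mx; have [bh _] := mx; have [hh _] := bh.
pose g n := hank a (h n).
have mg : maximizing L a g := maximizing_hank (ltW L0) La mx.
have [bg dg] := mg; have [hg [B hB]] := bg.
have oH := maximizing_orth1 (maximizing_hank (ltW L0) La mg).
pose b := wzb * a.
have Lb f : hardy f -> nn (hank b f) <= L * nn f.
  move=> hf; apply: le_trans (La hf); rewrite hank_zb_sadj//; exact: nn_sadj_le.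
have mbg : maximizing L b g.
  split => //; apply: (@null_le _ _ (fun n => (L * nn (g n) - nn (hank a (g n))) + nrm (coef (hank a (g n)) 0) ^+ 2) 1).
    by move=> n; rewrite mul1r le_eqVlt; apply/orP; left; apply/eqP; congr `|_|; rewrite nn_hank_zb// ip1r; ring.
  apply: nullD => //; move=> e e0.
  have e1 : 0 < Num.min 1 e by rewrite lt_min ltr01.
  have [N hN] := oH _ e1; exists N => n Nn; have := hN n Nn.
  rewrite (ger0_norm (nrm_ge0 _)) ger0_norm ?sqr_ge0// le_min => /andP[x1 x2].
  by apply: le_trans x2; rewrite expr2 ler_piMr ?nrm_ge0.
have mbKg := maximizing_hank (ltW L0) Lb mbg.
have maKg : maximizing L a (fun n => hank b (g n)).
  have [bK dK] := mbKg; split => //; apply: (null_le (c := 1) _ dK) => n.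
  rewrite mul1r ger0_norm; last by apply: defect_ge0 => //; exact: hardy_hank.
  apply: le_trans (ler_norm _); rewrite lerD2l lerN2 /b hank_zb_sadj ?nn_sadj_le//.
  exact: hardy_hank.
have rest : maximizing L a (fun n => hank b (g n) + sadj (wcst L%:C%C * h n - hank a (hank a (h n)))).
  apply: maximizing_add => //; first exact: ltW.
    by move=> n; apply: hardy_sadj; apply: hardyB; [exact: hardyZ|exact: hardy_hank].
  apply: (null_le (c := 1) _ (maximizing_defect La mx)) => n.
  by rewrite mul1r !ger0_norm ?nn_ge0 ?nn_sadj_le.
have := maximizing_scale L^-1%:C%C rest.
congr maximizing; apply/funext => n.
rewrite /b hank_zb_sadj// /g sadjB addrC subrK sadjZ mulrA -wcstM -rcM mulVf ?gt_eqF//.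
by rewrite wcst1 mul1r.
Qed.

(** Iterating [S^*] brings each coefficient in turn to index 0, so all the coefficients of a
    normalized maximizing sequence tend to 0; compactness then sends [|H_a h|] to 0, against
    [L > 0]. *)
Lemma visible_absurd : False.
Proof.
have [h oh] : exists h : nat -> V, forall n, [/\ hardy (h n), nn (h n) = 1 & L - n.+1%:R^-1 <= nn (hank a (h n))].
  have ex n : exists f : V, [/\ hardy f, nn f = 1 & L - n.+1%:R^-1 <= nn (hank a f)]; last first.
    by have [h oh] := boolp.choice ex; exists h.
  have [f of_] := @kyfan_adherent _ 1 a (n.+1%:R^-1) (ltac:(by rewrite invr_gt0)).
  rewrite /kyfan_at big_ord1 => lt; exists (f ord0); split; last exact: ltW.
    by case: of_.
  exact: orthonormal_nn.
have hh n : hardy (h n) by have [] := oh n.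
have mx : maximizing L a h.
  split; first by split=> //; exists 1 => n; have [_ -> _] := oh n.
  move=> e e0; have [N hN] : exists N, forall n, (N <= n)%N -> n.+1%:R^-1 <= e.
    have /cvgrPdist_lt/(_ _ e0)[N _ hN] := @cvg_harmonic R; exists N => n Nn.
    have := hN n Nn; rewrite /= sub0r normrN ger0_norm ?invr_ge0//; exact: ltW.
  exists N => n Nn; have [_ n1 n2] := oh n.
  rewrite ger0_norm; last by apply: defect_ge0 => //.
  rewrite n1 mulr1; apply: le_trans (hN n Nn).
  by rewrite lerBlDr addrC -lerBlDr.
have all (m : nat) : null (fun n => nrm (coef (h n) (Posz m))).
  have mxm : maximizing L a (fun n => iter m sadj (h n)).
    by elim: (m) => [|k IH] //=; exact: maximizing_sadj.
  move=> e e0; have [N hN] := maximizing_orth1 mxm e0; exists N => n Nn; have := hN n Nn.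
  suff -> : coef (iter m sadj (h n)) 0 = coef (h n) (Posz m) by [].
  have gen k f : (0 <= k)%R -> coef (iter m sadj f) k = coef f (k + Posz m).
    elim: (m) k => [|p IH] k k0 /=; first by rewrite addr0.
    rewrite coef_sadj ifF ?IH; first by congr coef; lia.
      by lia.
    by apply/negbTE; lia.
  by rewrite gen.
have [bh d0] := mx; have n0 := hank_compact a bh all.
have L3 : 0 < L / 3 by rewrite divr_gt0.
have [N hN] := n0 _ L3; have [M hM] := d0 _ L3.
have := hN (maxn N M) (leq_maxl _ _); have := hM (maxn N M) (leq_maxr _ _).
have [_ -> _] := oh (maxn N M); rewrite mulr1 (ger0_norm (nn_ge0 _)) => x1 x2.
have := ler_norm (L - nn (hank a (h (maxn N M)))); lra.
Qed.

End VisibilityProof.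

(* The constant function [1] sees the top of the spectrum of the squared Hankel operator. *)
Lemma visible a rho : 0 <= rho < kyfan 1 a -> exists n, rho * nn (hiter a n) < nn (hiter a n.+1).
Proof.
move=> /andP[r0 rL]; apply: contrapT => h.
apply: (@visible_absurd a rho r0 rL) => n; rewrite leNgt; apply/negP => lt; apply: h.
by exists n.
Qed.

Lemma bessel2 f g w : nn f = 1 -> nn g = 1 -> ip f g = 0 ->
  nrm (ip w f) ^+ 2 + nrm (ip w g) ^+ 2 <= nn w.
Proof.
move=> f1 g1 fg; have := nn_ge0 (w - (wcst (ip w f) * f + wcst (ip w g) * g)).
rewrite nnB nnD !nnZ f1 g1 !mulr1 ipDr !ipZr ipZl fg !mulr0 addr0.
rewrite ![conjc _ * _]mulrC !mul_conj cReD /=; lra.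
Qed.

Theorem kyfan_moments_le a : hardy a -> (forall n, ip (hiter a (n + n).+1) 1 = 0) ->
  2 * kyfan 1 (wzb * a) <= kyfan 2 (wzb * a) + nn a.
Proof.
move=> ha mom; have L1 := kyfan1_zb a.
apply: (@le_trans _ _ (2 * kyfan 1 a)); first by rewrite ler_wpM2l.
apply/ler_addgt0Pr => e e0.
have [small|big] := leP (2 * kyfan 1 a) e.
  by apply: le_trans small _; rewrite lerDr addr_ge0 ?kyfan_ge0 ?nn_ge0.
pose rho := kyfan 1 a - e / 2.
have rho0 : 0 <= rho by rewrite /rho; lra.
have rhoL : rho < kyfan 1 a by rewrite /rho; lra.
have [n hn] := visible (introT andP (conj rho0 rhoL)).
pose x := hiter a n; pose y := hiter a n.+1; pose w := hiter a n.+2.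
have x0 : 0 < nn x.
  rewrite lt0r nn_ge0 andbT; apply/eqP => /nn_eq0 z; move: hn.
  by rewrite hiterS -/x z hank0r nn0 mulr0 ltxx.
have y0 : 0 < nn y by apply: le_lt_trans hn; rewrite mulr_ge0 ?nn_ge0.
(* Log-convexity: the ratio [|H^(n+1) 1|^2 / |H^n 1|^2] does not decrease with [n], so the second
   vector of the pair does at least as well as the first. *)
have logc : nn y ^+ 2 <= nn x * nn w.
  have -> : nn y ^+ 2 = nrm (ip x w) ^+ 2.
    rewrite -ip_hiter_swap ipff nrm_real ger0_norm ?nn_ge0//.
  exact: cauchy_schwarz.
(* This product has the modulus of the moment of odd order [2 n + 1]. *)
have xy : ip y x = 0.
  apply: nrm_eq0; rewrite -ip_hiter_add addSn mom nrm0//.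
pose s u := (Num.sqrt (nn u))^-1.
have s2 u : 0 < nn u -> s u ^+ 2 = (nn u)^-1 by move=> u0; rewrite /s exprVn sqr_sqrtr ?ltW.
pose E := wcst (s x)%:C%C * x; pose F := wcst (s y)%:C%C * y.
have nZ u v : nn (wcst (s u)%:C%C * v) = s u ^+ 2 * nn v by rewrite nnZ nrm_real real_normK ?num_real.
have nE : nn E = 1 by rewrite nZ s2// mulVf// gt_eqF.
have nF : nn F = 1 by rewrite nZ s2// mulVf// gt_eqF.
have oEF : ip E F = 0 by rewrite /E /F ipZl ipZr ip_conj xy conjc0 !mulr0.
have hE : hardy E by apply: hardyZ; exact: hardy_hiter.
have hF : hardy F by apply: hardyZ; exact: hardy_hiter.
pose h (i : 'I_2) := if i == ord0 then E else F.
have oh : orthonormal h.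
  split=> [i|i j]; rewrite /h; first by case: ifP.
  case: (unliftP ord0 i) => [i'|] ->; case: (unliftP ord0 j) => [j'|] ->; rewrite ?eqxx ?(ord1 i') ?(ord1 j') /=.
  - by rewrite ipff nF.
  - by rewrite ip_conj oEF conjc0.
  - by rewrite oEF.
  - by rewrite ipff nE.
have HE : rho <= nn (hank a E).
  by rewrite hankZr conjc_rc nZ s2// ler_pdivlMl// mulrC ltW.
have HF : rho <= nn (hank a F).
  rewrite hankZr conjc_rc nZ s2// ler_pdivlMl// mulrC.
  apply: (@le_trans _ _ (nn y ^+ 2 / nn x)).
    rewrite ler_pdivlMr// expr2 mulrAC; apply: ler_wpM2r (ltW y0) _ _ _.
    exact: ltW.
  by rewrite ler_pdivrMr// mulrC.
(* Passing to [conj(z) a] loses [|(a|E)|^2] and [|(a|F)|^2], in total at most [|a|^2] by Bessel. *)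
have := kyfan_ge (wzb * a) oh; rewrite /kyfan_at big_ord_recl big_ord1 /h /=.
rewrite !nn_hank_zb//.
have i1 u : hardy u -> ip (hank a u) 1 = ip a u.
  move=> hu; rewrite (hank_sym a hu hardy1) /hank wconj1 mulr1 hardyK//.
rewrite !i1//; have := bessel2 a nE nF oEF; rewrite /rho in HE HF; lra.
Qed.

End Visibility.

(** * The flow in the Wiener algebra *)

Section RealInduction.
Context {R : realType}.

(** The supremum of the times up to which [P] holds satisfies [P] by the closure hypothesis and
    cannot stop before [b]. This globalizes bounds that are known only near each time. *)
Lemma real_induction (a b : R) (P : R -> Prop) : a <= b -> P a ->
  (forall x, a <= x < b -> P x -> exists2 d, 0 < d & forall y, x < y <= x + d -> y <= b -> P y) ->
  (forall x, a < x <= b -> (forall y, a <= y < x -> P y) -> P x) ->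
  forall x, a <= x <= b -> P x.
Proof.
move=> ab Pa ext lim.
pose S := [set x | a <= x <= b /\ forall y, a <= y <= x -> P y].
have Sa : S a by split; [rewrite lexx|move=> y ya; have -> : y = a by lra].
have hS : has_sup S by split; [exists a|exists b => x [/andP[]]].
have below y : a <= y < sup S -> P y.
  move=> /andP[ay ys].
  have [x [_ Px] yx] := sup_adherent (ltac:(by rewrite subr_gt0) : 0 < sup S - y) hS.
  by apply: Px; rewrite ay /=; lra.
have as_ : a <= sup S by exact: sup_upper_bound.
have sb : sup S <= b by apply: ge_sup => [|x [/andP[]]]; first by exists a.
have Ps : P (sup S).
  have [<-//|ns] := eqVneq a (sup S).
  by apply: lim => //; rewrite lt_neqAle ns as_.
have [seb|sltb] := leP b (sup S).
  have e : sup S = b by apply/eqP; rewrite eq_le sb.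
  move=> x /andP[ax xb]; have [->|nx] := eqVneq x b; first by rewrite -e.
  by apply: below; rewrite ax /= e lt_neqAle nx.
have [d d0 Pd] := ext _ (introT andP (conj as_ sltb)) Ps.
pose m := Num.min (sup S + d) b.
have ms : sup S < m by rewrite lt_min sltb andbT ltrDl.
have : S m.
  split; first by rewrite (le_trans as_ (ltW ms)) /= ge_min lexx orbT.
  move=> y /andP[ay ym]; have [ys|sy] := ltP y (sup S); first by apply: below; rewrite ay.
  have [->//|ny] := eqVneq y (sup S).
  apply: Pd; first by rewrite lt_neqAle eq_sym ny sy /=; apply: le_trans ym _; rewrite ge_min lexx.
  by apply: le_trans ym _; rewrite ge_min lexx orbT.
by move/(sup_upper_bound hS); lra.
Qed.

(** A mean value inequality from a bound of the slopes near each point; [Num.sg (r - t)] covers both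
    sides of [t] at once. The slack [e] is proportional to the length of the interval and removed at
    the end. *)
Lemma increment_le (phi : R -> R) (a b M : R) : a <= b ->
  (forall t, a <= t <= b -> forall e, 0 < e -> exists2 d, 0 < d &
     forall r, a <= r <= b -> `|r - t| < d -> (phi r - phi t) * Num.sg (r - t) <= (M + e) * `|r - t|) ->
  phi b - phi a <= M * (b - a).
Proof.
move=> ab loc.
apply/ler_addgt0Pr => e0 e00.
pose e := e0 / (b - a + 1).
have b1 : 0 < b - a + 1 by lra.
have e_gt0 : 0 < e by rewrite divr_gt0.
have : phi b - phi a <= (M + e) * (b - a).
  apply: (@real_induction a b (fun x => phi x - phi a <= (M + e) * (x - a))); rewrite ?lexx ?ab//.
  - by rewrite !subrr mulr0.
  - move=> x /andP[ax xb] Px; have xab : a <= x <= b by rewrite ax ltW.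
    have [d d0 hd] := loc x xab e e_gt0; exists (d / 2); first by rewrite divr_gt0.
    move=> y /andP[xy yd] yb.
    have yab : a <= y <= b by rewrite yb (le_trans ax (ltW xy)).
    have p : 0 < y - x by rewrite subr_gt0.
    have := hd y yab; rewrite gtr0_norm// gtr0_sg// mulr1 => h.
    have {h} : phi y - phi x <= (M + e) * (y - x) by apply: h; lra.
    rewrite (_ : (M + e) * (y - a) = (M + e) * (y - x) + (M + e) * (x - a)); last by ring.
    lra.
  - move=> x /andP[ax xb] Pb; have xab : a <= x <= b by rewrite xb ltW.
    have [d d0 hd] := loc x xab e e_gt0.
    pose y := Num.max a (x - d / 2).
    have ya : a <= y by rewrite le_max lexx.
    have yx : y < x by rewrite gt_max ax; lra.
    have yd : x - d / 2 <= y by rewrite le_max lexx orbT.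
    have yab : a <= y <= b by rewrite ya (le_trans (ltW yx)).
    have Py := Pb y (introT andP (conj ya yx)).
    have p : y - x < 0 by rewrite subr_lt0.
    have := hd y yab; rewrite ltr0_norm// ltr0_sg// mulrN1 => h.
    have {h} : - (phi y - phi x) <= (M + e) * - (y - x) by apply: h; lra.
    rewrite (_ : (M + e) * (x - a) = (M + e) * - (y - x) + (M + e) * (y - a)); last by ring.
    lra.
move=> h; apply: le_trans h _; rewrite mulrDl lerD2l /e.
by rewrite mulrAC ler_pdivrMr// ler_wpM2l ?(ltW e00)//; lra.
Qed.

(** A quadratic increment has zero slope, so [increment_le] applies with [M = 0]. *)
Lemma quadratic_mono (phi : R -> R) (T C0 : R) : 0 <= T -> 0 <= C0 ->
  (forall t t', 0 <= t -> t <= t' -> t' <= T -> phi t' <= phi t + C0 * (t' - t) ^+ 2) ->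
  phi T <= phi 0.
Proof.
move=> T0 C00 h0.
pose C1 := C0 + 1.
have C1_gt0 : 0 < C1 by rewrite ltr_wpDl.
have h t t' : 0 <= t -> t <= t' -> t' <= T -> phi t' <= phi t + C1 * (t' - t) ^+ 2.
  move=> ta tb tc; apply: le_trans (h0 t t' ta tb tc) _.
  by rewrite lerD2l ler_wpM2r ?sqr_ge0// lerDl.
suff : phi T - phi 0 <= 0 * (T - 0) by rewrite mul0r subr_le0.
apply: increment_le => // t /andP[t0 tT] e e0.
exists (e / C1); first by rewrite divr_gt0.
move=> r /andP[r0 rT]; rewrite add0r.
have [rt|rt|->] := ltgtP r t; last by rewrite subrr sgr0 mulr0 normr0 mulr0.
  rewrite ltr0_norm ?subr_lt0// ltr0_sg ?subr_lt0// mulrN1 => rd.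
  have := h r t r0 (ltW rt) tT; rewrite expr2 => h1.
  have : C1 * (t - r) <= e by rewrite -ler_pdivlMl// mulrC; lra.
  have : 0 <= t - r by lra.
  nra.
rewrite gtr0_norm ?subr_gt0// gtr0_sg ?subr_gt0// mulr1 => rd.
have := h t r t0 (ltW rt) rT; rewrite expr2 => h1.
have : C1 * (r - t) <= e by rewrite -ler_pdivlMl// mulrC; lra.
have : 0 <= r - t by lra.
nra.
Qed.

End RealInduction.

(** * The equation as an ordinary differential equation *)

Section VectorField.
Context {R : realType}.
Local Notation C := R[i].
Local Notation V := (walg R).
Implicit Types (a b f g h u v w : V) (c : C).
Variables (nu alpha beta : R).

Definition damping : C := nu%:C%C + 'i%C * alpha%:C%C.

(** The equation solved for the time derivative; the damping and the [alpha] term merge into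
    [damping]. Only products and bounded projections occur, so the field is locally Lipschitz. *)
Definition vfield u : V :=
  - wcst (damping * coef u 0) - wcst 'i%C * wproj (cub u)
  + wcst ('i%C * beta%:C%C) * (wz * wproj (cub (sadj u))).

Lemma hardy_vfield u : hardy (vfield u).
Proof.
apply: hardyD; first apply: hardyB.
- by rewrite -wcstN; exact: hardy_cst.
- by apply: hardyZ; exact: hardy_proj.
- by apply: hardyZ; apply: hardyM; [exact: hardy_z|exact: hardy_proj].
Qed.

Lemma wn_sadj f : wn (sadj f) <= 2 * wn f.
Proof.
apply: le_trans (wnM _ _) _.
apply: (@le_trans _ _ (1 * (wn f + wn f))); last by rewrite mul1r mulr_natl.
apply: ler_pM (wn_ge0 _) (wn_ge0 _) (wn_exp _) _.
apply: le_trans (wnB _ _) _; rewrite lerD2l; apply: le_trans (wn_cst _) _.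
exact: coef_le_wn.
Qed.

Lemma wnM3 (A B D : R) a b g : wn a <= A -> wn b <= B -> wn g <= D -> wn (a * b * g) <= A * B * D.
Proof.
move=> aA bB gD; apply: le_trans (wnM _ _) _; apply: ler_pM => //; rewrite ?wn_ge0//.
by apply: le_trans (wnM _ _) _; apply: ler_pM => //; rewrite ?wn_ge0.
Qed.

Lemma cub_lip (B : R) a b : wn a <= B -> wn b <= B -> wn (cub a - cub b) <= 3 * B ^+ 2 * wn (a - b).
Proof.
move=> aB bB.
have -> : cub a - cub b = (a - b) * wconj a * a + b * wconj (a - b) * a + b * wconj b * (a - b).
  by rewrite /cub wconjB; ring.
have e : wn (wconj (a - b)) <= wn (a - b) by rewrite wn_conj.
have h1 := wnM3 (lexx (wn (a - b))) (ltac:(by rewrite wn_conj) : wn (wconj a) <= B) aB.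
have h2 := wnM3 bB e aB.
have h3 := wnM3 bB (ltac:(by rewrite wn_conj) : wn (wconj b) <= B) (lexx (wn (a - b))).
have := wnD ((a - b) * wconj a * a + b * wconj (a - b) * a) (b * wconj b * (a - b)).
have := wnD ((a - b) * wconj a * a) (b * wconj (a - b) * a).
rewrite expr2 in h1 h2 h3 *; lra.
Qed.

Lemma cub0 : cub 0 = 0 :> V. Proof. by rewrite /cub !mul0r. Qed.

(** Lipschitz constant on the ball of radius [B]: the cubic map contributes [3 B^2], and [sadj] may
    double both the radius and the distance, whence [3 (2 B)^2 * 2 = 24 B^2]. *)
Definition vlip (B : R) : R := nrm damping + 3 * B ^+ 2 + `|beta| * (24 * B ^+ 2).

Lemma vlip_ge0 B : 0 <= vlip B.
Proof.
have := sqr_ge0 B; have := nrm_ge0 damping; have := normr_ge0 beta.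
by rewrite /vlip; set x := B ^+ 2; set y := nrm _; nra.
Qed.

Lemma vfield_lip (B : R) u v : wn u <= B -> wn v <= B -> wn (vfield u - vfield v) <= vlip B * wn (u - v).
Proof.
move=> uB vB; have B0 : 0 <= B by exact: le_trans (wn_ge0 _) uB.
have d0 := wn_ge0 (u - v).
have -> : vfield u - vfield v = - wcst (damping * coef (u - v) 0)
    - wcst 'i%C * wproj (cub u - cub v)
    + wcst ('i%C * beta%:C%C) * (wz * wproj (cub (sadj u) - cub (sadj v))).
  by rewrite /vfield !wprojB coefB mulrBr wcstB; ring.
have h1 : wn (- wcst (damping * coef (u - v) 0)) <= nrm damping * wn (u - v).
  rewrite wnN; apply: le_trans (wn_cst _) _; rewrite nrmM ler_wpM2l ?nrm_ge0//; exact: coef_le_wn.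
have h2 : wn (wcst 'i%C * wproj (cub u - cub v)) <= 3 * B ^+ 2 * wn (u - v).
  rewrite wnZ nrm_i mul1r; apply: le_trans (wn_proj _) _; exact: cub_lip.
have h3 : wn (wcst ('i%C * beta%:C%C) * (wz * wproj (cub (sadj u) - cub (sadj v)))) <= `|beta| * (24 * B ^+ 2) * wn (u - v).
  rewrite wnZ nrmM nrm_i mul1r nrm_real -mulrA ler_wpM2l//.
  apply: le_trans (wnM _ _) _.
  apply: (@le_trans _ _ (1 * (24 * B ^+ 2 * wn (u - v)))); last by rewrite mul1r.
  apply: ler_pM (wn_ge0 _) (wn_ge0 _) (wn_exp _) _.
  apply: le_trans (wn_proj _) _.
  have s1 : wn (sadj u) <= 2 * B by apply: le_trans (wn_sadj u) _; rewrite ler_wpM2l.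
  have s2 : wn (sadj v) <= 2 * B by apply: le_trans (wn_sadj v) _; rewrite ler_wpM2l.
  apply: le_trans (cub_lip s1 s2) _; rewrite -sadjB.
  have := wn_sadj (u - v) => s3.
  have : 3 * (2 * B) ^+ 2 * wn (sadj (u - v)) <= 3 * (2 * B) ^+ 2 * (2 * wn (u - v)).
    by rewrite ler_wpM2l// mulr_ge0 ?sqr_ge0.
  by rewrite exprMn; lra.
have := wnD (- wcst (damping * coef (u - v) 0) - wcst 'i%C * wproj (cub u - cub v))
  (wcst ('i%C * beta%:C%C) * (wz * wproj (cub (sadj u) - cub (sadj v)))).
have := wnB (- wcst (damping * coef (u - v) 0)) (wcst 'i%C * wproj (cub u - cub v)).
have -> : vlip B * wn (u - v) = nrm damping * wn (u - v) + 3 * B ^+ 2 * wn (u - v)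
    + `|beta| * (24 * B ^+ 2) * wn (u - v) by rewrite /vlip; ring.
lra.
Qed.

Lemma vfield0 : vfield 0 = 0.
Proof.
have s0 : sadj 0 = 0 :> V by rewrite /sadj coef0 wcst0 subrr mulr0.
by rewrite /vfield s0 cub0 wproj0 coef0 !mulr0 wcst0 oppr0 !addr0.
Qed.

Lemma vfield_bnd (B : R) u : wn u <= B -> wn (vfield u) <= vlip B * B.
Proof.
move=> uB; have B0 : 0 <= B by exact: le_trans (wn_ge0 _) uB.
have := @vfield_lip B u 0 uB; rewrite wn0 vfield0 !subr0 => h.
by apply: le_trans (h B0) _; rewrite ler_wpM2l ?vlip_ge0.
Qed.

Lemma coef_vfield u k : coef (vfield u) k =
  (if k == 0 then - (damping * coef u 0) else 0) - 'i%C * (if 0 <= k then coef (cub u) k else 0)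
  + 'i%C * beta%:C%C * (if 0 <= k - 1 then coef (cub (sadj u)) (k - 1) else 0).
Proof.
rewrite /vfield coefD coefB coefN !coefZ coef_z !coef_proj coef_cst.
by case: eqP => // _; rewrite oppr0.
Qed.

Lemma cRe_Ni (x : C) : complex.Re (- 'i%C * x) = complex.Im x.
Proof. by case: x => a b /=; ring. Qed.
Lemma cRe_ir (r : R) (x : C) : complex.Re ('i%C * r%:C%C * x) = - r * complex.Im x.
Proof. by case: x => a b /=; ring. Qed.

(** The Toeplitz symbol is [|a|^2 - beta |S^* u|^2] with [a = conj(z) u]. The mean term of the field
    becomes a multiple of [conj(z)], invisible to the operator, and [conj(z) u] and [S^* u] define
    the same operator, so [Im_hank_cub] handles both cubic terms. *)
Lemma lax_pair_vfield u : hardy u -> lax_pair (wzb * u) (wzb * vfield u).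
Proof.
move=> hu; pose w := sadj u; pose a := wzb * u.
have hw : hardy w by exact: hardy_sadj.
exists (a * wconj a - wcst beta%:C%C * (w * wconj w)).
  have self b : wconj (b * wconj b) = b * wconj b by rewrite wconjM wconjK mulrC.
  by rewrite wconjB self wconjM wconj_cst conjc_rc self.
move=> h hh.
have za : hardy (wz * a) by rewrite mulrA wzzb mul1r.
have zw : hardy (wz * w) by apply: hardyM => //; exact: hardy_z.
have aw f : hardy f -> hank w f = hank a f.
  move=> hf; apply: hank_anti => // k k0.
  by rewrite coef_sadj coef_zb; case: eqP => // k1; lia.
have cza : cub a = wzb * cub u.
  rewrite /cub /a wconjM wconj_zb.
  rewrite (_ : _ * _ * _ = (wzb * wz) * (wzb * (u * wconj u * u))); last by ring.
  by rewrite wzbz mul1r.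
(* On nonnegative frequencies, [conj(z)] times the field is [- i |a|^2 a + i beta |w|^2 w]. *)
have -> : hank (wzb * vfield u) h = wcst (- 'i%C) * hank (cub a) h + wcst ('i%C * beta%:C%C) * hank (cub w) h.
  rewrite -!hankZl -hankDl; apply: hank_anti => // k k0.
  rewrite coef_zb coef_vfield coefD !coefZ cza coef_zb addrK k0 ifF; last by lia.
  by rewrite ifT ?add0r ?mulNr//; lia.
rewrite ipDl !ipZl cReD cRe_Ni cRe_ir Im_hank_cub//.
have -> : complex.Im (ip (hank (cub w) h) (hank a h)) =
   complex.Im (ip (hank a (hank a h)) (toep (w * wconj w) h)).
  by rewrite -(aw h hh) Im_hank_cub// (aw h hh) aw//; exact: hardy_hank.
have -> : toep (a * wconj a - wcst beta%:C%C * (w * wconj w)) h =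
   toep (a * wconj a) h - wcst beta%:C%C * toep (w * wconj w) h.
  by rewrite /toep mulrBl wprojB -[wcst _ * _ * h]mulrA wprojZ.
rewrite ipBr ipZr conjc_rc cImD cImN.
have ir (x : C) : complex.Im (beta%:C%C * x) = beta * complex.Im x by case: x => p q /=; ring.
by rewrite ir mulNr.
Qed.

(** Each cubic term pairs with [u] to an imaginary number, proportional to the fourth power of the
    L^4 norm of [u] or of [S^* u]; the [alpha] term is imaginary as well, and only [nu] is left. *)
Lemma Re_vfield u : hardy u -> complex.Re (ip (vfield u) u) = - nu * nrm (coef u 0) ^+ 2.
Proof.
move=> hu; pose w := sadj u.
have hw : hardy w by exact: hardy_sadj.
rewrite /vfield ipDl ipBl ipNl !ipZl.
have c1 : ip (wcst (damping * coef u 0)) u = damping * (nrm (coef u 0) ^+ 2)%:C%C.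
  by rewrite -[wcst _]mulr1 ipZl ip_conj ip1r -mulrA mul_conj.
have real_cub b : ip (cub b) b = (nn (b * wconj b))%:C%C.
  by rewrite -ipff !ipE /cub wconjM wconjK; congr (coef _ 0); ring.
have c2 : ip (wproj (cub u)) u = (nn (u * wconj u))%:C%C by rewrite ip_projl.
have c3 : ip (wz * wproj (cub w)) u = (nn (w * wconj w))%:C%C.
  rewrite ipMl wconj_z.
  have -> : wzb * u = w + wcst (coef u 0) * wzb by rewrite /w /sadj; ring.
  rewrite ipDr ipZr ip_exp coef_proj /= mulr0 addr0 ip_projl//.
rewrite c1 c2 c3 /damping /=; ring.
Qed.

End VectorField.

(** * Perturbation of Ky Fan sums, iterates and moments *)

Section Perturbation.
Context {R : realType}.
Local Notation C := R[i].
Local Notation V := (walg R).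
Implicit Types (a b f g h u v w F E : V) (c : C) (B : R).

Lemma le_vanishing (x y c : R) : 0 <= c -> (forall e, 0 < e -> e <= 1 -> x <= y + c * e) -> x <= y.
Proof.
move=> c0 h; apply/ler_addgt0Pr => e e0.
pose d := Num.min 1 (e / (c + 1)).
have c1 : 0 < c + 1 by rewrite ltr_wpDl.
have d0 : 0 < d by rewrite lt_min ltr01 divr_gt0.
have d1 : d <= 1 by rewrite ge_min lexx.
have : d <= e / (c + 1) by rewrite ge_min lexx orbT.
rewrite ler_pdivlMr// => de; have := h d d0 d1; nra.
Qed.

Lemma wn_zb f : wn (wzb * f) <= wn f.
Proof.
apply: le_trans (wnM _ _) _; rewrite -[leRHS]mul1r.
by apply: ler_wpM2r; [exact: wn_ge0|exact: wn_exp].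
Qed.

Lemma Re_ip_wn f g : complex.Re (ip f g) <= wn f * wn g.
Proof.
apply: le_trans (ler_norm _) _; apply: le_trans (absRe_le _) _.
by apply: nrm_ip_le; rewrite ?wn_ge0 ?nn_le_wn.
Qed.

Lemma nn_add_le f g : nn (f + g) <= nn f + 2 * (wn f * wn g) + wn g ^+ 2.
Proof. by rewrite nnD; have := Re_ip_wn f g; have := nn_le_wn g; lra. Qed.

Lemma kyfan_lip n a b : kyfan n a <= kyfan n b + n%:R * (2 * (wn b * wn (a - b)) + wn (a - b) ^+ 2).
Proof.
apply: kyfan_le => h oh.
apply: (@le_trans _ _ (kyfan_at b h + n%:R * (2 * (wn b * wn (a - b)) + wn (a - b) ^+ 2))); last first.
  by rewrite lerD2r; exact: kyfan_ge.
rewrite /kyfan_at.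
have -> : n%:R * (2 * (wn b * wn (a - b)) + wn (a - b) ^+ 2) =
    \sum_(i < n) (2 * (wn b * wn (a - b)) + wn (a - b) ^+ 2).
  by rewrite sumr_const card_ord mulr_natl.
rewrite -big_split; apply: ler_sum => i _ /=.
have n1 := orthonormal_nn i oh.
have -> : hank a (h i) = hank b (h i) + hank (a - b) (h i) by rewrite -hankDl; congr (hank _ _); ring.
rewrite nnD addrA; apply: lerD; last by have := nn_hank (a - b) (h i); rewrite n1 mulr1.
rewrite lerD2l ler_wpM2l//; apply: le_trans (ler_norm _) _; apply: le_trans (absRe_le _) _.
by apply: nrm_ip_le; rewrite ?wn_ge0//; apply: le_trans (nn_hank _ _) _; rewrite n1 mulr1.
Qed.

Lemma wn_hiter B u n : wn u <= B -> wn (hiter u n) <= B ^+ n.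
Proof.
move=> uB; elim: n => [|n IH]; first by rewrite expr0; exact: wn1.
by rewrite hiterS exprS; apply: le_trans (wn_hank _ _) _; apply: ler_pM; rewrite ?wn_ge0.
Qed.

Lemma hiter_lip n B : 0 <= B -> exists2 K, 0 <= K &
  forall u u', wn u <= B -> wn u' <= B -> wn (hiter u' n - hiter u n) <= K * wn (u' - u).
Proof.
move=> B0; elim: n => [|n [K K0 IH]]; first by exists 0 => // *; rewrite subrr wn0 mul0r.
exists (B ^+ n + B * K) => [|u u' uB uB']; first by rewrite addr_ge0 ?exprn_ge0 ?mulr_ge0.
have -> : hiter u' n.+1 - hiter u n.+1 =
    hank (u' - u) (hiter u' n) + hank u (hiter u' n - hiter u n).
  by rewrite !hiterS hankBl hankBr; ring.
apply: le_trans (wnD _ _) _; rewrite mulrDl; apply: lerD.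
  apply: le_trans (wn_hank _ _) _; rewrite mulrC; apply: ler_wpM2r; rewrite ?wn_ge0//.
  exact: wn_hiter.
apply: le_trans (wn_hank _ _) _; rewrite -mulrA; apply: ler_pM; rewrite ?wn_ge0//; exact: IH.
Qed.

(* Derivative of [hiter u n] in the direction [F]. *)
Fixpoint dhiter u F n : V :=
  if n is m.+1 then hank F (hiter u m) + hank u (dhiter u F m) else 0.

Lemma dhiterD u F E n : dhiter u (F + E) n = dhiter u F n + dhiter u E n.
Proof. by elim: n => [|n IH] /=; rewrite ?addr0// IH hankDl hankDr; ring. Qed.

Lemma dhiter_bnd n B : 0 <= B -> exists2 K, 0 <= K &
  forall u F, wn u <= B -> wn (dhiter u F n) <= K * wn F.
Proof.
move=> B0; elim: n => [|n [K K0 IH]]; first by exists 0 => // *; rewrite /= wn0 mul0r.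
exists (B ^+ n + B * K) => [|u F uB]; first by rewrite addr_ge0 ?exprn_ge0 ?mulr_ge0.
apply: le_trans (wnD _ _) _; rewrite mulrDl; apply: lerD.
  apply: le_trans (wn_hank _ _) _; rewrite mulrC; apply: ler_wpM2r; rewrite ?wn_ge0//.
  exact: wn_hiter.
apply: le_trans (wn_hank _ _) _; rewrite -mulrA; apply: ler_pM; rewrite ?wn_ge0//; exact: IH.
Qed.

(** Leibniz rule: the product of two increments is quadratic in [d]. The constant depends on the
    bounds only, which makes the later estimates uniform in time. *)
Lemma hiter_taylor n B (L M : R) : 0 <= B -> 0 <= L -> 0 <= M -> exists2 K, 0 <= K &
  forall u u' F (d : R), 0 <= d -> wn u <= B -> wn u' <= B ->
    wn (u' - u) <= L * d -> wn (u' - u - wcst d%:C%C * F) <= M * d ^+ 2 ->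
    wn (hiter u' n - hiter u n - wcst d%:C%C * dhiter u F n) <= K * d ^+ 2.
Proof.
move=> B0 L0 M0; elim: n => [|n [K K0 IH]].
  by exists 0 => // *; rewrite /= subrr mulr0 subrr wn0 mul0r.
have [K1 K10 lip] := hiter_lip n B0.
exists (M * B ^+ n + L * (K1 * L) + B * K) => [|u u' F d d0 uB uB' hL hM].
  by rewrite !addr_ge0// mulr_ge0 ?exprn_ge0 ?mulr_ge0.
have -> : hiter u' n.+1 - hiter u n.+1 - wcst d%:C%C * dhiter u F n.+1 =
    hank (u' - u - wcst d%:C%C * F) (hiter u n) + hank (u' - u) (hiter u' n - hiter u n)
    + hank u (hiter u' n - hiter u n - wcst d%:C%C * dhiter u F n).
  by rewrite !hiterS /= !hankBr !hankBl hankZl hankZr conjc_rc; ring.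
have h1 : wn (hank (u' - u - wcst d%:C%C * F) (hiter u n)) <= M * d ^+ 2 * B ^+ n.
  by apply: le_trans (wn_hank _ _) _; apply: ler_pM; rewrite ?wn_ge0 ?wn_hiter.
have h2 : wn (hank (u' - u) (hiter u' n - hiter u n)) <= L * d * (K1 * (L * d)).
  apply: le_trans (wn_hank _ _) _; apply: ler_pM; rewrite ?wn_ge0//.
  by apply: le_trans (lip _ _ uB uB') _; rewrite ler_wpM2l.
have h3 : wn (hank u (hiter u' n - hiter u n - wcst d%:C%C * dhiter u F n)) <= B * (K * d ^+ 2).
  by apply: le_trans (wn_hank _ _) _; apply: ler_pM; rewrite ?wn_ge0//; exact: IH.
apply: le_trans (wnD _ _) _; apply: (le_trans (lerD (wnD _ _) (lexx _))).
apply: le_trans (lerD (lerD h1 h2) h3) _.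
by rewrite le_eqVlt; apply/orP; left; apply/eqP; ring.
Qed.

(** The odd moments [(H_u^(2m+1) 1 | 1)]: for Hardy [u], indices 0 and 1 give [(u|1)] and
    [(|u|^2 u|1)]. The even ones are, in modulus, squared norms of iterates. *)
Definition moment u (m : nat) : C := coef (hiter u (m + m).+1) 0.

(** [(T x | 1)] is [(x | Pi(|u|^2))], and [Pi(|u|^2) = H_u^2 1]. *)
Lemma toep_hiter u n : hardy u -> coef (toep (u * wconj u) (hiter u n)) 0 = coef (hiter u n.+2) 0.
Proof.
move=> hu; rewrite -!ip1r !hiterS ip_hank2_adj; [|exact: hardy_hiter|exact: hardy1].
rewrite /toep ip_projl; last exact: hardy1.
rewrite /hank !wconj1 mulr1 (hardyK hu) ip_projr; last exact: hardy_hiter.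
by rewrite ipMl mulr1 wconjM wconjK mulrC.
Qed.

Lemma coef_cub0 u : hardy u -> coef (cub u) 0 = moment u 1.
Proof.
move=> hu; rewrite /moment -toep_hiter// /toep coef_proj /=; congr (coef _ 0).
by rewrite /cub /hiter /= /hank wconj1 mulr1 (hardyK hu).
Qed.

(* In the direction [c * Pi(|u|^2 u)] with [c] imaginary, the derivative of the iterates is
   a commutator with the Toeplitz operator of symbol [|u|^2], up to a shift of the index. *)
Lemma dhiter_cub u c n : hardy u -> conjc c = - c ->
  dhiter u (wcst c * wproj (cub u)) n =
  wcst c * (toep (u * wconj u) (hiter u n) - (if odd n then 0 else hiter u n.+2)).
Proof.
move=> hu cc.
have zu : hardy (wz * u) by apply: hardyM => //; exact: hardy_z.
elim: n => [|n IH] /=.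
  by rewrite /hiter /= /hank /toep wconj1 !mulr1 (hardyK hu) subrr mulr0.
have hc : hank (wproj (cub u)) (hiter u n) = hank (cub u) (hiter u n).
  by apply: hank_anti; [move=> k k0; rewrite coef_proj k0|exact: hardy_hiter].
rewrite IH hankZl hc hank_cub//; last exact: hardy_hiter.
(* Antilinearity turns [c] into [- c], so that the term [H_u T] cancels and the term [H_u^3]
   survives every other step. *)
rewrite hankZr cc wcstN hankBr.
by case: (odd n) => /=; rewrite ?hank0r; ring.
Qed.

(** At odd order the correction of [dhiter_cub] disappears and the Toeplitz term is the next moment;
    this drives the induction of [small_moment]. *)
Lemma coef_dhiter_cub u c m : hardy u -> conjc c = - c ->
  coef (dhiter u (wcst c * wproj (cub u)) (m + m).+1) 0 = c * moment u m.+1.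
Proof.
move=> hu cc; have e : odd (m + m).+1 by rewrite /= oddD addbb.
rewrite dhiter_cub// e subr0 coefZ toep_hiter//.
by rewrite /moment addSn addnS.
Qed.

End Perturbation.

(** * Conserved quantities, dissipation and asymptotics of a trajectory *)

Section Dynamics.
Context {R : realType}.
Local Notation C := R[i].
Local Notation V := (walg R).
Implicit Types (f g h v X : V) (c : C) (B : R).
Variables (nu alpha beta : R) (u : R -> V).
Local Notation F := (vfield nu alpha beta).
Local Notation lip := (vlip nu alpha beta).
Local Notation c0 := (damping nu alpha).

Hypothesis hardy_u : forall t : R, 0 <= t -> hardy (u t).
Hypothesis cont_u : forall t e : R, 0 <= t -> 0 < e ->
  exists2 d : R, 0 < d & forall r : R, 0 <= r -> `|r - t| < d -> wn (u r - u t) <= e.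
Hypothesis diff_u : forall (t : R) k (e : R), 0 <= t -> 0 < e ->
  exists2 d : R, 0 < d & forall r : R, 0 <= r -> `|r - t| < d ->
    nrm (coef (u r) k - coef (u t) k - (r - t)%:C%C * coef (F (u t)) k) <= e * `|r - t|.

Lemma diff_u_seq (s : seq int) (t e : R) : 0 <= t -> 0 < e ->
  exists2 d : R, 0 < d & forall (r : R) k, k \in s -> 0 <= r -> `|r - t| < d ->
    nrm (coef (u r) k - coef (u t) k - (r - t)%:C%C * coef (F (u t)) k) <= e * `|r - t|.
Proof.
move=> t0 e0; elim: s => [|k s [d d0 IH]]; first by exists 1.
have [d' d'0 h] := diff_u k t0 e0; exists (Num.min d d'); first by rewrite lt_min d0.
move=> r j; rewrite inE lt_min => /orP[/eqP->|js] r0 /andP[rd rd']; first exact: h.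
exact: IH.
Qed.

(** Differentiability is known only coefficient by coefficient. A finite sum of moduli of
    coefficients of the increment is the variation of a real function [phi], to which [increment_le]
    applies with a bound independent of the number of terms. *)
Lemma mean_value X (a b M : R) : 0 <= a -> a <= b ->
  (forall t, a <= t <= b -> wn (F (u t) - X) <= M) ->
  wn (u b - u a - wcst (b - a)%:C%C * X) <= M * (b - a).
Proof.
move=> a0 ab hM; apply: wn_le => m.
set D := u b - u a - _.
(* Rotations frozen at the total increment [D] make the sum of moduli real-linear in the
   coefficients. *)
have rot j : {w : C | nrm w = 1 /\ w * coef D j = (nrm (coef D j))%:C%C}.
  by apply: cid; have [w w1 we] := rotate (coef D j); exists w.
pose th j := sval (rot j).
have th1 j : nrm (th j) = 1 by rewrite /th; case: (rot j) => w [].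
have thD j : th j * coef D j = (nrm (coef D j))%:C%C by rewrite /th; case: (rot j) => w [].
pose phi t := \sum_(j <- ints m) complex.Re (th j * (coef (u t) j - t%:C%C * coef X j)).
have -> : \sum_(j <- ints m) nrm (coef D j) = phi b - phi a.
  rewrite /phi -sumrB; apply: eq_bigr => j _.
  have -> : nrm (coef D j) = complex.Re (th j * coef D j) by rewrite thD.
  rewrite -cReN -cReD; congr complex.Re; rewrite /D !coefB coefZ rcB; ring.
apply: increment_le => // t tab e e0; have t0 : 0 <= t by case/andP: tab => /(le_trans a0).
pose n : R := (size (ints m))%:R + 1.
have n0 : 0 < n by rewrite ltr_wpDl.
have [d d0 hd] := diff_u_seq (ints m) t0 (divr_gt0 e0 n0).
exists d => // r rab rd; have r0 : 0 <= r by case/andP: rab => /(le_trans a0).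
have sg1 : `|Num.sg (r - t)| <= 1 by rewrite normr_sg; case: (_ == _).
apply: (@le_trans _ _ `|phi r - phi t|).
  by apply: le_trans (ler_norm _) _; rewrite normrM ler_piMr.
rewrite /phi -sumrB; apply: le_trans (ler_norm_sum _ _ _) _.
apply: (@le_trans _ _ (\sum_(j <- ints m) (e / n * `|r - t| + `|r - t| * nrm (coef (F (u t) - X) j)))).
  rewrite big_seq_cond [leRHS]big_seq_cond; apply: ler_sum => j; rewrite andbT => jm.
  rewrite -cReN -cReD.
  have -> : th j * (coef (u r) j - r%:C%C * coef X j) + - (th j * (coef (u t) j - t%:C%C * coef X j)) =
     th j * ((coef (u r) j - coef (u t) j - (r - t)%:C%C * coef (F (u t)) j)
       + (r - t)%:C%C * coef (F (u t) - X) j) by rewrite coefB rcB; ring.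
  apply: le_trans (absRe_le _) _; rewrite nrmM th1 mul1r.
  apply: le_trans (nrmD _ _) _; rewrite nrmM nrm_real lerD2r; exact: hd.
rewrite big_split /= big_const_seq count_predT iter_addr_0 -mulr_sumr mulrDl addrC.
apply: lerD.
  rewrite [leLHS]mulrC; apply: ler_wpM2r => //; apply: le_trans (hM t tab).
  exact: sum_le_wn (ints_uniq m).
rewrite -mulr_natr mulrAC; apply: ler_wpM2r => //.
by rewrite -mulrA ler_piMr ?(ltW e0)// mulrC ler_pdivrMr// mul1r /n lerDl.
Qed.

(** Second-order part of [|u t|^2] over a step: twice the Taylor remainder against [u], plus the
    square of the increment. *)
Definition nn_cost (B : R) : R := 2 * (B * (lip B * (lip B * B))) + (lip B * B) ^+ 2.

Lemma nn_cost_ge0 B : 0 <= B -> 0 <= nn_cost B.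
Proof.
move=> B0; have l0 := vlip_ge0 nu alpha beta B.
by apply: addr_ge0; [rewrite !mulr_ge0|exact: sqr_ge0].
Qed.

Section Bounded.
Variables (a b B : R).
Hypothesis a0 : 0 <= a.
Hypothesis bnd : forall t, a <= t <= b -> wn (u t) <= B.

Let speed := lip B * B.

Lemma bnd_ge0 : a <= b -> 0 <= B.
Proof. by move=> ab; apply: le_trans (wn_ge0 (u a)) (bnd _); rewrite lexx. Qed.

Lemma taylor0 s t : a <= s -> s <= t -> t <= b -> wn (u t - u s) <= speed * (t - s).
Proof.
move=> as_ st tb; have := @mean_value 0 s t speed (le_trans a0 as_) st.
rewrite mulr0 subr0; apply => r /andP[sr rt]; rewrite subr0; apply: vfield_bnd; apply: bnd.
by rewrite (le_trans as_ sr) (le_trans rt tb).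
Qed.

(** The velocity may be sampled at any [r] of the interval; the conservation of the Ky Fan sums uses
    both ends. *)
Lemma taylor1 s t r : a <= s -> s <= t -> t <= b -> s <= r <= t ->
  wn (u t - u s - wcst (t - s)%:C%C * F (u r)) <= lip B * speed * (t - s) ^+ 2.
Proof.
move=> as_ st tb /andP[sr rt].
have B0 : 0 <= B by apply: bnd_ge0; rewrite (le_trans as_) ?(le_trans st).
have l0 := vlip_ge0 nu alpha beta B.
rewrite expr2 mulrA; apply: mean_value => // [|q /andP[sq qt]]; first exact: le_trans as_.
have inab x : s <= x -> x <= t -> a <= x <= b.
  by move=> sx xt; rewrite (le_trans as_ sx) (le_trans xt tb).
apply: le_trans (vfield_lip nu alpha beta (bnd (inab q sq qt)) (bnd (inab r sr rt))) _.
rewrite -mulrA ler_wpM2l//.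
have [qr|rq] := leP q r.
  rewrite wn_distC; apply: le_trans (taylor0 _ qr _) _; rewrite ?(le_trans as_ sq) ?(le_trans rt tb)//.
  by rewrite ler_wpM2l ?mulr_ge0//; lra.
apply: le_trans (taylor0 _ (ltW rq) _) _; rewrite ?(le_trans as_ sr) ?(le_trans qt tb)//.
by rewrite ler_wpM2l ?mulr_ge0//; lra.
Qed.

(** In the first-order variation of the squared norm, [Re_vfield] leaves only the dissipation. *)
Lemma nn_step s t : a <= s -> s <= t -> t <= b ->
  nn (u t) + 2 * nu * nrm (coef (u s) 0) ^+ 2 * (t - s) <= nn (u s) + nn_cost B * (t - s) ^+ 2.
Proof.
move=> as_ st tb.
have B0 : 0 <= B by apply: bnd_ge0; rewrite (le_trans as_) ?(le_trans st).
have l0 := vlip_ge0 nu alpha beta B.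
have speed0 : 0 <= speed by rewrite mulr_ge0.
have sa : a <= s <= b by rewrite as_ (le_trans st).
set D := u t - u s; set E := D - wcst (t - s)%:C%C * F (u s).
have hE : wn E <= lip B * speed * (t - s) ^+ 2 by apply: taylor1 => //; rewrite lexx.
have hD : wn D <= speed * (t - s) by exact: taylor0.
have -> : u t = u s + D by rewrite /D; ring.
rewrite nnD Re_ip_conj.
have -> : complex.Re (ip D (u s)) = complex.Re (ip E (u s)) - (t - s) * (nu * nrm (coef (u s) 0) ^+ 2).
  have -> : D = E + wcst (t - s)%:C%C * F (u s) by rewrite /E; ring.
  rewrite ipDl ipZl cReD cRe_rcM Re_vfield; last by apply: hardy_u; exact: le_trans as_.
  ring.
have h1 : complex.Re (ip E (u s)) <= lip B * speed * (t - s) ^+ 2 * B.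
  by apply: le_trans (Re_ip_wn _ _) _; apply: ler_pM; rewrite ?wn_ge0 ?bnd.
have h2 : nn D <= speed ^+ 2 * (t - s) ^+ 2.
  by apply: le_trans (nn_le_wn _) _; rewrite -exprMn; apply: sqr_mono; rewrite ?wn_ge0.
have -> : nn_cost B * (t - s) ^+ 2 =
  2 * (lip B * speed * (t - s) ^+ 2 * B) + speed ^+ 2 * (t - s) ^+ 2 by rewrite /nn_cost /speed; ring.
have -> : 2 * nu * nrm (coef (u s) 0) ^+ 2 * (t - s) = 2 * ((t - s) * (nu * nrm (coef (u s) 0) ^+ 2)) by ring.
lra.
Qed.

End Bounded.

Lemma locally_bounded T : 0 <= T -> exists B, forall t, 0 <= t <= T -> wn (u t) <= B.
Proof.
move=> T0.
have hP : forall x, 0 <= x <= T -> exists B, forall t, 0 <= t <= x -> wn (u t) <= B.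
  apply: real_induction => //.
  - by exists (wn (u 0)) => t t0; have -> : t = 0 by lra.
  - move=> x /andP[x0 xT] [B hB]; have [d d0 hd] := cont_u x0 ltr01.
    exists (d / 2) => [|y /andP[xy yd] yT]; first by rewrite divr_gt0.
    exists (B + 1) => t /andP[t0 ty]; have [tx|xt] := leP t x.
      by apply: le_trans (hB t _) _; rewrite ?t0// lerDl.
    have tx1 : wn (u t - u x) <= 1 by apply: hd => //; rewrite gtr0_norm ?subr_gt0//; lra.
    have := hB x; rewrite x0 lexx => /(_ isT) xB.
    have -> : u t = u x + (u t - u x) by ring.
    by apply: le_trans (wnD _ _) _; apply: lerD.
  - move=> x /andP[x0 xT] hB; have [d d0 hd] := cont_u (ltW x0) ltr01.
    pose y := Num.max 0 (x - d / 2).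
    have y0 : 0 <= y by rewrite le_max lexx.
    have yx : y < x by rewrite gt_max x0; lra.
    have yd : x - d / 2 <= y by rewrite le_max lexx orbT.
    have [B yB] := hB y (introT andP (conj y0 yx)).
    exists (Num.max B (wn (u x) + 1)) => t /andP[t0 tx]; rewrite le_max.
    have [ty|yt] := leP t y; first by rewrite yB ?t0.
    apply/orP; right; have tx1 : wn (u t - u x) <= 1.
      by apply: hd => //; rewrite ler0_norm ?subr_le0//; lra.
    have -> : u t = u x + (u t - u x) by ring.
    by apply: le_trans (wnD _ _) _; rewrite lerD2l.
by apply: hP; rewrite T0 lexx.
Qed.

Lemma kyfan_invariant n T : 0 <= T -> kyfan n (wzb * u T) = kyfan n (wzb * u 0).
Proof.
move=> T0; have [B hB] := locally_bounded T0.
have B0 := bnd_ge0 hB T0; have l0 := vlip_ge0 nu alpha beta B.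
have z0 : (0 : R) <= 0 by [].
pose K := 2 * n%:R * (lip B * (lip B * B)) * B.
have C1 : 0 <= lip B * (lip B * B) by rewrite !mulr_ge0.
have K0 : 0 <= K by rewrite /K !mulr_ge0.
have zb d (x y z : V) : wzb * y - wzb * x - wcst d * (wzb * z) = wzb * (y - x - wcst d * z) by ring.
apply/eqP; rewrite eq_le; apply/andP; split.
(* For the upper bound, [kyfan_step] goes from the later time [t] back to [s], with increment
   [- (t - s)]. *)
- apply: (@quadratic_mono R (fun t => kyfan n (wzb * u t)) T K T0 K0) => s t s0 st tT.
  have t0 : 0 <= t by exact: le_trans st.
  have tB : wn (u t) <= B by apply: hB; rewrite t0.
  have lp := lax_pair_vfield nu alpha beta (hardy_u t0).
  have hE : wn (wzb * u s - wzb * u t - wcst (- (t - s))%:C%C * (wzb * F (u t))) <=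
      lip B * (lip B * B) * (- (t - s)) ^+ 2.
    rewrite zb sqrrN; apply: le_trans (wn_zb _) _.
    have -> : u s - u t - wcst (- (t - s))%:C%C * F (u t) = - (u t - u s - wcst (t - s)%:C%C * F (u t)).
      by rewrite rmorphN wcstN; ring.
    by rewrite wnN; apply: (taylor1 z0 hB s0 st tT); rewrite st lexx.
  have := kyfan_step n lp C1 hE; rewrite sqrrN lerBlDr => h; apply: le_trans h _.
  rewrite lerD2l; apply: ler_wpM2r; first exact: sqr_ge0.
  by apply: ler_wpM2l; [rewrite !mulr_ge0|apply: le_trans (wn_zb _) _].
- rewrite -lerN2.
  apply: (@quadratic_mono R (fun t => - kyfan n (wzb * u t)) T K T0 K0) => s t s0 st tT.
  have sB : wn (u s) <= B by apply: hB; rewrite s0 (le_trans st).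
  have lp := lax_pair_vfield nu alpha beta (hardy_u s0).
  have hE : wn (wzb * u t - wzb * u s - wcst (t - s)%:C%C * (wzb * F (u s))) <=
      lip B * (lip B * B) * (t - s) ^+ 2.
    rewrite zb; apply: le_trans (wn_zb _) _.
    by apply: (taylor1 z0 hB s0 st tT); rewrite lexx st.
  have := kyfan_step n lp C1 hE => h.
  have h2 : 2 * n%:R * (lip B * (lip B * B)) * wn (wzb * u s) * (t - s) ^+ 2 <= K * (t - s) ^+ 2.
    apply: ler_wpM2r; first exact: sqr_ge0.
    by apply: ler_wpM2l; [rewrite !mulr_ge0|apply: le_trans (wn_zb _) _].
  lra.
Qed.

Hypothesis nu_gt0 : 0 < nu.
Let nu_ge0 := ltW nu_gt0.

Lemma nn_noninc s t : 0 <= s -> s <= t -> nn (u t) <= nn (u s).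
Proof.
move=> s0 st; have t0 : 0 <= t by exact: le_trans st.
have [B hB] := locally_bounded t0.
have z0 : (0 : R) <= 0 by [].
have K0 := nn_cost_ge0 (bnd_ge0 hB t0).
have := @quadratic_mono R (fun r => nn (u (s + r))) (t - s) (nn_cost B) _ K0.
rewrite addr0 subrKC subr_ge0 => h; apply: h => // p q p0 pq qT.
have := nn_step z0 hB (s := s + p) (t := s + q); rewrite (_ : s + q - (s + p) = q - p); last by ring.
move=> h; have {h} := h (addr_ge0 s0 p0) (ltac:(lra)) (ltac:(lra)).
have : 0 <= 2 * nu * nrm (coef (u (s + p)) 0) ^+ 2 * (q - p).
  apply: mulr_ge0; last by rewrite subr_ge0.
  by apply: mulr_ge0; [exact: mulr_ge0|exact: sqr_ge0].
lra.
Qed.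

(** [tau] depends only on [B]: as long as the norm is at most [B + 1] the speed is at most [K], and
    [K * tau < 1] leaves no time to gain 1. Continuity keeps the bootstrap going. *)
Lemma window (B : R) : 0 <= B -> exists2 tau, 0 < tau & forall t, 0 <= t -> wn (u t) <= B ->
  forall s, t <= s <= t + tau -> wn (u s) <= B + 1.
Proof.
move=> B0; pose B1 := B + 1; pose K := lip B1 * B1.
have l0 := vlip_ge0 nu alpha beta B1.
have K0 : 0 <= K by rewrite mulr_ge0// addr_ge0.
exists (K + 1)^-1; first by rewrite invr_gt0 ltr_wpDl.
move=> t t0 tB; set tau := (K + 1)^-1.
have Ktau : K * tau < 1 by rewrite /tau ltr_pdivrMr ?ltr_wpDl// mul1r ltrDl.
have tau0 : 0 < tau by rewrite invr_gt0 ltr_wpDl.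
have hP : forall x, t <= x <= t + tau -> forall s, t <= s <= x -> wn (u s) <= B1.
  apply: real_induction => [||x /andP[tx xt] hx|x /andP[tx xt] hx].
  - by rewrite lerDl ltW.
  - move=> s st; have -> : s = t by lra.
    rewrite /B1; lra.
  - have x0 : 0 <= x by exact: le_trans tx.
    have tay : wn (u x - u t) <= K * (x - t) by apply: (taylor0 t0 hx).
    have small : 0 < 1 - K * (x - t).
      rewrite subr_gt0; apply: le_lt_trans Ktau; apply: ler_wpM2l => //; lra.
    have [d d0 hd] := cont_u x0 small.
    exists (d / 2) => [|y /andP[xy yd] yT s /andP[ts sy]]; first by rewrite divr_gt0.
    have [sx|xs] := leP s x; first by apply: hx; rewrite ts.
    have h : wn (u s - u x) <= 1 - K * (x - t).
      by apply: hd; [exact: le_trans ts|rewrite gtr0_norm ?subr_gt0//; lra].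
    have -> : u s = u t + (u x - u t) + (u s - u x) by ring.
    have := wnD (u t + (u x - u t)) (u s - u x); have := wnD (u t) (u x - u t).
    rewrite /B1; lra.
  - move=> s /andP[ts sx]; have [ss|xs] := ltP s x; first by apply: (hx s _ s); rewrite ts ?ss ?lexx.
    have {s ts sx xs} -> : s = x by lra.
    apply/ler_addgt0Pr => e e0; have x0 : 0 <= x by rewrite (le_trans t0)// ltW.
    have [d d0 hd] := cont_u x0 e0.
    pose y := Num.max t (x - d / 2).
    have ty : t <= y by rewrite le_max lexx.
    have yx : y < x by rewrite gt_max tx; lra.
    have yd : x - d / 2 <= y by rewrite le_max lexx orbT.
    have yB : wn (u y) <= B1 by apply: (hx y _ y); rewrite ty ?lexx.
    have h : wn (u y - u x) <= e.
      by apply: hd; [exact: le_trans ty|rewrite ltr0_norm ?subr_lt0//; lra].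
    have -> : u x = u y - (u y - u x) by ring.
    by apply: le_trans (wnB _ _) _; apply: lerD.
by move=> s st; apply: (hP s st); case/andP: st => -> /=; rewrite lexx.
Qed.

Lemma nn_cauchy (e : R) : 0 < e -> exists2 T, 0 <= T &
  forall t t', T <= t -> t <= t' -> nn (u t) - nn (u t') <= e.
Proof.
move=> e0; pose S := [set nn (u t) | t in [set t : R | 0 <= t]].
have hS : has_inf S.
  by split; [exists (nn (u 0)), 0 => //=|exists 0 => _ [t _ <-]; exact: nn_ge0].
have [_ [T /= T0 <-] lt] := inf_adherent e0 hS.
exists T => // t t' Tt tt'.
have : inf S <= nn (u t').
  by apply: inf_lbound; [case: hS|exists t' => //=; rewrite (le_trans T0) ?(le_trans Tt)].
have := nn_noninc T0 Tt; lra.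
Qed.

(* [f] tends to [0], uniformly on the windows of some fixed length that start at a time
   where the solution is bounded by [B]. *)
Definition small (B : R) (f : R -> R) := exists2 tau, 0 < tau & forall e, 0 < e ->
  exists T, forall t, 0 <= t -> T <= t -> wn (u t) <= B ->
    forall s, t <= s -> s <= t + tau -> f s <= e.

(** The comparison is assumed only where the norm is at most [B + 1], a bound that [window]
    guarantees once the length is shortened. *)
Lemma small_dom B (c : R) (f g h : R -> R) : 0 <= B -> 0 <= c -> small B f -> small B g ->
  (forall s, 0 <= s -> wn (u s) <= B + 1 -> h s <= c * (f s + g s)) -> small B h.
Proof.
move=> B0 c_ge0 [tf tf0 hf] [tg tg0 hg] hfg.
have [tau tau0 win] := window B0.
exists (Num.min tau (Num.min tf tg)); first by rewrite !lt_min tau0 tf0.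
move=> e e0; have c1 : 0 < 2 * (c + 1) by rewrite mulr_gt0// ltr_wpDl.
have [Tf Hf] := hf _ (divr_gt0 e0 c1); have [Tg Hg] := hg _ (divr_gt0 e0 c1).
exists (Num.max Tf Tg) => t t0; rewrite ge_max => /andP[Tft Tgt] tB s ts.
rewrite -lerBlDl !le_min !lerBlDl => /andP[s1 /andP[s2 s3]].
have := Hf t t0 Tft tB s ts s2; have := Hg t t0 Tgt tB s ts s3.
rewrite !ler_pdivlMr// => h1 h2.
apply: le_trans (hfg s (le_trans t0 ts) _) _; first by apply: (win t); rewrite ?ts.
have [fg|fg] := leP (f s + g s) 0; last nra.
by apply: le_trans (ltW e0); exact: mulr_ge0_le0.
Qed.

(** The squared norm converges, so its drop over [[s, s + d]] becomes negligible; by [nn_step] the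
    drop controls [|(u|1)|^2] at time [s] itself, up to an error quadratic in [d]. *)
Lemma small_mass B : 0 <= B -> small B (fun s => nrm (coef (u s) 0)).
Proof.
move=> B0; have [tau tau0 win] := window B0.
pose K := nn_cost (B + 1).
have K0 : 0 <= K by apply: nn_cost_ge0; rewrite addr_ge0.
exists (tau / 2); first by rewrite divr_gt0.
(* [d] is so small that the error [K d] is at most [nu e^2], then [T] so late that the drop is at
   most [nu e^2 d]; together they give [2 nu |(u|1)|^2 <= 2 nu e^2]. *)
move=> e e0; pose d := Num.min (tau / 2) (nu * e ^+ 2 / (K + 1)).
have K1 : 0 < K + 1 by rewrite ltr_wpDl.
have ne0 : 0 < nu * e ^+ 2 by rewrite mulr_gt0 ?exprn_gt0.
have d0 : 0 < d by rewrite lt_min !divr_gt0.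
have d1 : d <= tau / 2 by rewrite ge_min lexx.
have d2 : d * (K + 1) <= nu * e ^+ 2 by rewrite -ler_pdivlMr// ge_min lexx orbT.
have [T T0 hT] := nn_cauchy (mulr_gt0 ne0 d0).
exists T => t t0 Tt tB s ts st.
have wb r : t <= r <= t + tau -> wn (u r) <= B + 1 by exact: win.
have h := nn_step t0 wb ts (_ : s <= s + d) (_ : s + d <= t + tau).
have {h} := h (ltac:(lra)) (ltac:(lra)).
have -> : s + d - s = d by ring.
have := hT s (s + d) (le_trans Tt ts) (ltac:(lra)) => h1 h2.
have h3 : 2 * nu * nrm (coef (u s) 0) ^+ 2 <= nu * e ^+ 2 + K * d.
  by rewrite -(ler_pM2r d0) mulrDl; rewrite -/K expr2 in h2; lra.
have : nrm (coef (u s) 0) ^+ 2 <= e ^+ 2.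
  rewrite -(ler_pM2l nu_gt0); nra.
by rewrite ler_pXn2r// nnegrE ?nrm_ge0// ltW.
Qed.

(** An inequality of Landau type: [d h(s)] is a difference of two values of [f] up to [K d^2]. A
    small [d] absorbs the remainder, then [f] is made small compared to [d]; the window is halved to
    leave room for [s + d]. *)
Lemma landau B (f h : R -> C) : small B (fun s => nrm (f s)) ->
  (exists2 tau, 0 < tau & exists2 K, 0 <= K & forall t, 0 <= t -> wn (u t) <= B ->
     forall s r, t <= s -> s <= r -> r <= t + tau ->
       nrm (f r - f s - (r - s)%:C%C * h s) <= K * (r - s) ^+ 2) ->
  small B (fun s => nrm (h s)).
Proof.
move=> [tf tf0 hf] [tau tau0 [K K0 inc]].
pose tm := Num.min tf tau.
have tm0 : 0 < tm by rewrite lt_min tf0.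
have tmf : tm <= tf by rewrite ge_min lexx.
have tmt : tm <= tau by rewrite ge_min lexx orbT.
exists (tm / 2); first by rewrite divr_gt0.
move=> e e0; have K1 : 0 < 2 * (K + 1) by rewrite mulr_gt0// ltr_wpDl.
pose d := Num.min (tm / 2) (e / (2 * (K + 1))).
have d0 : 0 < d by rewrite lt_min !divr_gt0.
have d1 : d <= tm / 2 by rewrite ge_min lexx.
have d2 : d * (2 * (K + 1)) <= e by rewrite -ler_pdivlMr// ge_min lexx orbT.
have eta0 : 0 < e * d / 4 by rewrite divr_gt0// mulr_gt0.
have [T hT] := hf _ eta0; exists T => t t0 Tt tB s ts st.
have h1 := hT t t0 Tt tB s ts (ltac:(lra)).
have h2 := hT t t0 Tt tB (s + d) (ltac:(lra)) (ltac:(lra)).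
have := inc t t0 tB s (s + d) ts (ltac:(lra)) (ltac:(lra)).
have -> : s + d - s = d by ring.
move=> h3; rewrite -(ler_pM2l d0).
have -> : d * nrm (h s) = nrm (d%:C%C * h s) by rewrite nrmM nrm_real gtr0_norm.
have -> : d%:C%C * h s = (f (s + d) - f s) - (f (s + d) - f s - d%:C%C * h s) by ring.
apply: le_trans (nrmB _ _) _.
have h4 := nrmB (f (s + d)) (f s).
rewrite expr2 in h3.
have h5 : K * (d * d) <= e * d / 2 by nra.
lra.
Qed.

Lemma hiter_increment n B : 0 <= B -> exists2 tau, 0 < tau & exists2 K, 0 <= K &
  forall t, 0 <= t -> wn (u t) <= B -> forall s r, t <= s -> s <= r -> r <= t + tau ->
    nrm (coef (hiter (u r) n) 0 - coef (hiter (u s) n) 0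
         - (r - s)%:C%C * coef (dhiter (u s) (F (u s)) n) 0) <= K * (r - s) ^+ 2.
Proof.
move=> B0; have [tau tau0 win] := window B0; exists tau => //.
have B1 : 0 <= B + 1 by rewrite addr_ge0.
have l0 := vlip_ge0 nu alpha beta (B + 1).
have L0 : 0 <= lip (B + 1) * (B + 1) by rewrite mulr_ge0.
have [K K0 hK] := hiter_taylor n B1 L0 (mulr_ge0 l0 L0).
exists K => // t t0 tB s r ts sr rt.
have wb q : t <= q <= t + tau -> wn (u q) <= B + 1 by exact: win.
rewrite -coefZ -!coefB; apply: le_trans (coef_le_wn _ _) _.
apply: hK; first by rewrite subr_ge0.
- by apply: wb; rewrite ts (le_trans sr).
- by apply: wb; rewrite rt (le_trans ts).
- exact: (taylor0 t0 wb ts sr rt).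
- by apply: (taylor1 t0 wb ts sr rt); rewrite lexx.
Qed.

(** The coefficient of [Pi(|u|^2 u)] left when the two cubic terms coincide; it is imaginary, as
    [dhiter_cub] requires, and nonzero exactly when [beta <> 1]. *)
Definition kappa : C := - ('i%C * (1 - beta)%:C%C).

Lemma conj_kappa : conjc kappa = - kappa.
Proof. by rewrite /kappa; apply/eqP; rewrite eq_complex /=; apply/andP; split; apply/eqP; ring. Qed.

(** Up to the mean of [v], [S^* v] is [conj(z) v], and [S Pi(|S^* v|^2 S^* v)] is [Pi(|v|^2 v)]
    deprived of its mean. The error is governed by the two means [(v|1)] and [(|v|^2 v|1)]. *)
Lemma vfield_split B : 0 <= B -> exists2 K, 0 <= K & forall v, hardy v -> wn v <= B ->
  wn (F v - wcst kappa * wproj (cub v)) <= K * (nrm (coef v 0) + nrm (moment v 1)).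
Proof.
move=> B0; pose K := nrm c0 + `|beta| * (24 * B ^+ 2 + 1).
exists K => [|v hv vB].
  by rewrite /K; apply: addr_ge0; rewrite ?nrm_ge0// mulr_ge0// addr_ge0// mulr_ge0// sqr_ge0.
set g0 := coef v 0; pose y := v - wcst g0.
have hy : hardy y by apply: hardyB => //; exact: hardy_cst.
have sh : wz * wproj (cub (sadj v)) = wproj (cub y) - wcst (coef (cub y) 0).
  have -> : cub (sadj v) = wzb * cub y.
    have -> : sadj v = wzb * y by [].
    rewrite /cub wconjM wconj_zb (_ : _ * _ * _ = (wzb * wz) * (wzb * (y * wconj y * y))); last by ring.
    by rewrite wzbz mul1r.
  apply: walg_coef => k; rewrite coef_z coefB !coef_proj coef_cst coef_zb subrK.
  case: (eqVneq k 0) => [->|k0] /=; first by rewrite subrr.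
  rewrite subr0; case: (leP 0 k) => k1; first by rewrite ifT//; lia.
  by rewrite ifF//; lia.
have -> : F v - wcst kappa * wproj (cub v) = - wcst (c0 * g0)
   - wcst ('i%C * beta%:C%C) * (wproj (cub v - cub y) + wcst (coef (cub y) 0)).
  have -> : kappa = 'i%C * beta%:C%C - 'i%C by rewrite /kappa rmorphB rmorph1; ring.
  rewrite /vfield sh wprojB -/g0 wcstB; ring.
have g0B : nrm g0 <= B by apply: le_trans (coef_le_wn _ _) vB.
have g00 := nrm_ge0 g0.
have yB : wn y <= 2 * B.
  by apply: le_trans (wnB _ _) _; have := wn_cst g0; lra.
have vB2 : wn v <= 2 * B by lra.
have d1 : wn (cub v - cub y) <= 12 * B ^+ 2 * nrm g0.
  apply: le_trans (cub_lip vB2 yB) _.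
  have -> : v - y = wcst g0 by rewrite /y; ring.
  have := wn_cst g0; rewrite exprMn.
  have := sqr_ge0 B; set b := B ^+ 2; nra.
have d2 : nrm (coef (cub y) 0) <= nrm (moment v 1) + 12 * B ^+ 2 * nrm g0.
  rewrite -coef_cub0//.
  have -> : coef (cub y) 0 = coef (cub v) 0 - coef (cub v - cub y) 0 by rewrite coefB; ring.
  apply: le_trans (nrmB _ _) _; rewrite lerD2l; apply: le_trans (coef_le_wn _ _) d1.
have d3 := wn_proj (cub v - cub y); have d4 := wn_cst (coef (cub y) 0).
apply: le_trans (wnB _ _) _; rewrite wnN wnZ nrmM nrm_i mul1r nrm_real.
have d5 := wnD (wproj (cub v - cub y)) (wcst (coef (cub y) 0)).
have d6 : wn (wcst (c0 * g0)) <= nrm c0 * nrm g0 by rewrite -nrmM; exact: wn_cst.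
have d7 : `|beta| * wn (wproj (cub v - cub y) + wcst (coef (cub y) 0)) <=
    `|beta| * (24 * B ^+ 2 * nrm g0 + nrm (moment v 1)) by apply: ler_wpM2l => //; lra.
have e1 : 0 <= nrm (moment v 1) by exact: nrm_ge0.
have e2 : 0 <= nrm c0 by exact: nrm_ge0.
have e3 : 0 <= `|beta| * nrm g0 by rewrite mulr_ge0.
have e4 : 0 <= `|beta| * (B ^+ 2) * nrm (moment v 1) by rewrite mulr_ge0// mulr_ge0// sqr_ge0.
have e5 : 0 <= nrm c0 * nrm (moment v 1) by rewrite mulr_ge0.
apply: le_trans (lerD d6 d7) _; rewrite /K; lra.
Qed.

Hypothesis beta_neq1 : beta != 1.

Lemma kappa_gt0 : 0 < nrm kappa.
Proof.
by rewrite /kappa nrmN nrmM nrm_i mul1r nrm_real normr_gt0 subr_eq0 eq_sym.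
Qed.

Lemma moment0 v : hardy v -> moment v 0 = coef v 0.
Proof. by move=> hv; rewrite /moment /hiter /= /hank wconj1 mulr1 hardyK. Qed.

(** Separate from the general induction, since [vfield_split] has this moment in its error. The mean
    of the field is [- damping (u|1) - i (|u|^2 u|1)], because the [beta] term carries a factor
    [z]. *)
Lemma small_moment1 B : 0 <= B -> small B (fun s => nrm (moment (u s) 1)).
Proof.
move=> B0; have s0 := small_mass B0.
have sh : small B (fun s => nrm (coef (dhiter (u s) (F (u s)) 1) 0)).
  apply: (@landau B (fun s => coef (hiter (u s) 1) 0)); last exact: hiter_increment.
  apply: (small_dom (c := 1) B0 _ s0 s0) => // s t0 _.
  rewrite -[coef _ 0]/(moment (u s) 0) moment0; last exact: hardy_u.
  by rewrite mul1r lerDl nrm_ge0.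
apply: (small_dom (c := 1 + nrm c0) B0 _ s0 sh) => [|s t0 _]; first by rewrite addr_ge0 ?nrm_ge0.
have hs := hardy_u t0.
have -> : dhiter (u s) (F (u s)) 1 = F (u s).
  by rewrite /= hank0r addr0 /hiter /= /hank wconj1 mulr1 hardyK//; exact: hardy_vfield.
rewrite coef_vfield /= mulr0 addr0 coef_cub0//.
set g0 := coef _ 0; set g1 := moment _ 1; set x := - _ - _.
have -> : nrm g1 = nrm (- x - c0 * g0) by rewrite -[LHS]mul1r -nrm_i -nrmM /x; congr nrm; ring.
apply: le_trans (nrmB _ _) _; rewrite nrmN nrmM.
have := nrm_ge0 x; have := nrm_ge0 g0; have := nrm_ge0 c0; nra.
Qed.

(** The derivative of each moment is [kappa] times the next one, up to an error controlled by the
    first two; [landau] makes it small, and [kappa] is then divided out. *)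
Lemma small_moment B m : 0 <= B -> small B (fun s => nrm (moment (u s) m)).
Proof.
move=> B0; have s0 := small_mass B0; have s1 := small_moment1 B0.
elim: m => [|m IH].
  apply: (small_dom (c := 1) B0 _ s0 s0) => // s t0 _.
  by rewrite moment0; [rewrite mul1r lerDl nrm_ge0|exact: hardy_u].
have sh : small B (fun s => nrm (coef (dhiter (u s) (F (u s)) (m + m).+1) 0)).
  by apply: (@landau B (fun s => moment (u s) m)) => //; exact: hiter_increment.
have B1 : 0 <= B + 1 by rewrite addr_ge0.
have [K K0 hK] := vfield_split B1.
have sE : small B (fun s => wn (F (u s) - wcst kappa * wproj (cub (u s)))).
  by apply: (small_dom B0 K0 s0 s1) => s t0 sB; apply: hK => //; exact: hardy_u.
have [K' K'0 hK'] := dhiter_bnd (m + m).+1 B1.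
apply: (small_dom (c := (nrm kappa)^-1 * (1 + K')) B0 _ sh sE) => [|s t0 sB].
  by rewrite mulr_ge0 ?invr_ge0 ?nrm_ge0// addr_ge0.
have hs := hardy_u t0.
rewrite -mulrA mulrC ler_pdivlMr ?kappa_gt0// mulrC -nrmM.
rewrite -coef_dhiter_cub//; last exact: conj_kappa.
set E := F (u s) - _; set P := wcst kappa * _.
have -> : coef (dhiter (u s) P (m + m).+1) 0 =
    coef (dhiter (u s) (F (u s)) (m + m).+1) 0 - coef (dhiter (u s) E (m + m).+1) 0.
  have eF : F (u s) = E + P by rewrite /E /P; ring.
  by rewrite -coefB; congr (coef _ 0); rewrite eF dhiterD; ring.
apply: le_trans (nrmB _ _) _.
have h1 := coef_le_wn (dhiter (u s) E (m + m).+1) 0.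
have h2 := hK' (u s) E sB.
have := nrm_ge0 (coef (dhiter (u s) (F (u s)) (m + m).+1) 0); have := wn_ge0 E; nra.
Qed.

Lemma moments_eventually B m (e : R) : 0 <= B -> 0 < e ->
  exists T, forall t, 0 <= t -> T <= t -> wn (u t) <= B -> nrm (moment (u t) m) <= e.
Proof.
move=> B0 e0; have [tau tau0 h] := small_moment m B0; have [T hT] := h e e0.
by exists T => t t0 Tt tB; apply: (hT t) => //; rewrite lerDl ltW.
Qed.

Theorem no_cluster_point v :
  (forall e T, 0 < e -> exists t, [/\ 0 <= t, T <= t & wn (u t - v) <= e]) ->
  2 * kyfan 1 (wzb * u 0) <= kyfan 2 (wzb * u 0) + nn (u 0).
Proof.
move=> cl; pose B := wn v + 1.
have B0 : 0 <= B by rewrite addr_ge0 ?wn_ge0.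
have v0 := wn_ge0 v.
have near e : 0 < e -> e <= 1 -> forall T, exists t, [/\ 0 <= t, T <= t, wn (u t - v) <= e & wn (u t) <= B].
  move=> e0 e1 T; have [t [t0 Tt tv]] := cl e T e0; exists t; split => //.
  have -> : u t = v + (u t - v) by ring.
  by apply: le_trans (wnD _ _) _; rewrite /B lerD2l (le_trans tv).
have hv : hardy v.
  move=> k k0; apply: nrm_eq0; apply/eqP; rewrite eq_le nrm_ge0 andbT.
  apply: (@le_vanishing R _ _ 1) => // e e0 e1; have [t [t0 _ tv _]] := near e e0 e1 0.
  rewrite add0r mul1r; have := coef_le_wn (u t - v) k.
  by rewrite coefB (hardy_u t0 k0) sub0r nrmN => /le_trans; apply.
have mom m : ip (hiter v (m + m).+1) 1 = 0.
  rewrite ip1r -/(moment v m).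
  have [K K0 hK] := hiter_lip (m + m).+1 B0.
  apply: nrm_eq0; apply/eqP; rewrite eq_le nrm_ge0 andbT.
  apply: (@le_vanishing R _ _ (1 + K)) => [|e e0 e1]; first by rewrite addr_ge0.
  have [T hT] := moments_eventually m B0 e0.
  have [t [t0 Tt tv tB]] := near e e0 e1 T.
  have -> : moment v m = moment (u t) m - coef (hiter (u t) (m + m).+1 - hiter v (m + m).+1) 0.
    by rewrite coefB /moment; ring.
  apply: le_trans (nrmB _ _) _; rewrite add0r mulrDl mul1r; apply: lerD; first exact: hT.
  apply: le_trans (coef_le_wn _ _) _; apply: le_trans (hK _ _ _ tB) _; first by rewrite /B lerDl.
  by rewrite ler_wpM2l.
have main := kyfan_moments_le hv mom.
have k1 : kyfan 1 (wzb * u 0) <= kyfan 1 (wzb * v).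
  apply: (@le_vanishing R _ _ (2 * B + 1)) => [|e e0 e1]; first by lra.
  have [t [t0 _ tv tB]] := near e e0 e1 0.
  rewrite -(kyfan_invariant 1 t0); apply: le_trans (kyfan_lip 1 _ (wzb * v)) _; rewrite lerD2l mul1r.
  rewrite -mulrBr; have h1 := le_trans (wn_zb _) tv; have h2 := wn_zb v.
  have h3 := wn_ge0 (wzb * (u t - v)); have h4 := wn_ge0 (wzb * v).
  rewrite expr2 /B; nra.
have k2 : kyfan 2 (wzb * v) <= kyfan 2 (wzb * u 0).
  apply: (@le_vanishing R _ _ (2 * (2 * B + 1))) => [|e e0 e1]; first by lra.
  have [t [t0 _ tv tB]] := near e e0 e1 0.
  rewrite -(kyfan_invariant 2 t0); apply: le_trans (kyfan_lip 2 _ (wzb * u t)) _; rewrite lerD2l -mulrA.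
  apply: ler_wpM2l => //; rewrite -mulrBr wn_distC in tv *.
  have h1 := le_trans (wn_zb _) tv; have h2 := le_trans (wn_zb _) tB.
  have h3 := wn_ge0 (wzb * (v - u t)); have h4 := wn_ge0 (wzb * u t).
  rewrite expr2; nra.
have k3 : nn v <= nn (u 0).
  apply: (@le_vanishing R _ _ (2 * B + 1)) => [|e e0 e1]; first by lra.
  have [t [t0 _ tv tB]] := near e e0 e1 0.
  have h := nn_noninc (lexx 0) t0.
  have := nn_add_le (u t) (v - u t); rewrite (_ : u t + (v - u t) = v); last by ring.
  rewrite wn_distC in tv; have h3 := wn_ge0 (v - u t); have h4 := wn_ge0 (u t).
  rewrite expr2; nra.
lra.
Qed.

End Dynamics.

(** * Spectral bounds for explicit data *)

Section SpectralBounds.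
Context {R : realType}.
Local Notation C := R[i].
Local Notation V := (walg R).
Implicit Types (a f g h w : V) (c : C).

Lemma nn_wtr w m : nn (w - wtr w m) = nn w - \sum_(j <- ints m) nrm (coef w j) ^+ 2.
Proof.
have e : ip w (wtr w m) = (\sum_(j <- ints m) nrm (coef w j) ^+ 2)%:C%C.
  rewrite /wtr ip_sumr rmorph_sum; apply: eq_bigr => j _.
  by rewrite ipZr ip_exp mulrC mul_conj.
have e2 : ip (wtr w m) (wtr w m) = ip w (wtr w m).
  rewrite /wtr [in LHS]ip_sumr ip_sumr; apply: eq_big_seq => j jm.
  by rewrite !ipZr !ip_exp coef_wtr -mem_ints jm.
by rewrite nnB [nn (wtr w m)]nn_ip e2 e /=; ring.
Qed.

Lemma sum_ints_hardy w m : hardy w ->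
  \sum_(j <- ints m) nrm (coef w j) ^+ 2 = \sum_(0 <= k < m) nrm (coef w (Posz k)) ^+ 2.
Proof.
move=> hw; rewrite sum_intsE; apply: eq_big_nat => k _.
by rewrite (hw (Negz k)) // nrm0 expr0n addr0.
Qed.

Lemma parseval_le w e : hardy w -> 0 < e -> exists N, forall m, (N <= m)%N ->
  nn w <= \sum_(0 <= k < m) nrm (coef w (Posz k)) ^+ 2 + e.
Proof.
move=> hw e0; pose d := Num.min 1 e.
have d0 : 0 < d by rewrite lt_min ltr01.
have d1 : d <= 1 by rewrite ge_min lexx.
have de : d <= e by rewrite ge_min lexx orbT.
have [N hN] := wn_wtr w d0; exists N => m Nm.
rewrite -sum_ints_hardy// addrC -lerBlDr -nn_wtr; apply: le_trans (nn_le_wn _) _.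
have := hN m Nm; have := wn_ge0 (w - wtr w m); rewrite expr2; nra.
Qed.

Lemma eventually_all (P : nat -> nat -> Prop) :
  (forall k, exists N, forall m, (N <= m)%N -> P k m) ->
  forall K, exists N, forall m, (N <= m)%N -> forall k, (k < K)%N -> P k m.
Proof.
move=> h; elim=> [|K [N hN]]; first by exists 0%N.
have [M hM] := h K; exists (maxn N M) => m; rewrite geq_max => /andP[Nm Mm] k.
by rewrite ltnS leq_eqVlt => /orP[/eqP->|kK]; [exact: hM|exact: hN].
Qed.

(** A number [n] is the sum of at most [n + 1] of the pairs; removing the first row shifts [x],
    which drives the induction. *)
Lemma hankel_double_sum (x : nat -> R) N M : (forall n, 0 <= x n) ->
  \sum_(0 <= k < N) \sum_(0 <= l < M) x (k + l)%N <= \sum_(0 <= n < N + M) n.+1%:R * x n.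
Proof.
elim: N x => [|N IH] x x0.
  by rewrite big_geq//; apply: sumr_ge0 => n _; exact: mulr_ge0.
rewrite big_nat_recl// addSn big_nat_recl//.
have h : \sum_(0 <= k < N) \sum_(0 <= l < M) x (k.+1 + l)%N <= \sum_(0 <= n < N + M) n.+1%:R * x n.+1.
  by apply: (IH (fun n => x n.+1)) => n; exact: x0.
have h2 : \sum_(0 <= l < M) x (0 + l)%N <= x 0%N + \sum_(0 <= n < N + M) x n.+1.
  rewrite -[x 0%N + _](@big_nat_recl _ _ _ (N + M) 0 (fun n => x n))//.
  rewrite [leRHS](@big_cat_nat _ _ _ M)//=; last by rewrite ltnW// ltnS leq_addl.
  by rewrite lerDl sumr_ge0.
apply: le_trans (lerD h2 h) _; rewrite mul1r -addrA lerD2l -big_split /=.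
by apply: ler_sum => n _; rewrite [n.+2%:R]mulrS mulrDl mul1r.
Qed.

Lemma coef_hank_exp a k l : coef (hank a (wexp (Posz k))) (Posz l) = coef a (Posz (k + l)).
Proof.
rewrite /hank coef_proj /= wconj_exp mulrC coef_shift opprK; congr coef; lia.
Qed.

(** A Ky Fan sum is at most the squared Hilbert-Schmidt norm: by symmetry the [k]-th coefficients of
    the two images have the moduli of the products of [H_a z^k] with the two test vectors, so Bessel
    bounds them column by column. *)
Lemma kyfan2_zb_le g (Q : R) : hardy g ->
  (forall N, \sum_(0 <= n < N) n.+1%:R * nrm (coef g (Posz n)) ^+ 2 <= Q) ->
  kyfan 2 (wzb * g) + nn g <= Q.
Proof.
move=> hg hQ; rewrite -lerBrDr; apply: kyfan_le => h [hh o]; rewrite lerBrDr.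
(* The four [e] pay for truncating the two images, the columns, and [g] itself. *)
apply: (@le_vanishing R _ _ 4) => // e e0 e1.
pose a := wzb * g; pose W (i : 'I_2) := hank a (h i).
have e2 (i : 'I_2) : exists N, forall m, (N <= m)%N ->
    nn (W i) <= \sum_(0 <= k < m) nrm (coef (W i) (Posz k)) ^+ 2 + e.
  exact: parseval_le (hardy_hank _ _) e0.
have [N0 hN0] := e2 ord0; have [N1 hN1] := e2 (lift ord0 ord0).
pose N := maxn N0 N1.
have N_gt0 : 0 < N%:R + 1 :> R by rewrite ltr_wpDl.
have [M hM] := @eventually_all (fun k m => nn (hank a (wexp (Posz k))) <=
   \sum_(0 <= l < m) nrm (coef (hank a (wexp (Posz k))) (Posz l)) ^+ 2 + e / (N%:R + 1))
   (fun k => parseval_le (hardy_hank _ _) (divr_gt0 e0 N_gt0)) N.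
have [K hK] := parseval_le hg e0.
pose x n := nrm (coef a (Posz n)) ^+ 2.
have x0 n : 0 <= x n by exact: sqr_ge0.
have s1 : kyfan_at a h <= \sum_(0 <= k < N) nn (hank a (wexp (Posz k))) + 2 * e.
  rewrite /kyfan_at !big_ord_recl big_ord0 addr0 -!/(W _).
  have := hN0 N (leq_maxl _ _); have := hN1 N (leq_maxr _ _).
  suff : \sum_(0 <= k < N) nrm (coef (W ord0) (Posz k)) ^+ 2
      + \sum_(0 <= k < N) nrm (coef (W (lift ord0 ord0)) (Posz k)) ^+ 2
      <= \sum_(0 <= k < N) nn (hank a (wexp (Posz k))) by lra.
  rewrite -big_split /=; apply: ler_sum => k _.
  have c i : nrm (coef (W i) (Posz k)) = nrm (ip (hank a (wexp (Posz k))) (h i)).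
    by rewrite -ip_exp hank_sym//; exact: hardy_exp.
  have nh i : nn (h i) = 1 by rewrite nn_ip o eqxx.
  by rewrite !c; apply: bessel2; rewrite ?nh ?o.
have s2 : \sum_(0 <= k < N) nn (hank a (wexp (Posz k))) <=
    \sum_(0 <= k < N) \sum_(0 <= l < M) x (k + l)%N + e.
  apply: (@le_trans _ _ (\sum_(0 <= k < N) (\sum_(0 <= l < M) x (k + l)%N + e / (N%:R + 1)))).
    apply: ler_sum_nat => k /andP[_ kN]; apply: le_trans (hM M (leqnn M) k kN) _.
    by rewrite lerD2r; apply: ler_sum => l _; rewrite coef_hank_exp.
  rewrite big_split /= lerD2l big_const_nat subn0 iter_addr_0 -[leLHS]mulr_natr mulrAC.
  by rewrite -mulrA ler_piMr ?(ltW e0)// ler_pdivrMr// mul1r lerDl ler01.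
have s3 := hankel_double_sum N M x0.
pose L := maxn (N + M).+1 K.
have s4 := hK L (leq_maxr _ _).
have s5 : \sum_(0 <= n < N + M) n.+1%:R * x n + \sum_(0 <= k < L) nrm (coef g (Posz k)) ^+ 2 <= Q.
  apply: le_trans (hQ L).
  have -> : \sum_(0 <= n < L) n.+1%:R * nrm (coef g (Posz n)) ^+ 2 =
     \sum_(0 <= n < L) n%:R * nrm (coef g (Posz n)) ^+ 2 + \sum_(0 <= k < L) nrm (coef g (Posz k)) ^+ 2.
    by rewrite -big_split /=; apply: eq_bigr => n _; rewrite mulrS mulrDl mul1r addrC.
  rewrite lerD2r.
  (* [x n] is the squared modulus of the coefficient [n + 1] of [g]: the shift turns the weight
     [n + 1] into [n], and the added [|g|^2] restores it. *)
  have -> : \sum_(0 <= n < N + M) n.+1%:R * x n =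
      \sum_(0 <= n < (N + M).+1) n%:R * nrm (coef g (Posz n)) ^+ 2.
    rewrite [RHS]big_nat_recl// mul0r add0r; apply: eq_bigr => n _.
    by rewrite /x /a coef_zb; congr (_ * nrm (coef _ _) ^+ 2); lia.
  rewrite [leRHS](@big_cat_nat _ _ _ (N + M).+1)//=; last exact: leq_maxl.
  by rewrite lerDl sumr_ge0// => n _; rewrite mulr_ge0 ?sqr_ge0.
rewrite -/a.
lra.
Qed.

Lemma wcst_nat n : wcst n%:R = n%:R :> V.
Proof. by elim: n => [|n IH]; [rewrite wcst0|rewrite !mulrS wcstD wcst1 IH]. Qed.
Lemma wexp_nat n : wexp (Posz n) = wz ^+ n :> V.
Proof.
elim: n => [|n IH]; first by rewrite expr0 wexp0.
by rewrite exprS -IH -wexpD; congr wexp; lia.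
Qed.
Lemma coef_natM n f k : coef (n%:R * f) k = n%:R * coef f k.
Proof. by rewrite -wcst_nat coefZ. Qed.
Lemma coef_zX n k : coef (wz ^+ n : V) k = (Posz n == k)%:R.
Proof. by rewrite -wexp_nat coef_exp. Qed.
Lemma ip_zX f n : ip f (wz ^+ n) = coef f (Posz n).
Proof. by rewrite -wexp_nat ip_exp. Qed.
Lemma ip_natr n f g : ip f (n%:R * g) = n%:R * ip f g.
Proof. by rewrite -wcst_nat ipZr rmorph_nat. Qed.
Lemma hardy_zX n : hardy (wz ^+ n : V).
Proof. by rewrite -wexp_nat; exact: hardy_exp. Qed.
Lemma hardy_natM n f : hardy f -> hardy (n%:R * f).
Proof. by rewrite -wcst_nat; exact: hardyZ. Qed.

(* The coefficients of [z * (3 + 4 z + 3 z^2 + z^3)^2]. *)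
Definition weights : seq nat := [:: 9; 24; 34; 30; 17; 6; 1].

Definition pairing (c : int -> C) : C := \sum_(k < 7) (nth 0%N weights k)%:R * c (Posz k.+1).

(** The test vector [h] has [|h|^2 = 35], and [1225 = 35^2]. It approximates the top eigenvector for
    [datum], whose Hankel matrix has rows (-1,5,5,3), (5,5,3,0), (5,3,0,0), (3,0,0,0) and sends
    (3,4,3,1) to (35,44,27,9). *)
Lemma kyfan1_zb_ge g : hardy g ->
  nrm (pairing (coef g)) ^+ 2 <= 1225 * kyfan 1 (wzb * g).
Proof.
move=> hg; pose h : V := 3%:R * wz ^+ 0 + 4%:R * wz ^+ 1 + 3%:R * wz ^+ 2 + wz ^+ 3.
have hh : hardy h.
  by apply: hardyD; [apply: hardyD; [apply: hardyD|]|]; try apply: hardy_natM; exact: hardy_zX.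
have nh : nn h = 35.
  rewrite nn_ip {2}/h !ipDr !ip_natr !ip_zX /h !coefD !coef_natM !coef_zX /=.
  ring.
have -> : pairing (coef g) = ip (hank (wzb * g) h) h.
  rewrite ip_projl// ipE.
  have -> : wzb * g * wconj h * wconj h = g * wconj (wz * h * h) by rewrite !wconjM wconj_z; ring.
  rewrite -ipE.
  have -> : wz * h * h = 9%:R * wz ^+ 1 + 24%:R * wz ^+ 2 + 34%:R * wz ^+ 3 + 30%:R * wz ^+ 4
     + 17%:R * wz ^+ 5 + 6%:R * wz ^+ 6 + 1%:R * wz ^+ 7 by rewrite /h; ring.
  by rewrite /pairing !big_ord_recr big_ord0 /= add0r !ipDr !ip_natr !ip_zX.
apply: le_trans (cauchy_schwarz _ _) _; rewrite nh.
have := nn_hank_kyfan (wzb * g) hh; rewrite nh; lra.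
Qed.

End SpectralBounds.

(** * Square integrable functions and Sobolev norms *)

Section SquareIntegrable.
Context {R : realType}.
Local Notation C := R[i].
Local Notation mu := (@lebesgue_measure R).
Local Notation per := (@period R).
Local Notation V := (walg R).
Implicit Types (f g : R -> C) (k : int).

Lemma twopi_gt0 : 0 < 2 * pi :> R.
Proof. by rewrite mulr_gt0// pi_gt0. Qed.

Lemma measurable_nrm2 f : cmeas f -> measurable_fun per (fun x => nrm (f x) ^+ 2).
Proof. by move=> mf; apply: measurable_funX; exact: measurable_nrm. Qed.

Lemma L2norm_ltP f (e : R) : cmeas f -> (L2norm f < e%:E)%E ->
  mu.-integrable per (EFin \o (fun x => nrm (f x) ^+ 2)) /\
  (2 * pi)^-1 * Rintegral mu per (fun x => nrm (f x) ^+ 2) <= e ^+ 2.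
Proof.
move=> mf; rewrite /L2norm.
set I := (\int[_]_(_ in _) _)%E.
have I0 : (0 <= I)%E by apply: integral_ge0 => x _; rewrite lee_fin sqr_ge0.
have c0 : 0 < (2 * pi)^-1 :> R by rewrite invr_gt0 twopi_gt0.
rewrite poweR12_sqrt; last by rewrite mule_ge0// lee_fin ltW.
have : {I = +oo%E} + {exists2 r : R, 0 <= r & I = r%:E}.
  by move: I0; case: I => [r|_|//]; [right; exists r|left].
move=> [Ioo|[r r0 Ir]].
  by rewrite Ioo gt0_muley ?lte_fin//= ltNge leey.
rewrite Ir /= lte_fin => re.
have e0 : 0 < e by apply: le_lt_trans re; exact: sqrtr_ge0.
split; last first.
  have -> : Rintegral mu per (fun x => nrm (f x) ^+ 2) = r by rewrite /Rintegral -/I Ir.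
  rewrite -(@sqr_sqrtr _ ((2 * pi)^-1 * r)); last by rewrite mulr_ge0// ltW.
  by apply: sqr_mono; [exact: sqrtr_ge0|exact: ltW].
apply/integrableP; split; first by apply/measurable_EFinP; exact: measurable_nrm2.
rewrite (_ : (\int[_]_(x in _) _)%E = I) ?Ir ?ltry//.
by rewrite -Ir; apply: eq_integral => x _; rewrite /= ger0_norm// sqr_ge0.
Qed.

Lemma cmeas_setT f : measurable_fun setT (fun x => complex.Re (f x)) ->
  measurable_fun setT (fun x => complex.Im (f x)) -> cmeas f.
Proof. by move=> f1 f2; split; exact: measurable_funTS. Qed.

Lemma L2_cmeas f : L2 f -> cmeas f.
Proof. by case=> _ f1 f2 _; exact: cmeas_setT. Qed.

Lemma L2norm_bounded f : (L2norm f < +oo)%E -> exists e : R, (L2norm f < e%:E)%E.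
Proof.
case: (L2norm f) => [r _|//|_]; last by exists 0; rewrite ltNyr.
by exists (r + 1); rewrite lte_fin ltrDl.
Qed.

Lemma cint_square f : cmeas f -> mu.-integrable per (EFin \o (fun x => nrm (f x) ^+ 2)) -> cint f.
Proof.
move=> mf i2; apply: (@cint_dom _ _ (fun x => 1 + nrm (f x) ^+ 2)) => //.
  have := integrableD (measurable_period (R := R)) (integrable_cst_period 1) i2.
  by apply: eq_integrable => //; exact: measurable_period.
by move=> x _; have := sqr_ge0 (nrm (f x) - 1); rewrite sqrrB1; have := nrm_ge0 (f x); lra.
Qed.

Lemma cint_L2 f : L2 f -> cint f.
Proof.
move=> f2; have mf := L2_cmeas f2; case: f2 => _ _ _ /L2norm_bounded[e fe].
by apply: cint_square => //; case: (L2norm_ltP mf fe).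
Qed.

(** The pointwise inequality [x <= x^2 / (2 e) + e / 2], tuned to the bound [e], is integrated in
    place of Cauchy-Schwarz. *)
Lemma nrm_fourier_L2 f k (e : R) : cmeas f -> 0 < e -> (L2norm f < e%:E)%E -> nrm (fourier f k) <= e.
Proof.
move=> mf e0 fe; have [i2 h] := L2norm_ltP mf fe.
have cf := cint_square mf i2; have mp := measurable_period (R := R).
apply: le_trans (nrm_fourier_int k cf) _.
have p0 := twopi_gt0; have e2 : 0 < 2 * e by rewrite mulr_gt0.
pose I := Rintegral mu per (fun x => nrm (f x) ^+ 2).
have iZ : mu.-integrable per (EFin \o (fun x => (2 * e)^-1 * nrm (f x) ^+ 2)).
  by have := integrableZl mp (2 * e)^-1 i2; apply: eq_integrable.
have le : Rintegral mu per (fun x => nrm (f x)) <= (2 * e)^-1 * I + e / 2 * (2 * pi).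
  have -> : (2 * e)^-1 * I + e / 2 * (2 * pi) =
      Rintegral mu per (fun x => (2 * e)^-1 * nrm (f x) ^+ 2 + e / 2).
    rewrite RintegralD//; last exact: integrable_cst_period.
    have -> : Rintegral mu per (fun=> e / 2) = e / 2 * (2 * pi).
      by rewrite Rintegral_cst//= [X in fine X]mu_period.
    by rewrite RintegralZl.
  apply: le_Rintegral => //; first exact: integrable_nrm.
    have := integrableD mp iZ (integrable_cst_period (e / 2)).
    by apply: eq_integrable.
  move=> x _; have -> : (2 * e)^-1 * nrm (f x) ^+ 2 + e / 2 =
     nrm (f x) + (nrm (f x) - e) ^+ 2 / (2 * e) by field; rewrite gt_eqF.
  by rewrite lerDl divr_ge0 ?sqr_ge0 ?ltW.
apply: le_trans (ler_wpM2l _ le) _; first by rewrite invr_ge0 ltW.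
have -> : (2 * pi)^-1 * ((2 * e)^-1 * I + e / 2 * (2 * pi)) = (2 * e)^-1 * ((2 * pi)^-1 * I) + e / 2.
  by rewrite mulrDr mulrCA; congr (_ + _); rewrite mulrC mulfK// gt_eqF.
have : (2 * e)^-1 * ((2 * pi)^-1 * I) <= (2 * e)^-1 * e ^+ 2.
  by apply: ler_wpM2l => //; rewrite invr_ge0 ltW.
rewrite (_ : (2 * e)^-1 * e ^+ 2 = e / 2); last by field; rewrite gt_eqF.
lra.
Qed.

Lemma L2norm_bnd f (B : R) : cmeas f -> 0 <= B -> (forall x, per x -> nrm (f x) <= B) ->
  (L2norm f <= B%:E)%E.
Proof.
move=> mf B0 fB; rewrite /L2norm; have p0 := twopi_gt0.
set I := (\int[_]_(_ in _) _)%E.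
have I0 : (0 <= I)%E by apply: integral_ge0 => x _; rewrite lee_fin sqr_ge0.
have IB : (I <= (B ^+ 2 * (2 * pi))%:E)%E.
  apply: (@le_trans _ _ (\int[mu]_(x in per) (cst (B ^+ 2)%:E) x)%E); last first.
    rewrite integral_cst; last exact: measurable_period.
    by rewrite [X in (_ * X)%E]mu_period -EFinM.
  apply: ge0_le_integral => /=; try exact: measurable_period; try exact: measurable_cst.
  all: try by move=> x _; rewrite lee_fin sqr_ge0.
  all: try by apply/measurable_EFinP; exact: measurable_nrm2.
  by move=> x px; rewrite lee_fin; apply: sqr_mono; [exact: nrm_ge0|exact: fB].
rewrite poweR12_sqrt; last by rewrite mule_ge0// lee_fin ltW// invr_gt0.
have : exists2 r : R, I = r%:E & r <= B ^+ 2 * (2 * pi).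
  move: I0 IB; case: I => [r _|//|//]; first by rewrite lee_fin; exists r.
move=> [r -> rB]; rewrite /= lee_fin -[leRHS](ger0_norm B0) -sqrtr_sqr ler_wsqrtr//.
by rewrite ler_pdivrMl// mulrC.
Qed.

Lemma L2_walg (F : V) : L2 F.
Proof.
have wF := walgP F; split.
- exact: wiener_per wF.
- by apply: continuous_measurable_fun; exact: wiener_contRe wF.
- by apply: continuous_measurable_fun; exact: wiener_contIm wF.
- apply: (@le_lt_trans _ _ (wn F)%:E); last exact: ltry.
  by apply: L2norm_bnd; [exact: walg_cmeas|exact: wn_ge0|move=> x _; exact: nrm_le_wn].
Qed.

Lemma L2_ae_eq f g : L2 f -> L2 g -> (forall k, fourier f k = fourier g k) ->
  {ae mu, forall x, per x -> f x = g x}.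
Proof. by move=> f2 g2; apply: fourier_inj_ae; exact: cint_L2. Qed.

Lemma cvge0P (T : Type) (F : set_system T) (h : T -> \bar R) : Filter F ->
  (forall x, (0 <= h x)%E) ->
  h @ F --> 0%E <-> forall e : R, 0 < e -> \forall x \near F, (h x < e%:E)%E.
Proof.
move=> FF h0; rewrite (_ : 0%E = 0%:E)//; split.
  move/fine_cvgP => [hf /cvgr0Pnorm_lt hc] e e0.
  apply: filterS2 hf (hc e e0) => x hx; rewrite -(fineK hx) lte_fin.
  exact: le_lt_trans (ler_norm _).
move=> hc; apply/fine_cvgP; split.
  apply: filterS (hc 1 ltr01) => x hx; rewrite ge0_fin_numE//.
  exact: lt_trans hx (ltry _).
apply/cvgr0Pnorm_lt => e e0; apply: filterS (hc e e0) => x hx /=.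
have hf : h x \is a fin_num by rewrite ge0_fin_numE// (lt_trans hx (ltry _)).
by rewrite ger0_norm ?fine_ge0// -lte_fin fineK.
Qed.

Lemma L2norm_ge0 f : (0 <= L2norm f)%E. Proof. exact: poweR_ge0. Qed.

Lemma szego_proj_coef f g k : is_szego_proj f g ->
  fourier g k = if 0 <= k then fourier f k else 0.
Proof.
move=> [g2 gf]; apply/eqP; rewrite -subr_eq0; apply/eqP/nrm_eq0/eqP.
rewrite eq_le nrm_ge0 andbT; apply/ler_addgt0Pr => e e0; rewrite add0r.
have cg := cint_L2 g2.
pose s n : seq int := [seq Posz i | i <- iota 0 n].
have us n : uniq (s n) by rewrite map_inj_uniq ?iota_uniq// => x y [].
have sE n x : \sum_(0 <= j < n) fourier f j%:Z * expi j%:Z x = \sum_(j <- s n) fourier f j * expi j x.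
  by rewrite /s big_map /index_iota subn0.
have cs n : cint (fun x => g x - \sum_(0 <= j < n) fourier f j%:Z * expi j%:Z x).
  have -> : (fun x => g x - \sum_(0 <= j < n) fourier f j%:Z * expi j%:Z x) =
     (fun x => g x + -1 * (\sum_(j <- s n) fourier f j * expi j x)).
    by apply/funext => x; rewrite sE mulN1r.
  by apply: cintD => //; apply: cintZ; exact: cint_sum.
have [N _ hN] : \forall n \near \oo,
   (L2norm (fun x => (g x - \sum_(0 <= k < n) fourier f k%:Z * expi k%:Z x)%R) < e%:E)%E.
  by have := (cvge0P _ (fun n => L2norm_ge0 _)).1 gf e e0; apply.
pose n := maxn N (idx k).+1.
have := nrm_fourier_L2 k (cint_meas (cs n)) e0 (hN n (leq_maxl _ _)).
suff -> : fourier (fun x => g x - \sum_(0 <= j < n) fourier f j%:Z * expi j%:Z x) k =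
    fourier g k - (if 0 <= k then fourier f k else 0) by [].
rewrite fourierB//; last first.
  rewrite (_ : (fun x => _) = (fun x => \sum_(j <- s n) fourier f j * expi j x)); first exact: cint_sum.
  by apply/funext => x; rewrite sE.
congr (_ - _).
rewrite (_ : (fun x => _) = (fun x => \sum_(j <- s n) fourier f j * expi j x)); last first.
  by apply/funext => x; rewrite sE.
rewrite fourier_finsum//; congr (if _ then _ else _).
case: k @n => m n.
  by rewrite /s mem_map ?mem_iota /= ?add0n ?leq_maxr// => x y [].
by apply/negbTE/negP => /mapP[].
Qed.

(** Summable coefficients make the partial sums converge uniformly. The projection therefore exists,
    and [szego_proj] does not take its default value. *)
Lemma szego_proj_walg f (F : V) : (forall k, fourier f k = coef F k) -> is_szego_proj f (wproj F).
Proof.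
move=> fF; split; first exact: L2_walg.
pose tail n : V := wproj F - \sum_(0 <= j < n) wcst (coef F j%:Z) * wexp j%:Z.
have valD (f1 f2 : V) x : (f1 + f2) x = f1 x + f2 x by [].
have valB (f1 f2 : V) x : (f1 - f2) x = f1 x - f2 x by [].
have val_sum n x : (\sum_(0 <= j < n) wcst (coef F j%:Z) * wexp j%:Z : V) x =
    \sum_(0 <= j < n) fourier f j%:Z * expi j%:Z x.
  elim: n => [|n IH]; first by rewrite !big_geq.
  by rewrite !big_nat_recr// valD IH fF.
have tailE n : (fun x => wproj F x - \sum_(0 <= k < n) fourier f k%:Z * expi k%:Z x) = tail n.
  by apply/funext => x; rewrite /tail valB val_sum.
have coef_tail n k : coef (tail n) k = if (n%:Z <= k) then coef F k else 0.
  rewrite /tail coefB coef_proj coef_sum; under eq_bigr do rewrite coefZ coef_exp.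
  case: k => k; last first.
    by rewrite big1 ?subr0// => j _; rewrite mulr0.
  rewrite /= lez_nat; case: leqP => kn.
    rewrite big_nat_cond big1 ?subr0// => j /andP[/andP[_ jn] _].
    by rewrite eqz_nat ltn_eqF ?mulr0// (leq_trans jn).
  rewrite big_mkord (bigD1 (Ordinal kn))//= eqxx mulr1 big1 ?addr0 ?subrr// => j jk.
  rewrite eqz_nat; case: eqP => [e|]; last by rewrite mulr0.
  by move: jk; rewrite -val_eqE /= e eqxx.
have wn_tail e : 0 < e -> exists N, forall n, (N <= n)%N -> wn (tail n) <= e.
  move=> e0; have [N hN] := wn_wtr F e0; exists N => n Nn.
  apply: le_trans (hN n Nn); apply: wn_le => m; apply: le_trans (sum_le_wn _ (ints_uniq m)).
  apply: ler_sum => j _; rewrite coef_tail coefB coef_wtr.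
  case: ifP => [nj|_]; last by rewrite nrm0 nrm_ge0.
  by rewrite ifF ?subr0//; case: j nj => j /=; rewrite ?lez_nat//; lia.
apply/cvge0P => [n|e e0]; first exact: L2norm_ge0.
have e2 : 0 < e / 2 by rewrite divr_gt0.
have [N hN] := wn_tail _ e2; exists N => // n Nn /=; rewrite tailE.
apply: (@le_lt_trans _ _ (e / 2)%:E); last by rewrite lte_fin; lra.
apply: L2norm_bnd; [exact: walg_cmeas|exact: ltW|move=> x _].
by apply: le_trans (nrm_le_wn _ _) _; exact: hN.
Qed.

End SquareIntegrable.

(** * Embedding of [H^s] into the Wiener algebra *)

Section Sobolev.
Context {R : realType}.
Local Notation C := R[i].
Local Notation V := (walg R).
Implicit Types (f g : R -> C) (s : R) (k j : int) (c : int -> C).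

Definition wt s k : R := (1 + k%:~R ^+ 2) `^ s.

Lemma wt_base_ge1 k : 1 <= 1 + k%:~R ^+ 2 :> R.
Proof. by rewrite lerDl sqr_ge0. Qed.

Lemma wt_gt0 s k : 0 < wt s k.
Proof. by rewrite powR_gt0// (lt_le_trans ltr01) ?wt_base_ge1. Qed.

Lemma wt_ge1 s k : 0 <= s -> 1 <= wt s k.
Proof. by move=> s0; rewrite -(powRr0 (1 + k%:~R ^+ 2)) ler_powR ?wt_base_ge1. Qed.

Lemma sqrte_leP (x : \bar R) (B : R) : (0 <= x)%E -> 0 <= B ->
  (x `^ 2^-1 <= B%:E)%E = (x <= (B ^+ 2)%:E)%E.
Proof.
move=> x0 B0; rewrite poweR12_sqrt//; case: x x0 => [r|_|//]; last by rewrite /= !leye_eq.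
rewrite !lee_fin => r0; apply/idP/idP => h.
  by rewrite -(sqr_sqrtr r0); apply: sqr_mono => //; exact: sqrtr_ge0.
by rewrite -[leRHS]ger0_norm// -sqrtr_sqr ler_wsqrtr.
Qed.

Lemma wterm_ge0 s c k : 0 <= wt s k * nrm (c k) ^+ 2.
Proof. by rewrite mulr_ge0 ?sqr_ge0// ltW// wt_gt0. Qed.

Lemma Hnorm_ge0 s f : (0 <= Hnorm s f)%E. Proof. exact: poweR_ge0. Qed.

Lemma Hnorm_ge s f (B : R) (r : seq int) : uniq r -> (Hnorm s f <= B%:E)%E ->
  \sum_(j <- r) wt s j * nrm (fourier f j) ^+ 2 <= B ^+ 2.
Proof.
move=> ur hB; have B0 : 0 <= B by rewrite -lee_fin (le_trans (Hnorm_ge0 s f)).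
move: hB; rewrite /Hnorm sqrte_leP//; last first.
  by apply: esum_ge0 => k _; rewrite lee_fin; exact: (wterm_ge0 s (fourier f)).
move=> hB; rewrite -lee_fin; apply: le_trans hB; apply: esum_ge.
exists [set` r]; first by split => //; exact: finite_seq.
by rewrite -fsbig_seq// sumEFin.
Qed.

Lemma Hnorm_le s f (B : R) : 0 <= B ->
  (forall m, \sum_(j <- ints m) wt s j * nrm (fourier f j) ^+ 2 <= B ^+ 2) -> (Hnorm s f <= B%:E)%E.
Proof.
move=> B0 hB; rewrite /Hnorm sqrte_leP//; last first.
  by apply: esum_ge0 => k _; rewrite lee_fin; exact: (wterm_ge0 s (fourier f)).
apply: ge_ereal_sup => _ [X [fX _] <-]; rewrite fsbig_finite// sumEFin lee_fin.
have [n hn] := seq_idx_bound (finmap.enum_fset (fset_set X)).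
apply: le_trans (hB n); apply: (sum_sub_ints (wterm_ge0 s (fourier f))) => //.
exact: finmap.fset_uniq.
Qed.

(* Bernoulli's inequality in the form that makes [k^(-1-sigma)] telescope. *)
Lemma powR_telescope (sigma : R) (k : nat) : 0 < sigma ->
  sigma * k.+2%:R `^ (- (1 + sigma)) <= k.+1%:R `^ (- sigma) - k.+2%:R `^ (- sigma).
Proof.
move=> s0; have a0 : 0 < k.+1%:R :> R by rewrite ltr0n.
have b0 : 0 < k.+2%:R :> R by rewrite ltr0n.
have -> : k.+2%:R `^ (- (1 + sigma)) = k.+2%:R `^ (- sigma) / k.+2%:R :> R.
  rewrite opprD addrC powRD; last by rewrite (gt_eqF b0) implybT.
  by rewrite powR_inv1 ?ltW.
have -> : k.+1%:R `^ (- sigma) = k.+2%:R `^ (- sigma) * expR (sigma * (ln k.+2%:R - ln k.+1%:R)) :> R.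
  by rewrite /powR !gt_eqF// -expRD; congr expR; ring.
have p0 : 0 < k.+2%:R `^ (- sigma) :> R by rewrite powR_gt0.
have h : (k.+2%:R)^-1 <= ln k.+2%:R - ln k.+1%:R :> R.
  rewrite -lerN2 opprB -ln_div ?posrE//.
  have -> : k.+1%:R / k.+2%:R = 1 + - (k.+2%:R)^-1 :> R.
    by rewrite [k.+2%:R]mulrS; field; rewrite -mulrS gt_eqF.
  by apply: le_ln1Dx; rewrite ltrN2 invf_lt1// ltr1n.
have := expR_ge1Dx (sigma * (ln k.+2%:R - ln k.+1%:R)).
have : sigma * (k.+2%:R)^-1 <= sigma * (ln k.+2%:R - ln k.+1%:R) by rewrite ler_pM2l.
set E := expR _; set x := sigma * (_ - _); set p := _ `^ _ => h1 h2.
rewrite mulrCA; have -> : p * E - p = p * (E - 1) by ring.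
by rewrite ler_pM2l//; apply: le_trans h1 _; lra.
Qed.

Lemma wt_inv_le s (n : nat) k : 0 < s -> (k%:~R : R) ^+ 2 = n%:R ^+ 2 ->
  (wt s k)^-1 <= 2 `^ s * n.+1%:R `^ (- (2 * s)).
Proof.
move=> s0 kn; have w0 := wt_gt0 s k.
have n0 : 0 < n.+1%:R `^ (2 * s) :> R by rewrite powR_gt0// ltr0n.
rewrite powRN ler_pdivlMr// mulrC ler_pdivrMr//.
have -> : n.+1%:R `^ (2 * s) = (n.+1%:R ^+ 2) `^ s :> R by rewrite powRrM powR_mulrn.
rewrite /wt kn -powRM ?addr_ge0 ?sqr_ge0//.
apply: ge0_ler_powR; rewrite ?nnegrE ?sqr_ge0 ?mulr_ge0 ?addr_ge0 ?sqr_ge0 ?(ltW s0)//.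
by rewrite mulrS; have := sqr_ge0 (n%:R - 1 : R); rewrite !expr2; lra.
Qed.

(** Comparison with the telescoping series of [powR_telescope] for [sigma = 2 s - 1], whose
    positivity is where [s > 1/2] enters. *)
Lemma wt_inv_summ s : 2^-1 < s -> summ (fun j => (wt s j)^-1).
Proof.
move=> s2; pose sigma := 2 * s - 1.
have sg0 : 0 < sigma by rewrite /sigma; lra.
have s0 : 0 < s by lra.
pose T (k : nat) : R := k.+1%:R `^ (- sigma).
pose K := 2 `^ s / sigma.
have K0 : 0 < K by rewrite divr_gt0// powR_gt0.
have step (k : nat) j : (j%:~R : R) ^+ 2 = k.+1%:R ^+ 2 -> (wt s j)^-1 <= K * (T k - T k.+1).
  move=> jk; apply: le_trans (wt_inv_le s0 jk) _.
  have := powR_telescope k sg0; rewrite (_ : 1 + sigma = 2 * s); last by rewrite /sigma; ring.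
  rewrite /K mulrAC ler_pdivlMr// => h; rewrite -mulrA; apply: ler_wpM2l; first exact: powR_ge0.
  by rewrite mulrC.
have T0 (k : nat) : 0 <= T k by exact: powR_ge0.
have tele m : \sum_(0 <= k < m) K * (T k - T k.+1) <= K.
  rewrite -mulr_sumr ger_pMr//.
  have -> : \sum_(0 <= k < m) (T k - T k.+1) = T 0%N - T m.
    elim: m => [|m IH]; first by rewrite big_geq// subrr.
    by rewrite big_nat_recr//= IH; ring.
  by have := T0 m; rewrite /T powR1; lra.
exists (1 + K + K) => m; rewrite sum_intsE big_split /=; apply: lerD.
  apply: (@le_trans _ _ (\sum_(0 <= k < m.+1) (wt s (Posz k))^-1)).
    by rewrite big_nat_recr//= lerDl invr_ge0 ltW// wt_gt0.
  rewrite big_nat_recl//; apply: lerD; first by rewrite invf_le1 ?wt_gt0// wt_ge1// ltW.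
  by apply: le_trans (tele m); apply: ler_sum => k _; exact: step.
apply: le_trans (tele m); apply: ler_sum => k _; apply: step.
by rewrite NegzE mulrNz sqrrN.
Qed.

(** Young's inequality term by term with a free parameter: [l] equal to the norm bound gives the
    embedding; [l] large, against a small tail of the inverse weights, gives compactness in
    [cluster_point]. *)
Lemma weighted_sum_le s c (r : seq int) (l : R) : 0 < l ->
  \sum_(j <- r) nrm (c j) <=
  (l * \sum_(j <- r) (wt s j)^-1 + l^-1 * \sum_(j <- r) wt s j * nrm (c j) ^+ 2) / 2.
Proof.
move=> l0; rewrite !mulr_sumr -big_split /= mulr_suml; apply: ler_sum => j _.
have w0 := wt_gt0 s j; set w := wt s j in w0 *; set x := nrm _.
have -> : (l * w^-1 + l^-1 * (w * x ^+ 2)) / 2 = x + (l - w * x) ^+ 2 / (2 * l * w).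
  by field; rewrite !gt_eqF.
by rewrite lerDl divr_ge0 ?sqr_ge0// !mulr_ge0// ltW.
Qed.

Definition wt_tot s : R := tot (fun j => (wt s j)^-1).

Lemma wt_tot_ge0 s : 2^-1 < s -> 0 <= wt_tot s.
Proof. by move=> s2; apply: tot_ge0 (wt_inv_summ s2) => j; rewrite invr_ge0 ltW// wt_gt0. Qed.

Lemma embedding_sum s c (B : R) m : 2^-1 < s -> 0 < B ->
  \sum_(j <- ints m) wt s j * nrm (c j) ^+ 2 <= B ^+ 2 ->
  \sum_(j <- ints m) nrm (c j) <= B * (wt_tot s + 1) / 2.
Proof.
move=> s2 B0 hB; apply: le_trans (weighted_sum_le s c _ B0) _.
rewrite ler_wpM2r ?invr_ge0// mulrDr mulr1; apply: lerD.
  by rewrite ler_pM2l//; exact: sum_le_tot (wt_inv_summ s2).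
by rewrite ler_pdivrMl// -expr2.
Qed.

Lemma asum_Hnorm s f : 2^-1 < s -> (Hnorm s f < +oo)%E -> asum (fourier f).
Proof.
move=> s2 fs; have [B [B0 hB]] : exists B : R, 0 < B /\ (Hnorm s f <= B%:E)%E.
  move: fs (Hnorm_ge0 s f); case: (Hnorm s f) => [r _ r0|//|//].
  exists (r + 1); rewrite lee_fin; split; last by rewrite lerDl.
  by rewrite ltr_wpDl// -lee_fin.
exists (B * (wt_tot s + 1) / 2) => m; apply: (embedding_sum s2 B0).
exact: Hnorm_ge (ints_uniq m) hB.
Qed.

Lemma wn_Hnorm s f (F : V) (B : R) : 2^-1 < s -> 0 < B -> (forall k, coef F k = fourier f k) ->
  (Hnorm s f <= B%:E)%E -> wn F <= B * (wt_tot s + 1) / 2.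
Proof.
move=> s2 B0 cF hB; apply: wn_le => m; apply: (embedding_sum s2 B0).
by under eq_bigr do rewrite cF; exact: Hnorm_ge (ints_uniq m) hB.
Qed.

(** The element of the algebra with the coefficients of [f], or [0] if there is none. *)
Definition walg_of f : V := xget 0 [set F | forall k, coef F k = fourier f k].

Lemma coef_walg_of f k : asum (fourier f) -> coef (walg_of f) k = fourier f k.
Proof.
move=> af; rewrite /walg_of; case: xgetP => [F -> //|/(_ (wmk (wiener_synth af))) []] j /=.
by rewrite coefE; exact: fourier_synth.
Qed.

End Sobolev.

(** * Cluster points of bounded trajectories *)

Section Compactness.
Context {R : realType}.
Local Notation C := R[i].
Local Notation V := (walg R).

(** The limit is the supremum of the levels that [f] reaches on a set of the ultrafilter. *)
Lemma ultra_limit (T : Type) (U : set_system T) (f : T -> R) (A : R) : UltraFilter U ->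
  U [set t | `|f t| <= A] -> exists l, forall e, 0 < e -> U [set t | `|f t - l| <= e].
Proof.
move=> UU fA; pose S := [set a | U [set t | a <= f t]].
have UP : ProperFilter U by exact: ultra_proper.
have SA : S (- A) by apply: filterS fA => t /=; rewrite ler_norml => /andP[].
have hS : has_sup S.
  split; first by exists (- A).
  exists A => a Sa; have [t [/= h1 h2]] := filter_ex (filterI Sa fA).
  by apply: le_trans h1 (le_trans (ler_norm _) h2).
exists (sup S) => e e0.
have [a Sa ae] := sup_adherent e0 hS.
have up : U [set t | f t <= sup S + e].
  have [//|nU] := in_ultra_setVsetC [set t | f t <= sup S + e] UU.
  have : S (sup S + e) by apply: filterS nU => t /= /negP; rewrite -ltNge => /ltW.
  by move/(sup_upper_bound hS); rewrite gerDl leNgt e0.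
by apply: filterS2 Sa up => t /= h1 h2; rewrite ler_norml; lra.
Qed.

(** An ultrafilter finer than [t -> +oo] within [G] makes all the coefficients converge at once, in
    place of a diagonal extraction. *)
Lemma pointwise_cluster (c : R -> int -> C) (G : set R) (A : R) :
  (forall T, exists2 t, G t & T <= t) -> (forall t, G t -> forall j, nrm (c t j) <= A) ->
  exists v : int -> C, forall (r : seq int) (e T : R), 0 < e ->
    exists t, [/\ G t, T <= t & forall j, j \in r -> nrm (c t j - v j) <= e].
Proof.
move=> unb bnd; pose F := within G (pinfty_nbhs R).
have FF : ProperFilter F.
  split; last exact: within_filter.
  rewrite /F /within /= => -[M [_ hM]]; have [t Gt Mt] := unb (M + 1).
  by apply: (hM t) => //; lra.
have [U [UU FU]] := ultraFilterLemma FF.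
have UP : ProperFilter U by exact: ultra_proper.
have UG : U G by apply: FU; exists 0; split => //; exact: real0.
have lim j : {l : C | forall e, 0 < e -> U [set t | nrm (c t j - l) <= e]}.
  apply: cid.
  have [a ha] := @ultra_limit _ U (fun t => complex.Re (c t j)) A UU
    (filterS (fun t Gt => le_trans (absRe_le _) (bnd t Gt j)) UG).
  have [b hb] := @ultra_limit _ U (fun t => complex.Im (c t j)) A UU
    (filterS (fun t Gt => le_trans (absIm_le _) (bnd t Gt j)) UG).
  exists (Complex a b) => e e0; have e2 : 0 < e / 2 by rewrite divr_gt0.
  apply: filterS2 (ha _ e2) (hb _ e2) => t /= h1 h2.
  apply: le_trans (nrm_le_ReIm _) _; move: h1 h2; case: (c t j) => x y /=; lra.
exists (fun j => sval (lim j)) => r e T e0.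
have UT : U [set t | T <= t] by apply: FU; exists T; split => [|x /ltW]; rewrite ?num_real.
have Ur : U [set t | forall j, j \in r -> nrm (c t j - sval (lim j)) <= e].
  elim: r => [|j r IH]; first by apply: filterS UG.
  have := svalP (lim j) e e0; apply: filterS2 IH => t /= h1 h2 k.
  by rewrite inE => /orP[/eqP->|]; [|exact: h1].
have [t [[Gt Tt] ht]] := filter_ex (filterI (filterI UG UT) Ur).
by exists t.
Qed.

(** The coefficientwise limit inherits the [H^s] bound through finite sums; then finitely many
    coefficients are close by convergence, and the tails are uniformly small in the Wiener norm
    because [s > 1/2]. *)
Lemma cluster_point (U : R -> V) (G : set R) (s A : R) : 2^-1 < s -> 0 <= A ->
  (forall T, exists2 t, G t & T <= t) ->
  (forall t, G t -> forall m, \sum_(j <- ints m) wt s j * nrm (coef (U t) j) ^+ 2 <= A ^+ 2) ->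
  exists v, forall e T, 0 < e -> exists t, [/\ G t, T <= t & wn (U t - v) <= e].
Proof.
move=> s2 A0 unb bnd; have s0 : 0 <= s by lra.
have cA t : G t -> forall j, nrm (coef (U t) j) <= A.
  move=> Gt j; have [m jm] := seq_idx_bound [:: j].
  have := @sum_sub_ints R (fun j => wt s j * nrm (coef (U t) j) ^+ 2) [:: j] m
    (wterm_ge0 s (coef (U t))) isT jm.
  rewrite big_seq1 => /le_trans/(_ (bnd t Gt m)) h.
  rewrite -(@ler_pXn2r _ 2) ?nnegrE ?nrm_ge0//; apply: le_trans h.
  by rewrite ler_peMl ?sqr_ge0// wt_ge1.
have [v hv] := pointwise_cluster (c := fun t => coef (U t)) unb cA.
have vA m : \sum_(j <- ints m) wt s j * nrm (v j) ^+ 2 <= A ^+ 2.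
  pose W := \sum_(j <- ints m) wt s j.
  have W0 : 0 <= W by apply: sumr_ge0 => j _; rewrite ltW// wt_gt0.
  (* For [0 < e <= 1] and [x <= A], [(x + e)^2 <= x^2 + (2 A + 1) e]. *)
  apply: (@le_vanishing R _ _ (W * (2 * A + 1))) => [|e e0 e1]; first by rewrite mulr_ge0//; lra.
  have [t [Gt _ ht]] := hv (ints m) e 0 e0.
  apply: (@le_trans _ _ (\sum_(j <- ints m) (wt s j * nrm (coef (U t) j) ^+ 2 + wt s j * ((2 * A + 1) * e)))).
    rewrite big_seq [leRHS]big_seq; apply: ler_sum => j jm.
    rewrite -mulrDr; apply: ler_wpM2l; first by rewrite ltW// wt_gt0.
    have h1 := ht j jm; have h2 := cA t Gt j.
    have h3 : nrm (v j) <= nrm (coef (U t) j) + e.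
      have -> : v j = coef (U t) j - (coef (U t) j - v j) by ring.
      by apply: le_trans (nrmB _ _) _; rewrite lerD2l.
    have := nrm_ge0 (v j); have := nrm_ge0 (coef (U t) j).
    by set x := nrm _ in h2 h3 *; set y := nrm _ in h3 *; rewrite !expr2; nra.
  rewrite big_split /= -mulr_suml -/W mulrA lerD2r; exact: bnd.
have vs : asum v.
  exists ((A + 1) * (wt_tot s + 1) / 2) => m; apply: (embedding_sum s2); first by rewrite ltr_wpDl.
  by apply: le_trans (vA m) _; apply: sqr_mono => //; rewrite lerDl.
pose w : V := wmk (wiener_synth vs).
have cw j : coef w j = v j by rewrite coefE; exact: fourier_synth.
exists w => e T e0.
(* The weighted energy of the difference is at most [4 A^2], so this [l] brings its share below
   [e / 2]; the tail of the inverse weights is then taken below [e / (2 l)]. *)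
pose l := (8 * A ^+ 2 + 1) / e.
have l0 : 0 < l by rewrite divr_gt0// ltr_wpDl// mulr_ge0// sqr_ge0.
have e2 : 0 < e / (2 * l) by rewrite divr_gt0// mulr_gt0.
have wi0 j : 0 <= (wt s j)^-1 by rewrite invr_ge0 ltW// wt_gt0.
have [N hN] := tot_tail wi0 (wt_inv_summ s2) e2.
pose n : R := (size (ints N))%:R + 1.
have n0 : 0 < n by rewrite ltr_wpDl.
have e3 : 0 < e / (2 * n) by rewrite divr_gt0// mulr_gt0.
have [t [Gt Tt ht]] := hv (ints N) _ T e3; exists t; split => //.
pose d j := coef (U t) j - v j.
apply: wn_le => m; under eq_bigr do rewrite coefB cw -/(d _).
pose M := maxn m N.
apply: (@le_trans _ _ (\sum_(j <- ints M) nrm (d j))).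
  by apply: ints_mono (leq_maxl _ _) => j; exact: nrm_ge0.
rewrite (bigID (fun j => j \in ints N)) /=.
have h1 : \sum_(j <- ints M | j \in ints N) nrm (d j) <= e / 2.
  have -> : \sum_(j <- ints M | j \in ints N) nrm (d j) = \sum_(j <- ints N) nrm (d j).
    rewrite -big_filter; apply: perm_big; apply: uniq_perm.
    - by rewrite filter_uniq// ints_uniq.
    - exact: ints_uniq.
    - move=> j; rewrite mem_filter; case jN: (j \in ints N) => //=.
      by move: jN; rewrite !mem_ints => jN; rewrite (leq_trans jN)// leq_maxr.
  apply: (@le_trans _ _ (\sum_(j <- ints N) e / (2 * n))).
    by rewrite big_seq [leRHS]big_seq; apply: ler_sum => j jN; exact: ht.
  rewrite big_const_seq count_predT iter_addr_0 -[leLHS]mulr_natr.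
  have -> : e / 2 = e / (2 * n) * n by field; rewrite gt_eqF.
  by rewrite ler_pM2l// /n lerDl.
have h2 : \sum_(j <- ints M | j \notin ints N) nrm (d j) <= e / 2.
  pose r := [seq j <- ints M | j \notin ints N]; rewrite -[leLHS]big_filter -/r.
  apply: le_trans (weighted_sum_le s d r l0) _.
  have tail : \sum_(j <- r) (wt s j)^-1 <= e / (2 * l).
    have := hN N (leqnn N); have := sum_le_tot M (wt_inv_summ s2).
    rewrite (bigID (fun j => j \in ints N)) /= -[X in _ + X]big_filter -/r.
    have -> : \sum_(j <- ints M | j \in ints N) (wt s j)^-1 = \sum_(j <- ints N) (wt s j)^-1.
      rewrite -big_filter; apply: perm_big; apply: uniq_perm.
      - by rewrite filter_uniq// ints_uniq.
      - exact: ints_uniq.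
      - move=> j; rewrite mem_filter; case jN: (j \in ints N) => //=.
        by move: jN; rewrite !mem_ints => jN; rewrite (leq_trans jN)// leq_maxr.
    lra.
  have ener : \sum_(j <- r) wt s j * nrm (d j) ^+ 2 <= 4 * A ^+ 2.
    apply: (@le_trans _ _ (\sum_(j <- ints M) wt s j * nrm (d j) ^+ 2)).
      rewrite [leRHS](bigID (fun j => j \in ints N)) /= -[X in _ + X]big_filter -/r lerDr.
      by apply: sumr_ge0 => j _; exact: (wterm_ge0 s d).
    apply: (@le_trans _ _ (\sum_(j <- ints M) (2 * (wt s j * nrm (coef (U t) j) ^+ 2) + 2 * (wt s j * nrm (v j) ^+ 2)))).
      apply: ler_sum => j _; have w0 := wt_gt0 s j; set x := wt s j in w0 *.
      have h := nrmB (coef (U t) j) (v j); rewrite -/(d j) in h.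
      have := nrm_ge0 (d j); set p := nrm (d j) in h *; set q := nrm _ in h *; set y := nrm _ in h *.
      have : p ^+ 2 <= 2 * q ^+ 2 + 2 * y ^+ 2.
        have := sqr_ge0 (q - y); rewrite !expr2; have := nrm_ge0 (d j); rewrite -/p; nra.
      by move=> h4 _; nra.
    rewrite big_split /= -!mulr_sumr; have := bnd t Gt M; have := vA M; lra.
  have h3 : l * \sum_(j <- r) (wt s j)^-1 <= e / 2.
    have -> : e / 2 = l * (e / (2 * l)) by field; rewrite gt_eqF.
    by rewrite ler_pM2l.
  have h4 : l^-1 * \sum_(j <- r) wt s j * nrm (d j) ^+ 2 <= e / 2.
    rewrite ler_pdivrMl//; apply: le_trans ener _; rewrite /l.
    have -> : (8 * A ^+ 2 + 1) / e * (e / 2) = 4 * A ^+ 2 + 2^-1 by field; rewrite gt_eqF.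
    by rewrite lerDl invr_ge0.
  lra.
lra.
Qed.

End Compactness.

(** * Solutions of the equation *)

Section Cubic.
Context {R : realType}.
Local Notation C := R[i].
Local Notation mu := (@lebesgue_measure R).
Local Notation per := (@period R).
Local Notation V := (walg R).
Implicit Types (f g : R -> C) (F : V) (k : int).

Lemma cubicE f x : cubic f x = f x * conjc (f x) * f x.
Proof. by rewrite /cubic mul_conj -nrmC -rmorphXn. Qed.

Lemma cmeas_cubic f : cmeas f -> cmeas (cubic f).
Proof.
move=> mf; rewrite (_ : cubic f = fun x => f x * conjc (f x) * f x); last by apply/funext => x; exact: cubicE.
by apply: cmeasM => //; apply: cmeasM => //; exact: cmeas_conj.
Qed.

Lemma coef_ae f F k : cmeas f -> {ae mu, forall x, per x -> F x = f x} -> fourier f k = coef F k.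
Proof. by move=> mf Ff; rewrite coefE; apply/esym/fourier_ae => //; exact: walg_cint. Qed.

Lemma ae_of_coef f F : cint f -> (forall k, coef F k = fourier f k) ->
  {ae mu, forall x, per x -> F x = f x}.
Proof.
by move=> cf fF; apply: fourier_inj_ae => [||k] //; [exact: walg_cint|rewrite -coefE].
Qed.

Lemma cubic_ae f F : {ae mu, forall x, per x -> F x = f x} ->
  {ae mu, forall x, per x -> cub F x = cubic f x}.
Proof. by apply: aeS => x h px; rewrite cubicE -h. Qed.

Lemma inner_one f : inner f fun_one = fourier f 0.
Proof.
rewrite /fourier /inner; congr (_ * _); apply: cintegral_ext => x _.
by rewrite expi0.
Qed.

Lemma shift_adj_ae f F : fourier f 0 = coef F 0 -> {ae mu, forall x, per x -> F x = f x} ->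
  {ae mu, forall x, per x -> sadj F x = hardy_shift_adj f x}.
Proof.
by move=> f0; apply: aeS => x h px; rewrite /hardy_shift_adj inner_one f0 -h.
Qed.

Lemma cmeas_shift_adj f : cmeas f -> cmeas (hardy_shift_adj f).
Proof.
move=> mf; apply: cmeasM; first exact: cmeas_expi.
by apply: cmeasB => //; exact: cmeas_cst.
Qed.

(** [f] agrees almost everywhere with an element of the algebra, hence so does its cubic expression,
    and the projection of the equation is computed by [wproj]. *)
Lemma szego_proj_cubic f F : cmeas f -> {ae mu, forall x, per x -> F x = f x} ->
  L2 (szego_proj (cubic f)) /\ forall k, fourier (szego_proj (cubic f)) k = coef (wproj (cub F)) k.
Proof.
move=> mf Ff; have c k : fourier (cubic f) k = coef (cub F) k.
  by apply: coef_ae; [exact: cmeas_cubic|exact: cubic_ae].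
have ex : is_szego_proj (cubic f) (szego_proj (cubic f)).
  by apply: (@xgetPex _ (fun=> 0) [set g | is_szego_proj (cubic f) g]); exists (wproj (cub F) : R -> C); exact: szego_proj_walg.
by split=> [|k]; [case: ex|rewrite (szego_proj_coef k ex) coef_proj c].
Qed.

End Cubic.

Section Solution.
Context {R : realType}.
Local Notation C := R[i].
Local Notation mu := (@lebesgue_measure R).
Local Notation per := (@period R).
Local Notation V := (walg R).
Variables (s nu alpha beta : R) (u : R -> R -> C).
Hypothesis s_gt : 2^-1 < s.
Hypothesis sol : szego_solution s nu alpha beta u.

Definition lift_sol (t : R) : V := walg_of (u t).
Local Notation U := lift_sol.

Lemma sol_L2 t : 0 <= t -> L2 (u t).
Proof. by case: sol => h _ _ /h [[]]. Qed.

Lemma coef_lift t k : 0 <= t -> coef (U t) k = fourier (u t) k.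
Proof.
move=> t0; apply: coef_walg_of; apply: (asum_Hnorm s_gt).
by case: sol => h _ _; case: (h t t0) => [[]].
Qed.

Lemma hardy_lift t : 0 <= t -> hardy (U t).
Proof.
move=> t0 k k0; rewrite coef_lift//; case: sol => h _ _.
by case: (h t t0) => _ [_] /(_ k k0).
Qed.

Lemma cont_lift (t e : R) : 0 <= t -> 0 < e ->
  exists2 d : R, 0 < d & forall r : R, 0 <= r -> `|r - t| < d -> wn (U r - U t) <= e.
Proof.
move=> t0 e0; case: sol => _ /(_ t t0) hc _.
have Z0 := wt_tot_ge0 s_gt.
have B0 : 0 < 2 * e / (wt_tot s + 1) by rewrite divr_gt0 ?mulr_gt0// ltr_wpDl.
have : nbhs t (fun r : R => 0 <= r -> (Hnorm s (u r \- u t)%R < (2 * e / (wt_tot s + 1))%:E)%E).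
  exact: (cvge0P _ (fun r => Hnorm_ge0 s (u r \- u t))).1 hc _ B0.
move=> /nbhs_ballP[d /= d0 hd].
exists d => // r r0 rt.
have bt : ball t d r by rewrite /ball /= distrC.
have -> : e = 2 * e / (wt_tot s + 1) * (wt_tot s + 1) / 2 by field; rewrite gt_eqF// ltr_wpDl.
apply: (@wn_Hnorm _ s (u r \- u t)) => //; last exact: ltW (hd r bt r0).
move=> k; rewrite coefB !coef_lift// -fourierB//; exact: cint_L2 (sol_L2 _).
Qed.

Lemma ae_lift t : 0 <= t -> {ae mu, forall x, per x -> U t x = u t x}.
Proof. by move=> t0; apply: ae_of_coef => [|k]; [exact: cint_L2 (sol_L2 _)|exact: coef_lift]. Qed.

(** Equality almost everywhere becomes equality of Fourier coefficients, where the equation is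
    solved for the derivative by multiplying by [- i]. *)
Lemma velocity_coef t (du : R -> C) k : 0 <= t -> L2 du ->
  {ae mu, forall x, per x ->
     'i%C * du x + 'i%C * real_complex R nu * inner (u t) fun_one =
     szego_proj (cubic (u t)) x + real_complex R alpha * inner (u t) fun_one
     - real_complex R beta * hardy_shift (szego_proj (cubic (hardy_shift_adj (u t)))) x} ->
  fourier du k = coef (vfield nu alpha beta (U t)) k.
Proof.
move=> t0 d2 eqn; have mf := L2_cmeas (sol_L2 t0).
have Uf := ae_lift t0; have f0 : fourier (u t) 0 = coef (U t) 0 by rewrite coef_lift.
have [P2 Pc] := szego_proj_cubic mf Uf.
have [Q2 Qc] := szego_proj_cubic (cmeas_shift_adj mf) (shift_adj_ae f0 Uf).
set P := szego_proj (cubic (u t)) in eqn P2 Pc *.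
set Q := szego_proj (cubic (hardy_shift_adj (u t))) in eqn Q2 Qc *.
have cP := cint_L2 P2; have cQ := cint_L2 Q2; have cd := cint_L2 d2.
pose g0 := coef (U t) 0.
have cst_coef (c : C) : fourier (fun=> c) k = if k == 0 then c else 0.
  by rewrite -coef_cst coefE.
have cS : cint (hardy_shift Q).
  by apply: cint_ext (cintM_expi 1 cQ) => x _; rewrite /hardy_shift mulrC.
have lhs : fourier (fun x => 'i%C * du x + 'i%C * nu%:C%C * g0) k =
    'i%C * fourier du k + (if k == 0 then 'i%C * nu%:C%C * g0 else 0).
  by rewrite (fourierD k (cintZ 'i%C cd) (cint_cst _)) (fourierZ _ _ cd) cst_coef.
have cPa : cint (fun x => P x + alpha%:C%C * g0) by apply: cintD => //; exact: cint_cst.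
have cbS : cint (fun x => beta%:C%C * hardy_shift Q x) by exact: cintZ.
have rhs : fourier (fun x => P x + alpha%:C%C * g0 - beta%:C%C * hardy_shift Q x) k =
    coef (wproj (cub (U t))) k + (if k == 0 then alpha%:C%C * g0 else 0)
    - beta%:C%C * coef (wproj (cub (sadj (U t)))) (k - 1).
  rewrite (fourierB k cPa cbS) (fourierD k cP (cint_cst _)) cst_coef Pc (fourierZ _ _ cS).
  congr (_ - _ * _); rewrite -Qc -fourier_shift.
  by apply: fourier_ext => x _; rewrite /hardy_shift mulrC.
have : fourier (fun x => 'i%C * du x + 'i%C * nu%:C%C * g0) k =
    fourier (fun x => P x + alpha%:C%C * g0 - beta%:C%C * hardy_shift Q x) k.
  apply: fourier_ae.
  - by apply: cintD; [exact: cintZ|exact: cint_cst].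
  - by apply: cmeasB; exact: cint_meas.
  - by move: eqn; apply: aeS => x h px; have := h px; rewrite inner_one f0.
rewrite lhs rhs coef_vfield -/g0 !coef_proj /damping => h.
have {h} : 'i%C * fourier du k = (if 0 <= k then coef (cub (U t)) k else 0)
  + (if k == 0 then alpha%:C%C * g0 else 0)
  - beta%:C%C * (if 0 <= k - 1 then coef (cub (sadj (U t))) (k - 1) else 0)
  - (if k == 0 then 'i%C * nu%:C%C * g0 else 0) by rewrite -h; ring.
have ii : 'i%C * 'i%C = -1 :> C by apply/eqP; rewrite eq_complex /=; apply/andP; split; apply/eqP; ring.
move=> h; have -> : fourier du k = - 'i%C * ('i%C * fourier du k) by rewrite mulrA mulNr ii opprK mul1r.
rewrite h; set A := if 0 <= k then _ else _; set B := if 0 <= k - 1 then _ else _.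
case: (k == 0); last by ring.
have -> : - 'i%C * (A + alpha%:C%C * g0 - beta%:C%C * B - 'i%C * nu%:C%C * g0) =
  - ('i%C * A) - 'i%C * alpha%:C%C * g0 + 'i%C * beta%:C%C * B + ('i%C * 'i%C) * nu%:C%C * g0 by ring.
rewrite ii; ring.
Qed.

(** The L^2 norm of a difference quotient bounds each of its coefficients. *)
Lemma diff_lift (t : R) k (e : R) : 0 <= t -> 0 < e ->
  exists2 d : R, 0 < d & forall r : R, 0 <= r -> `|r - t| < d ->
    nrm (coef (U r) k - coef (U t) k - (r - t)%:C%C * coef (vfield nu alpha beta (U t)) k) <= e * `|r - t|.
Proof.
move=> t0 e0; case: sol => _ _ /(_ t t0) [du [d2 hd] eqn].
rewrite -(velocity_coef k t0 d2 eqn).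
have cd := cint_L2 d2; have ct := cint_L2 (sol_L2 t0).
have : nbhs t (fun r : R => r != t -> 0 <= r ->
    (L2norm (fun x => ((r - t)^-1%:C%C * (u r x - u t x) - du x)%R) < e%:E)%E).
  exact: (cvge0P _ (fun r => L2norm_ge0 _)).1 hd _ e0.
move=> /nbhs_ballP[d /= d0 h].
exists d => // r r0 rt; rewrite !coef_lift//.
have [->|nrt] := eqVneq r t; first by rewrite !subrr mul0r subrr nrm0 normr0 mulr0.
have bt : ball t d r by rewrite /ball /= distrC.
have cr := cint_L2 (sol_L2 r0).
have cdiff : cint (fun x => u r x - u t x).
  have := cintD cr (cintZ (-1) ct); apply: cint_ext => x _; by rewrite mulN1r.
have cq : cint (fun x => (r - t)^-1%:C%C * (u r x - u t x) - du x).
  have := cintD (cintZ (r - t)^-1%:C%C cdiff) (cintZ (-1) cd); apply: cint_ext => x _; by rewrite mulN1r.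
have := nrm_fourier_L2 k (cint_meas cq) e0 (h r bt nrt r0).
rewrite (fourierB k (cintZ _ cdiff) cd) (fourierZ _ _ cdiff) (fourierB k cr ct).
move=> hq; have rt0 : r - t != 0 by rewrite subr_eq0.
have -> : fourier (u r) k - fourier (u t) k - (r - t)%:C%C * fourier du k =
   (r - t)%:C%C * ((r - t)^-1%:C%C * (fourier (u r) k - fourier (u t) k) - fourier du k).
  have e1 : (r - t)%:C%C * (r - t)^-1%:C%C = 1 :> C by rewrite -rmorphM divff.
  by rewrite [RHS]mulrBr [X in _ = X - _]mulrA e1 mul1r.
by rewrite nrmM nrm_real mulrC ler_wpM2r.
Qed.

Hypothesis nu_gt0 : 0 < nu.
Hypothesis beta_neq1 : beta != 1.

Theorem bounded_kyfan_le : ~ (Hnorm s (u t) @[t --> +oo] --> +oo%E) ->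
  2 * kyfan 1 (wzb * U 0) <= kyfan 2 (wzb * U 0) + nn (U 0).
Proof.
move=> ncvg.
(* Failure of divergence bounds the norm only along some arbitrarily late times; hence cluster
   points, and windows that start at such times. *)
have [A hA] : exists A : R, forall T, exists2 t, (0 <= t /\ (Hnorm s (u t) <= A%:E)%E) & T <= t.
  apply: contrapT => hn; apply: ncvg; apply/cvgeyPge => A.
  apply: contrapT => hA; apply: hn; exists A => T.
  (* The maximum with 0 restricts to the times at which the equation holds. *)
  apply: contrapT => hT; apply: hA; exists (Num.max 0 T); split; first exact: num_real.
  move=> t; rewrite gt_max => /andP[t0 Tt]; rewrite leNgt; apply/negP => lt; apply: hT.
  by exists t; [split; exact: ltW|exact: ltW].
pose G := [set t | 0 <= t /\ (Hnorm s (u t) <= A%:E)%E].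
have A0 : 0 <= A.
  by have [t [_ tA] _] := hA 0; rewrite -lee_fin (le_trans (Hnorm_ge0 s (u t))).
have [v hv] : exists v, forall e T, 0 < e -> exists t, [/\ G t, T <= t & wn (U t - v) <= e].
  apply: (cluster_point s_gt A0) hA _ => t [t0 tA] m.
  under eq_bigr do rewrite coef_lift//.
  exact: Hnorm_ge (ints_uniq m) tA.
apply: (no_cluster_point hardy_lift cont_lift diff_lift nu_gt0 beta_neq1 (v := v)) => e T e0.
by have [t [[t0 _] Tt tv]] := hv e T e0; exists t.
Qed.

End Solution.

(** * The open set and the stationary datum *)

Section Datum.
Context {R : realType}.
Local Notation C := R[i].
Local Notation mu := (@lebesgue_measure R).
Local Notation per := (@period R).
Local Notation V := (walg R).
Implicit Types (f g : R -> C) (F : V) (k : int).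

Definition energy f (N : nat) : R := \sum_(0 <= n < N) n.+1%:R * nrm (fourier f (Posz n)) ^+ 2.

(* The bound on [q] makes [2 * kyfan 1 > kyfan 2 + |u|^2] at a point of [domain], since
   [35 ^ 2 = 1225] and [(141 / 100) ^ 2 < 2]. *)
Definition domain : set (R -> C) := [set f | Hplus 2^-1 f /\ exists q : R,
  [/\ 0 < q, forall N, energy f N <= q ^+ 2 & 35 * q < 141 / 100 * nrm (pairing (fourier f))]].

Lemma pairingB (c d : int -> C) : pairing (fun k => c k - d k) = pairing c - pairing d.
Proof. by rewrite /pairing -sumrB; apply: eq_bigr => k _; rewrite mulrBr. Qed.

Lemma eq_pairing (c d : int -> C) : c =1 d -> pairing c = pairing d.
Proof. by move=> cd; apply: eq_bigr => k _; rewrite cd. Qed.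

Lemma nrm_nat n : nrm (n%:R : C) = n%:R.
Proof. by rewrite -(rmorph_nat (real_complex R)) nrm_real normr_nat. Qed.

Lemma nrm_pairing (c : int -> C) (e : R) : (forall k, nrm (c k) <= e) -> nrm (pairing c) <= 121 * e.
Proof.
move=> ce; apply: le_trans (nrm_sum _ _ _) _.
apply: (@le_trans _ _ (\sum_(k < 7) (nth 0%N weights k)%:R * e)).
  by apply: ler_sum => k _; rewrite nrmM nrm_nat ler_wpM2l.
rewrite -mulr_suml.
have -> : \sum_(k < 7) (nth 0%N weights k)%:R = 121 :> R by rewrite !big_ord_recr big_ord0 /=; ring.
by [].
Qed.

(** Compares the weights of [energy] with those of the [H^{1/2}] norm, which thus controls
    [energy]. *)
Lemma wt_half_ge (n : nat) : n.+1%:R <= 2 * wt 2^-1 (Posz n) :> R.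
Proof.
have b0 : 0 <= 1 + (Posz n)%:~R ^+ 2 :> R by rewrite addr_ge0 ?sqr_ge0.
rewrite /wt powR12_sqrt// -(@ler_pXn2r _ 2) ?nnegrE ?mulr_ge0 ?sqrtr_ge0// exprMn sqr_sqrtr//.
rewrite -[(Posz n)%:~R]/(n%:R) mulrS; have := sqr_ge0 (n%:R - 1 : R); rewrite !expr2.
have := ler0n R n; nra.
Qed.

(** Termwise form of Minkowski's inequality: when the sums of [y^2] and [z^2] are at most [q^2] and
    [p^2], the right-hand sides add up to at most [(q + p)^2] by [sqr_add_eq]. *)
Lemma sqr_add_le (p q x y z : R) : 0 < p -> 0 < q -> 0 <= x -> x <= y + z ->
  x ^+ 2 <= (1 + p / q) * y ^+ 2 + (1 + q / p) * z ^+ 2.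
Proof.
move=> p0 q0 x0 xyz; apply: le_trans (sqr_mono x0 xyz) _.
have -> : (1 + p / q) * y ^+ 2 + (1 + q / p) * z ^+ 2 = (y + z) ^+ 2 + (p * y - q * z) ^+ 2 / (p * q).
  by field; rewrite !gt_eqF.
by rewrite lerDl divr_ge0 ?sqr_ge0// mulr_ge0// ltW.
Qed.

Lemma sqr_add_eq (p q : R) : 0 < p -> 0 < q ->
  (q + p) ^+ 2 = (1 + p / q) * q ^+ 2 + (1 + q / p) * p ^+ 2.
Proof. by move=> p0 q0; field; rewrite !gt_eqF. Qed.

Lemma open_domain : open_in_Hplus 2^-1 domain.
Proof.
split=> [f []//|f [[[f2 _] _] [q [q0 fq fp]]]].
set S := nrm (pairing (fourier f)) in fp.
(* Moving by [e] raises [35 q] by [70 e] and lowers the other side by at most [141 / 100 * 121 e],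
   together less than the gap [500 e]. *)
have [e [e0 ee]] : exists e : R, 0 < e /\ 20 * (25 * e) = 141 / 100 * S - 35 * q.
  exists ((141 / 100 * S - 35 * q) / 20 / 25); split; last by field.
  by rewrite !divr_gt0// subr_gt0.
exists e => // g Hg lt; split => //; have [[g2 _] _] := Hg.
have cf := cint_L2 f2; have cg := cint_L2 g2.
pose d k := fourier (g \- f) k.
have dE k : d k = fourier g k - fourier f k by rewrite /d fourierB.
have dsum (r : seq int) : uniq r -> \sum_(j <- r) wt 2^-1 j * nrm (d j) ^+ 2 <= e ^+ 2.
  by move=> ur; apply: Hnorm_ge => //; exact: ltW.
have d1 k : nrm (d k) <= e.
  rewrite -(@ler_pXn2r _ 2) ?nnegrE ?nrm_ge0 ?(ltW e0)//.
  have := dsum [:: k] isT; rewrite big_seq1; apply: le_trans.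
  by rewrite ler_peMl ?sqr_ge0// wt_ge1// invr_ge0.
exists (q + 2 * e); split; first by rewrite addr_gt0// mulr_gt0.
(* [p^2 = 4 e^2] covers the energy of the difference, which is at most [2 e^2] since [n + 1] is at
   most twice the [H^{1/2}] weight. *)
- move=> N; have [p pE] : exists p, p = 2 * e by exists (2 * e).
  have p0 : 0 < p by rewrite pE mulr_gt0.
  have dN : \sum_(0 <= n < N) n.+1%:R * nrm (d (Posz n)) ^+ 2 <= p ^+ 2.
    apply: (@le_trans _ _ (2 * e ^+ 2)); last first.
      by have := sqr_ge0 e; rewrite pE !expr2; lra.
    apply: (@le_trans _ _ (2 * \sum_(j <- [seq Posz n | n <- index_iota 0 N]) wt 2^-1 j * nrm (d j) ^+ 2)).
      rewrite big_map mulr_sumr; apply: ler_sum => n _.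
      by rewrite mulrA ler_wpM2r ?sqr_ge0// wt_half_ge.
    by rewrite ler_pM2l//; apply: dsum; rewrite map_inj_uniq ?iota_uniq// => x y [].
  rewrite -pE; apply: (@le_trans _ _ ((1 + p / q) * energy f N
      + (1 + q / p) * \sum_(0 <= n < N) n.+1%:R * nrm (d (Posz n)) ^+ 2)).
    rewrite /energy !mulr_sumr -big_split /=; apply: ler_sum => n _.
    set x := nrm (fourier g _); set y := nrm (fourier f _); set z := nrm (d _).
    have -> : (1 + p / q) * (n.+1%:R * y ^+ 2) + (1 + q / p) * (n.+1%:R * z ^+ 2) =
      n.+1%:R * ((1 + p / q) * y ^+ 2 + (1 + q / p) * z ^+ 2) by ring.
    apply: ler_wpM2l => //.
    have h : x <= y + z.
      have -> : x = nrm (fourier f (Posz n) + d (Posz n)) by rewrite dE subrKC.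
      exact: nrmD.
    have x0 : 0 <= x by exact: nrm_ge0.
    move: x y z h x0 => x y z h x0.
    exact: (sqr_add_le p0 q0 x0 h).
  rewrite (sqr_add_eq p0 q0).
  by apply: lerD; apply: ler_wpM2l => //; rewrite addr_ge0 ?divr_ge0// ltW.
- have : S - 121 * e <= nrm (pairing (fourier g)).
    rewrite lerBlDr /S; have -> : pairing (fourier f) = pairing (fourier g) - pairing d.
      by rewrite (eq_pairing dE) pairingB; ring.
    by apply: le_trans (nrmB _ _) _; rewrite lerD2l nrm_pairing.
  lra.
Qed.

Lemma domain_spectral f F : hardy F -> (forall k, coef F k = fourier f k) -> domain f ->
  kyfan 2 (wzb * F) + nn F < 2 * kyfan 1 (wzb * F).
Proof.
move=> hF Ff [_ [q [q0 fq fp]]].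
have h1 : kyfan 2 (wzb * F) + nn F <= q ^+ 2.
  apply: kyfan2_zb_le => // N; apply: le_trans (fq N).
  by rewrite le_eqVlt; apply/orP; left; apply/eqP; apply: eq_bigr => n _; rewrite Ff.
have h2 := kyfan1_zb_ge hF; rewrite (eq_pairing Ff) in h2.
set S := nrm _ in fp h2.
have q2 : 0 < q ^+ 2 by rewrite exprn_gt0.
have [c cE] : exists c : R, c = (141 / 100) ^+ 2 by eexists.
have c2 : c < 2 by rewrite cE expr2; lra.
have c0 : 0 <= c by rewrite cE sqr_ge0.
have e1 : (35 : R) ^+ 2 = 1225 by ring.
have h3 : 1225 * q ^+ 2 <= c * S ^+ 2.
  by rewrite -e1 cE -!exprMn; apply: sqr_mono; [rewrite mulr_ge0// ltW|exact: ltW].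
have h4 : c * S ^+ 2 <= c * (1225 * kyfan 1 (wzb * F)) by apply: ler_wpM2l.
have k0 : 0 <= kyfan 1 (wzb * F) by exact: kyfan_ge0.
have h5 : q ^+ 2 <= c * kyfan 1 (wzb * F) by lra.
(* Positivity of [q] forces a positive top of the spectrum, which makes the comparison of [c] with 2
   strict. *)
have k1 : 0 < kyfan 1 (wzb * F).
  rewrite lt_neqAle k0 andbT eq_sym; apply/eqP => k1; move: h5; rewrite k1 mulr0; lra.
have : c * kyfan 1 (wzb * F) < 2 * kyfan 1 (wzb * F) by rewrite ltr_pM2r.
lra.
Qed.

(** The square of this polynomial starts with [z^2 - 10 z^3 + 15 z^4], so the mean of [|u|^2 u] is
    [5 - 5 * 10 + 3 * 15 = 0]. The spectral condition holds by a narrow margin: [2 * 371^2 / 1225]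
    is about 224.7, against an energy of 222. *)
Fact datum_seal : {d : V | d = 5%:R * wz ^+ 2 + 5%:R * wz ^+ 3 + 3%:R * wz ^+ 4 - wz ^+ 1}.
Proof. by eexists. Qed.
Definition datum := sval datum_seal.
Lemma datumE : datum = 5%:R * wz ^+ 2 + 5%:R * wz ^+ 3 + 3%:R * wz ^+ 4 - wz ^+ 1.
Proof. exact: (svalP datum_seal). Qed.

Lemma hardy_datum : hardy datum.
Proof.
rewrite datumE; by apply: hardyB; [apply: hardyD; [apply: hardyD|]; apply: hardy_natM|]; exact: hardy_zX.
Qed.

Lemma coef_datum k : coef datum k = 5%:R * (Posz 2 == k)%:R + 5%:R * (Posz 3 == k)%:R
  + 3%:R * (Posz 4 == k)%:R - (Posz 1 == k)%:R.
Proof. by rewrite datumE coefB !coefD !coef_natM !coef_zX. Qed.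

Lemma coef_datum_out k : k \notin ints 5 -> coef datum k = 0.
Proof.
rewrite mem_ints -leqNgt coef_datum => h.
have ne (n : nat) : (n < 5)%N -> (Posz n == k) = false.
  by move=> n5; apply/negP => /eqP e; move: h; rewrite -e /= leqNgt n5.
by rewrite !ne// !mulr0 !addr0 subr0.
Qed.

Lemma Hplus_datum s : Hplus s datum.
Proof.
have d2 := L2_walg datum; split; last first.
  by split => // k k0; rewrite -coefE; exact: hardy_datum.
split => //; pose B := \sum_(j <- ints 5) wt s j * nrm (fourier datum j) ^+ 2.
have B0 : 0 <= B by apply: sumr_ge0 => j _; exact: wterm_ge0.
apply: (@le_lt_trans _ _ (B + 1)%:E); last exact: ltry.
apply: Hnorm_le => [|m]; first by rewrite addr_ge0.
apply: (@le_trans _ _ B); last by rewrite sqrrD1; have := sqr_ge0 B; lra.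
rewrite (bigID (fun j => j \in ints 5)) /= [X in _ + X]big1 ?addr0; last first.
  by move=> j jn; rewrite -coefE coef_datum_out// nrm0 expr0n mulr0.
rewrite -big_filter; apply: (sum_sub_ints (wterm_ge0 s (fourier datum))).
  by rewrite filter_uniq// ints_uniq.
by move=> j; rewrite mem_filter => /andP[j5 _]; rewrite mem_ints in j5.
Qed.

Lemma domain_datum : domain datum.
Proof.
have c0 : coef datum (Posz 0) = 0 by rewrite coef_datum /=; ring.
have c1 : coef datum (Posz 1) = - 1 by rewrite coef_datum /=; ring.
have c2 : coef datum (Posz 2) = 5%:R by rewrite coef_datum /=; ring.
have c3 : coef datum (Posz 3) = 5%:R by rewrite coef_datum /=; ring.
have c4 : coef datum (Posz 4) = 3%:R by rewrite coef_datum /=; ring.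
split; first exact: Hplus_datum.
(* The energy is [2 + 3 * 25 + 4 * 25 + 5 * 9 = 222], below [14.9^2 = 222.01]; the pairing is 371,
   and [35 * 14.9 = 521.5] stays below [1.41 * 371 = 523.11]. *)
exists (149 / 10); split; first by rewrite divr_gt0.
- move=> N; apply: (@le_trans _ _ (energy datum (5 + N))).
    rewrite /energy [leRHS](@big_cat_nat _ _ _ N)//= ?leq_addl// lerDl.
    by apply: sumr_ge0 => n _; rewrite mulr_ge0 ?sqr_ge0.
  rewrite /energy (@big_cat_nat _ _ _ 5)//= ?leq_addr//.
  rewrite [X in _ + X]big_nat_cond [X in _ + X]big1 ?addr0; last first.
    move=> n /andP[/andP[n5 _] _]; rewrite -coefE coef_datum_out ?nrm0 ?expr0n ?mulr0//.
    by rewrite mem_ints /= -leqNgt.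
  rewrite !big_nat_recl// big_geq// -!coefE c0 c1 c2 c3 c4.
  rewrite nrm0 nrmN nrm1 !nrm_nat; lra.
- have -> : pairing (fourier datum) = 371%:R.
    rewrite (eq_pairing (fun k => esym (coefE datum k))) /pairing !big_ord_recr big_ord0 /= !coef_datum /=.
    ring.
  rewrite nrm_nat; lra.
Qed.

Lemma rational_datum : rational_fun datum.
Proof.
exists (5%:R *: 'X^2 + 5%:R *: 'X^3 + 3%:R *: 'X^4 - 'X), 1; split => [z _|x].
  by rewrite hornerC oner_neq0.
rewrite hornerC divr1 !(hornerD, hornerN, hornerZ, hornerXn, hornerX).
have valD (f1 f2 : V) y : (f1 + f2) y = f1 y + f2 y by [].
have valB (f1 f2 : V) y : (f1 - f2) y = f1 y - f2 y by [].
have valM (f1 f2 : V) y : (f1 * f2) y = f1 y * f2 y by [].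
have valX n y : (wz ^+ n : V) y = expi 1 y ^+ n.
  by elim: n => [//|n IH]; rewrite !exprS valM IH.
have valN n y : (n%:R : V) y = n%:R by rewrite -wcst_nat.
by rewrite datumE valB !valD !valM !valN !valX expr1.
Qed.

Lemma mean_cub_datum : coef (cub datum) 0 = 0.
Proof.
have -> : cub datum = (datum * datum) * wconj datum by rewrite /cub; ring.
rewrite -ipE.
have sq : datum * datum = wz ^+ 2 + 15%:R * wz ^+ 4 + 44%:R * wz ^+ 5 + 55%:R * wz ^+ 6 + 30%:R * wz ^+ 7
    + 9%:R * wz ^+ 8 - 10%:R * wz ^+ 3 by rewrite datumE; ring.
have sqE (a b c d e f : nat) k : coef (wz ^+ 2 + a%:R * wz ^+ 4 + b%:R * wz ^+ 5 + c%:R * wz ^+ 6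
    + d%:R * wz ^+ 7 + e%:R * wz ^+ 8 - f%:R * wz ^+ 3 : V) k =
    (Posz 2 == k)%:R + a%:R * (Posz 4 == k)%:R + b%:R * (Posz 5 == k)%:R + c%:R * (Posz 6 == k)%:R
    + d%:R * (Posz 7 == k)%:R + e%:R * (Posz 8 == k)%:R - f%:R * (Posz 3 == k)%:R.
  by rewrite coefB !coefD !coef_natM !coef_zX.
have z (a b c d e f : nat) : ip (wz ^+ 2 + a%:R * wz ^+ 4 + b%:R * wz ^+ 5 + c%:R * wz ^+ 6
    + d%:R * wz ^+ 7 + e%:R * wz ^+ 8 - f%:R * wz ^+ 3) datum = 5%:R - 5%:R * f%:R + 3%:R * a%:R.
  by rewrite datumE ipBr !ipDr !ip_natr !ip_zX !sqE /=; ring.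
rewrite sq z; ring.
Qed.

(** As the mean of [datum] is 0, [S^* u] is [conj(z) u], and the right-hand side is [Pi(|u|^2 u)]
    deprived of its mean, which is 0 by [mean_cub_datum]. *)
Lemma stationary_datum : wproj (cub datum) = wz * wproj (cub (sadj datum)) :> V.
Proof.
have d0 : coef datum 0 = 0 by rewrite coef_datum /= !mulr0 !addr0 subr0.
have -> : cub (sadj datum) = wzb * cub datum.
  rewrite /sadj d0 wcst0 subr0 /cub wconjM wconj_zb.
  rewrite (_ : _ * _ * _ = (wzb * wz) * (wzb * (datum * wconj datum * datum))); last by ring.
  by rewrite wzbz mul1r.
apply: walg_coef => k; rewrite coef_z !coef_proj coef_zb subrK.
case: (eqVneq k 0) => [->|k0] /=; first exact: mean_cub_datum.
case: (leP 0 k) => k1; first by rewrite ifT//; lia.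
by rewrite ifF//; lia.
Qed.

(** For [beta = 1] the two cubic terms cancel, and the vanishing mean of [datum] removes the terms
    in [nu] and [alpha]. *)
Lemma datum_solution (nu alpha s : R) : szego_solution s nu alpha 1 (fun=> datum : R -> C).
Proof.
have cd := walg_cint datum; have md := walg_cmeas datum.
have d0 : fourier datum 0 = 0 by rewrite -coefE coef_datum /= !mulr0 !addr0 subr0.
split=> [t _|t _|t _]; first exact: Hplus_datum.
  apply/cvge0P => [r|e e0]; first exact: Hnorm_ge0.
  apply: nearW => r; apply: (@le_lt_trans _ _ 0%:E); last by rewrite lte_fin.
  apply: Hnorm_le => // m; rewrite big1 ?sqr_ge0// => j _.
  by rewrite fourierB// subrr nrm0 expr0n mulr0.
exists (fun=> 0).
  split; first exact: (L2_walg 0).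
  apply/cvge0P => [r|e e0]; first exact: L2norm_ge0.
  apply: nearW => r; apply: (@le_lt_trans _ _ 0%:E); last by rewrite lte_fin.
  have -> : (fun x => (r - t)^-1%:C%C * (datum x - datum x) - 0) = fun=> 0 :> C.
    by apply/funext => x; rewrite !subrr mulr0 subr0.
  by apply: L2norm_bnd => [||x _]; [exact: cmeas_cst|by []|rewrite nrm0].
have Fd : {ae mu, forall x, per x -> datum x = datum x} by exact: aeW.
have [P2 Pc] := szego_proj_cubic md Fd.
have f0 : fourier datum 0 = coef datum 0 by rewrite coefE.
have [Q2 Qc] := szego_proj_cubic (cmeas_shift_adj md) (shift_adj_ae f0 Fd).
have Pa := L2_ae_eq P2 (L2_walg (wproj (cub datum))) (fun k => etrans (Pc k) (coefE _ k)).
have Qa := L2_ae_eq Q2 (L2_walg (wproj (cub (sadj datum)))) (fun k => etrans (Qc k) (coefE _ k)).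
move: (aeI Pa Qa); apply: aeS => x [hP hQ] px; rewrite hP// /hardy_shift hQ// inner_one d0.
by rewrite stationary_datum !mulr0 !addr0 mul1r subrr.
Qed.

End Datum.

Theorem theorem1p1 (R : realType) (nu : R) (nu_gt0 : 0 < nu) :
  exists Omega : set (R -> R[i]),
    [/\ open_in_Hplus 2^-1 Omega,
        forall s : R, 2^-1 < s -> Omega `&` Hplus s !=set0,
        forall (s alpha beta : R) (u : R -> R -> R[i]),
          2^-1 < s -> beta != 1 ->
          szego_solution s nu alpha beta u ->
          (Omega `&` Hplus s) (u 0) ->
          Hnorm s (u t) @[t --> +oo] --> +oo%E &
        exists f : R -> R[i],
          [/\ Omega f, rational_fun f &
              forall alpha s : R, 2^-1 <= s ->
                szego_solution s nu alpha 1 (fun=> f)]].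
Proof.
exists (@domain R); split.
- exact: open_domain.
- by move=> s _; exists datum; split; [exact: domain_datum|exact: Hplus_datum].
- move=> s alpha beta u s2 beta1 sol [u0 _]; apply: contrapT => ncvg.
  have := bounded_kyfan_le s2 sol nu_gt0 beta1 ncvg.
  have := domain_spectral (hardy_lift s2 sol (lexx 0)) (fun k => coef_lift s2 sol k (lexx 0)) u0.
  by move=> h1 /(lt_le_trans h1); rewrite ltxx.
- exists datum; split; [exact: domain_datum|exact: rational_datum|].
  by move=> alpha s _; exact: datum_solution.
Qed.
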